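(* Let $\alpha>0$, let $U\in\mathcal{RV}'_{1/\alpha}$ satisfy the second-order condition with rate $A(t)$ and second-order parameter $\rho<0$, and let $X_1,\dots,X_n$ be i.i.d. $\sim\mathrm{RV}(U)$. Let $k=k_n$ be an intermediate sequence and let $\theta_k>0$ satisfy $$\theta_k\to0,\qquad k\theta_k^2\to\infty,\qquad |A(n/k)|=O(\theta_k).$$ Let $\tilde H_{k,n}=H_{k,n}-\frac{A(n/k)}{1-\rho}$ be the bias-corrected Hill statistic. Then, as $n\to\infty$, $$-\log\mathbb{P}(\alpha\tilde H_{k,n}>1+\theta_k)\sim\frac k2\theta_k^2\qquad\text{and}\qquad-\log\mathbb{P}(\alpha\tilde H_{k,n}<1-\theta_k)\sim\frac k2\theta_k^2 .$$
   Context: A function $g$ is in $\mathcal{RV}_\gamma$ if $g(tx)/g(t)\to x^\gamma$ as $t\to\infty$ for every $x>0$. $\mathcal{RV}'_\gamma$ is the set of positive, non-decreasing, left-continuous functions in $\mathcal{RV}_\gamma$ (defined on $(1,\infty)$). $X\sim\mathrm{RV}(U)$ means $X\stackrel{d}{=}U(e^E)$ with $E\sim\mathrm{Exp}(1)$ (so $U$ is the tail quantile function of $X$). Second-order condition with rate $A$: $A\in\mathcal{RV}_\rho$ for some $\rho\le0$ (the second-order parameter), $A(t)\to0$, $A(t)\ne0$ for sufficiently large $t$, and for all $x>0$ $$\lim_{t\to\infty}\frac{U(tx)/U(t)-x^{1/\alpha}}{A(t)}=x^{1/\alpha}\int_1^xu^{\rho-1}\,du .$$ Order statistics in decreasing order: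 $X_{1,n}\ge\dots\ge X_{n,n}$; $H_{k,n}=\frac1k\sum_{i=1}^k\log(X_{i,n}/X_{k,n})$. Intermediate sequence: integers $k=k_n$ with $k_n\to\infty$, $k_n/n\to0$; all limits are along this sequence as $n\to\infty$, with $\theta_k$ and $A(n/k)$ evaluated at $k=k_n$. $a\sim b$ means $a/b\to1$. *)

(* Defs.v *)
From HB Require Import structures.
From mathcomp Require Import all_boot all_order all_algebra finmap.
From mathcomp Require Import all_classical all_reals all_analysis.

Set Implicit Arguments.
Unset Strict Implicit.
Unset Printing Implicit Defensive.

Import Order.TTheory GRing.Theory Num.Theory.
Import numFieldNormedType.Exports.

Local Open Scope classical_set_scope.
Local Open Scope ring_scope.

Section RegularVariation.
Context {R : realType}.

Definition RV (gamma : R) (g : R -> R) : Prop :=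
  forall x : R, 0 < x -> g (t * x) / g t @[t --> +oo] --> x `^ gamma.

(* Only the values of [g] on the open half-line (1, +oo) are constrained. *)
Definition RV' (gamma : R) (g : R -> R) : Prop :=
  [/\ RV gamma g,
      forall t : R, 1 < t -> 0 < g t,
      forall s t : R, 1 < s -> s <= t -> g s <= g t &
      forall t : R, 1 < t -> g s @[s --> t^'-] --> g t].

(* [int_(a, b) f] with orientation: minus the integral over [b, a] when b < a. *)
Definition oriented_int (a b : R) (f : R -> R) : R :=
  if a <= b then \int[lebesgue_measure]_(u in `[a, b]) f u
  else - \int[lebesgue_measure]_(u in `[b, a]) f u.

Definition second_order (alpha rho : R) (U A : R -> R) : Prop :=
  [/\ rho <= 0,
      RV rho A,
      A t @[t --> +oo] --> 0,
      \forall t \near +oo, A t != 0 &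
      forall x : R, 0 < x ->
        (U (t * x) / U t - x `^ (alpha^-1)) / A t @[t --> +oo] -->
        x `^ (alpha^-1) * oriented_int 1 x (fun u => u `^ (rho - 1))].

End RegularVariation.

Section Sample.
Context {R : realType} {d : measure_display} {T : measurableType d}.
Variable P : probability T R.

Definition mutually_independent (X : nat -> {RV P >-> R}) : Prop :=
  forall (J : {fset nat}) (B : nat -> set R), (forall i, measurable (B i)) ->
    P [set w | forall i, i \in J -> B i (X i w)] =
    (\prod_(i <- J) P (X i @^-1` B i))%E.

(* X is distributed as U(e^E) with E ~ Exp(1). The null event E <= 0 is
   discarded because U is only meaningful on (1, +oo). *)
Definition dist_RV (U : R -> R) (X : {RV P >-> R}) : Prop :=
  forall B : set R, measurable B ->
    distribution P X B =
    exponential_prob 1 [set e : R | 0 < e /\ B (U (expR e))].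

Definition iid_RV (U : R -> R) (X : nat -> {RV P >-> R}) : Prop :=
  mutually_independent X /\ forall i, dist_RV U (X i).

(* The i-th largest (1 <= i <= n) of the n variables X 0, ..., X (n-1). *)
Definition order_stat (X : nat -> {RV P >-> R}) (i n : nat) (w : T) : R :=
  nth 0 (sort >=%R (mkseq (fun j => X j w) n)) i.-1.

Definition hill (X : nat -> {RV P >-> R}) (k n : nat) (w : T) : R :=
  (k%:R)^-1 *
  \sum_(1 <= i < k.+1) ln (order_stat X i n w / order_stat X k n w).

Definition hill_corrected (rho : R) (A : R -> R) (X : nat -> {RV P >-> R})
    (k n : nat) (w : T) : R :=
  hill X k n w - A (n%:R / k%:R) / (1 - rho).

End Sample.

(* a_n / b_n --> 1, where a_n may be infinite (as -log 0 = +oo). *)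
Definition asymp_equiv {R : realType} (a : nat -> \bar R) (b : nat -> R) : Prop :=
  (a n * ((b n)^-1)%:E)%E @[n --> \oo] --> (1%:E : \bar R).

Definition intermediate {R : realType} (k : nat -> nat) : Prop :=
  k @ \oo --> \oo /\ ((k n)%:R / n%:R : R) @[n --> \oo] --> (0 : R).

(* Main.v *)
(* Write W = theta_k * k * (alpha * tilde H - 1), up to sign, and N = k theta_k^2,
   so that the deviation events are W > N.  Splitting according to which index
   carries X_{k,n} and which indices lie above it, independence turns the
   exponential moments of W into products: given X_{k,n} = U(e^s), the k - 1
   excesses alpha * log (X_i / X_{k,n}) behave like i.i.d. copies of
   alpha * log (U(e^{s+E}) / U(e^s)) with E ~ Exp(1).  The second-order condition,
   made uniform over E and over s near log (n / k), says that this is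
   E + (alpha / rho) * A(n/k) * (e^{rho E} - 1) up to o(A(n/k)); its mean
   1 + alpha * A(n/k) / (1 - rho) is exactly what the bias correction removes, and
   A(n/k) = O(theta_k) makes the other terms negligible.  Hence, on the event that
   log X_{k,n} is close to its typical value, which fails with probability at most
   2 e^{- c k}, the moment E[e^{c W}] is e^{(c^2 / 2 + o(1)) N}.  The upper bound
   is Chernoff's inequality at c = 1; the lower bound compares the exponents
   c = 1, 1 + eta, 1 + 2 eta, which forces W / N to be close to 1 + eta under
   the weight e^{(1 + eta) W}. *)
Require Import Defs.
From HB Require Import structures.
From mathcomp Require Import all_boot all_order all_algebra finmap.
From mathcomp Require Import all_classical all_reals all_analysis.
From mathcomp Require Import measurable_realfun.
From mathcomp Require Import ring lra.

Set Implicit Arguments.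
Unset Strict Implicit.
Unset Printing Implicit Defensive.

Import Order.TTheory GRing.Theory Num.Theory.
Import numFieldNormedType.Exports.

Local Open Scope classical_set_scope.
Local Open Scope ring_scope.

(** * Independence and ranks *)

(** Three obstacles shape the argument. First, the second-order condition is pointwise in [x] and
    [A] is not assumed measurable, so the uniform convergence theorem cannot be applied to [A]
    itself. With [f s = ln (U (e^s)) - s / alpha], the assumption [rho < 0] makes the unit
    increments of [f] decay geometrically; hence [f] has a limit [L], and [b = f - L] is asymptotic
    to [A (e^s) / rho]. This [b] inherits regular variation from [A] and measurability from the
    monotone [U], so the uniform estimates are made on [b]. Second, [U] may jump or be constant on
    intervals: the value [x] of [X_{k,n}] need not determine [s], and ties occur. So [s] is defined
    through the probability [e^{-s}] of exceeding [x], where exceeding is weak or strict according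
    to the order of the indices. Third, no conditional law given [X_{k,n}] is constructed: the
    tilted and untilted expectations are decomposed in the same way and compared term by term, so
    that the law of [X_{k,n}] never has to be computed. *)

Section Independence.
Context {R : realType} {d : measure_display} {T : measurableType d}.
Variable P : probability T R.
Variable X : nat -> {RV P >-> R}.
Hypothesis X_indep : mutually_independent X.

Definition cylinder_without (m : nat) : set (set T) :=
  [set C | exists (J : {fset nat}) (B : nat -> set R),
     [/\ m \notin J, forall i, measurable (B i) &
         C = [set w | forall i, i \in J -> B i (X i w)]]].

Lemma cylinder_fsetE (J : {fset nat}) (B : nat -> set R) :
  [set w | forall i, i \in J -> B i (X i w)] =
  \bigcap_(i in [set` J]) (X i @^-1` B i).
Proof. by apply/seteqP; split => w /= h i; exact: h. Qed.

Lemma measurable_cylinder m : cylinder_without m `<=` measurable.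
Proof.
move=> _ [J [B [_ mB ->]]]; rewrite cylinder_fsetE.
apply: fin_bigcap_measurable => // i _.
by rewrite -[X in measurable X]setTI; exact: measurable_funP.
Qed.

Lemma setI_closed_cylinder m : setI_closed (cylinder_without m).
Proof.
move=> _ _ [J [B [mJ mB ->]]] [K [C [mK mC ->]]].
exists (J `|` K)%fset,
  (fun i => (if i \in J then B i else setT) `&` (if i \in K then C i else setT)).
split.
- by rewrite inE negb_or mJ mK.
- by move=> i; apply: measurableI; case: ifP.
- apply/seteqP; split => w /=.
    move=> [hB hC] i _; split.
      by case: ifP => // iJ; exact: hB.
    by case: ifP => // iK; exact: hC.
  move=> h; split => i hi.
    by have := h i; rewrite inE hi => /(_ isT) [].
  by have := h i; rewrite inE hi orbT => /(_ isT) [].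
Qed.

(** [cylinder_without m] is a pi-system generating the information of the variables other than
    [X m]. On it the identity is [mutually_independent] applied to [J] enlarged by [m]; both sides
    being finite measures in [C], uniqueness of measures extends it to the generated
    sigma-algebra. *)
Lemma cylinder_indep m (B0 : set R) : measurable B0 ->
  forall C, <<s cylinder_without m >> C ->
  P (C `&` X m @^-1` B0) = (P C * P (X m @^-1` B0))%E.
Proof.
move=> mB0.
have mE : measurable (X m @^-1` B0).
  by rewrite -[X in measurable X]setTI; exact: measurable_funP.
have Efin : P (X m @^-1` B0) \is a fin_num by rewrite fin_num_measure.
pose p := NngNum (fine_ge0 (measure_ge0 P (X m @^-1` B0))).
pose m1 := mrestr P mE.
pose m2 := mscale p P.
move=> C mC.
suff : m1 C = m2 C.
  by rewrite /m1 /m2 /mrestr /mscale/= fineK// => ->; rewrite muleC.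
apply: (g_sigma_algebra_measure_unique (cylinder_without m)
   (@measurable_cylinder m) (fun=> setT)) => //.
- move=> _; exists fset0, (fun=> setT); split => //.
  by apply/seteqP; split.
- exact: bigcup_const.
- exact: setI_closed_cylinder.
- move=> _ [J [B [mJ mB ->]]].
  change (P ([set w | forall i, i \in J -> B i (X i w)] `&` X m @^-1` B0) =
    ((fine (P (X m @^-1` B0)))%:E * P [set w | forall i, i \in J -> B i (X i w)])%E).
  rewrite fineK//.
  have := @X_indep (m |` J)%fset (fun i => if i == m then B0 else B i).
  rewrite big_fsetU1//= eqxx.
  rewrite (eq_big_seq (fun i => P (X i @^-1` B i))); last first.
    by move=> i iJ; case: eqP => // im; rewrite -im iJ in mJ.
  rewrite -X_indep// => <-; last by move=> i; case: ifP.
  congr (P _); apply/seteqP; split => w /=.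
    move=> [h hm] i; rewrite !inE => /predU1P[->|iJ]; first by rewrite eqxx.
    by case: eqP => [->//|_]; exact: h.
  move=> h; split; last by have := h m; rewrite !inE eqxx => /(_ isT).
  move=> i iJ; have := h i; rewrite !inE iJ orbT => /(_ isT).
  by case: eqP => // im; rewrite -im iJ in mJ.
- move=> _; change (P ([set: T] `&` X m @^-1` B0) < +oo)%E; rewrite setTI.
  by rewrite (le_lt_trans (probability_le1 _ _))// ltry.
Qed.

Section SeparateCoordinate.
Variable m : nat.
Let T' : measurableType _ := g_sigma_algebraType (cylinder_without m).

Lemma measurable_rv_cylinder (i : nat) : i != m ->
  measurable_fun [set: T'] (X i : T' -> R).
Proof.
move=> im _ B mB; rewrite setTI; apply: sub_sigma_algebra.
exists [fset i]%fset, (fun j => if j == i then B else setT); split.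
- by rewrite inE eq_sym.
- by move=> j; case: ifP.
- apply/seteqP; split => w /=.
    by move=> h j; rewrite inE => /eqP ->; rewrite eqxx.
  by move=> /(_ i); rewrite inE eqxx => /(_ isT).
Qed.

Let idT (w : T) : T' := w.
Let measurable_idT : measurable_fun setT idT.
Proof.
move=> _ C mC; rewrite setTI.
exact: (smallest_sub (@sigma_algebra_measurable _ T) (@measurable_cylinder m)).
Qed.

Local Open Scope ereal_scope.

(** [T'] is the sample space with the coarser sigma-algebra of the other variables. For it the joint
    law of the identity and [X m] is a product measure, by [cylinder_indep], and Tonelli separates
    the two integrations. *)
Lemma fubini_indep (f : T' * R -> \bar R) :
  measurable_fun [set: (T' * R)%type] f -> (forall z, 0 <= f z) ->
  \int[P]_w f (w, X m w) = \int[P]_w \int[P]_v f (w, X m v).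
Proof.
move=> mf f0.
have mpair : measurable_fun [set: T] (fun w : T => (idT w, X m w) : T' * R).
  by apply: measurable_fun_pair => //; exact: measurable_idT.
pose X' : {mfun T >-> T'} := mfun_Sub (mem_set measurable_idT).
pose Y' : {mfun T >-> (T' * R)%type} := mfun_Sub (mem_set mpair).
transitivity (\int[distribution P Y']_z f z).
  by rewrite ge0_integral_distribution.
transitivity (\int[distribution P X' \x distribution P (X m)]_z f z).
  apply: eq_measure_integral => A mA _; apply/esym.
  apply: product_measure_unique => // B C mB mC.
  exact: cylinder_indep.
rewrite fubini_tonelli1//.
rewrite ge0_integral_distribution//=; first last.
- by move=> x; rewrite /fubini_F integral_ge0.
- exact: measurable_fun_fubini_tonelli_F.
apply: eq_integral => w _ /=.
rewrite /fubini_F ge0_integral_distribution//.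
by apply: measurableT_comp.
Qed.

End SeparateCoordinate.

Local Open Scope ereal_scope.

Lemma measurable_indep_mean (h : R * R -> \bar R) (m : nat) :
  measurable_fun setT h -> (forall z, 0 <= h z) ->
  measurable_fun setT (fun x : R => \int[P]_v h (x, X m v)).
Proof.
move=> mh h0.
have <- : fubini_F (distribution P (X m)) h = fun x : R => \int[P]_v h (x, X m v).
  apply/funext => x; rewrite /fubini_F ge0_integral_distribution//.
  by apply: measurableT_comp.
exact: measurable_fun_fubini_tonelli_F.
Qed.

(** Given [X j] the factors are independent, so their conditional means multiply. The variables are
    integrated out one at a time; [g] varies in the induction so as to absorb the means already
    computed, which depend on [X j] alone. *)
Lemma expectation_prod_indep (j : nat) (s : seq nat) (g : R -> \bar R)
    (h : nat -> R * R -> \bar R) :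
  uniq (j :: s) ->
  measurable_fun setT g -> (forall x, 0 <= g x) ->
  (forall i, measurable_fun setT (h i)) -> (forall i z, 0 <= h i z) ->
  \int[P]_w (g (X j w) * \prod_(i <- s) h i (X j w, X i w)) =
  \int[P]_w (g (X j w) * \prod_(i <- s) \int[P]_v h i (X j w, X i v)).
Proof.
move=> + + + mh h0; elim: s g => [|m s IH] g.
  by move=> _ mg g0; under eq_integral do rewrite big_nil;
     under [RHS]eq_integral do rewrite big_nil.
move=> /= /andP[]; rewrite inE negb_or => /andP[jm js] /andP[ms us] mg g0.
pose H x := \int[P]_v h m (x, X m v).
have mH : measurable_fun setT H by exact: measurable_indep_mean.
have H0 x : 0 <= H x by exact: integral_ge0.
transitivity (\int[P]_w (g (X j w) * H (X j w) * \prod_(i <- s) h i (X j w, X i w))).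
  pose T' : measurableType _ := g_sigma_algebraType (cylinder_without m).
  pose f (z : T' * R) := g (X j z.1) * (\prod_(i <- s) h i (X j z.1, X i z.1)) *
     h m (X j z.1, z.2).
  transitivity (\int[P]_w f (w, X m w)).
    by apply: eq_integral => w _; rewrite big_cons /f/= muleCA muleC.
  have mX i : i != m -> measurable_fun [set: T' * R] (fun z => X i z.1).
    move=> im; apply: (measurableT_comp (measurable_rv_cylinder im)).
    exact: measurable_fst.
  have pos0 w : 0 <= \prod_(i <- s) h i (X j w, X i w).
    by rewrite big_seq; apply: prode_ge0 => i.
  rewrite fubini_indep; last 2 first.
  - apply: emeasurable_funM; last first.
      by apply: (measurableT_comp (mh m)); apply: measurable_fun_pair => //; exact: mX.
    apply: emeasurable_funM; first by apply: (measurableT_comp mg); exact: mX.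
    have mXj := mX j jm.
    have {}mX i : i \in s -> measurable_fun [set: T' * R] (fun z => X i z.1).
      by move=> iS; apply: mX; apply: contraNneq ms => <-.
    move: mX; elim: s {IH pos0 js ms us f} => [|a s IH] mX'.
      by under eq_fun do rewrite big_nil; exact: measurable_cst.
    under eq_fun do rewrite big_cons.
    apply: emeasurable_funM; last by apply: IH => i iS; apply: mX'; rewrite inE iS orbT.
    apply: (measurableT_comp (mh a)); apply: measurable_fun_pair; first exact: mXj.
    by apply: mX'; rewrite mem_head.
  - by move=> z; rewrite /f !mule_ge0.
  apply: eq_integral => w _; rewrite /f/=.
  rewrite ge0_integralZl//.
  - by rewrite muleAC.
  - by apply: (measurableT_comp (mh m)); apply: measurable_fun_pair => //;
       exact: measurable_cst.
  - by rewrite mule_ge0.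
rewrite (IH (fun x => g x * H x)).
- by apply: eq_integral => w _; rewrite big_cons /= muleA.
- by rewrite /= js.
- exact: emeasurable_funM.
- by move=> x; rewrite mule_ge0.
Qed.

End Independence.

(** * Ranks and order statistics *)

Section Ranking.
Context {R : realType}.

(* Ties are broken by the index, so that ranks are well defined. *)
Definition ranks_above (x : nat -> R) (i j : nat) : bool :=
  (x j < x i) || ((x i == x j) && (i <= j)%N).

Definition top_set n (x : nat -> R) (j : 'I_n) : {set 'I_n} :=
  [set i : 'I_n | (i != j) && ranks_above x i j].

Variables (n : nat) (x : nat -> R).
Let r (i j : 'I_n) := ranks_above x i j.
Let p := sort r (enum 'I_n).
Let dsort := sort >=%R (mkseq x n).

Let r_total : total r.
Proof.
move=> i j; rewrite /r /ranks_above eq_sym.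
by case: (ltgtP (x i) (x j)) => //= _; exact: leq_total.
Qed.

Let r_trans : transitive r.
Proof.
move=> j i l; rewrite /r /ranks_above => /orP[h1|/andP[/eqP e1 h1]] /orP[h2|/andP[/eqP e2 h2]].
- by rewrite (lt_trans h2 h1).
- by rewrite -e2 h1.
- by rewrite e1 h2.
- by rewrite e1 e2 eqxx (leq_trans h1 h2) orbT.
Qed.

Let r_anti : antisymmetric r.
Proof.
move=> i j /andP[]; rewrite /r /ranks_above eq_sym => /orP[h1|/andP[/eqP e1 h1]] /orP[h2|h2].
- by have := lt_trans h1 h2; rewrite ltxx.
- by move: h2 => /andP[/eqP e2 _]; move: h1; rewrite e2 ltxx.
- by move: h2; rewrite e1 ltxx.
- by move: h2 => /andP[_ h2]; apply/val_inj/eqP; rewrite eqn_leq h1 h2.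
Qed.

Let p_uniq : uniq p. Proof. by rewrite sort_uniq enum_uniq. Qed.
Let p_mem i : i \in p. Proof. by rewrite mem_sort mem_enum. Qed.
Let p_size : size p = n. Proof. by rewrite size_sort size_enum_ord. Qed.

(** Both lists are sorted permutations of the sample, and the order on values is antisymmetric, so
    the way ties are broken does not show. *)
Let dsortE : dsort = [seq x (val i) | i <- p].
Proof.
apply: (@sorted_eq _ >=%R).
- by move=> a b c; exact: ge_trans.
- by move=> a b; exact: ge_anti.
- by apply: sort_sorted => a b; exact: ge_total.
- rewrite sorted_map; have := sort_sorted r_total (enum 'I_n).
  apply: sub_sorted => i j; rewrite /r /ranks_above /= => /orP[/ltW//|/andP[/eqP -> _]].
  exact: lexx.
- rewrite /dsort perm_sort /mkseq -val_enum_ord -map_comp.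
  by apply: perm_map; rewrite perm_sym perm_sort.
Qed.

Lemma top_setE (j : 'I_n) :
  top_set x j = [set i in take (index j p) p].
Proof.
apply/setP => i; rewrite !inE.
have li : (index i p < size p)%N by rewrite index_mem.
have lj : (index j p < size p)%N by rewrite index_mem.
rewrite in_take//.
case: (ltngtP (index i p) (index j p)) => ij.
- have := sorted_ltn_nth r_trans j (sort_sorted r_total _) _ _ li lj ij.
  rewrite !nth_index// => rij.
  rewrite [X in _ && X]rij andbT; apply/eqP => eij; by rewrite eij ltnn in ij.
- have := sorted_ltn_nth r_trans j (sort_sorted r_total _) _ _ lj li ij.
  rewrite !nth_index// => rji.
  case: (eqVneq i j) => //= nij; apply/negP => rij.
  by move/eqP: nij; apply; apply: r_anti; rewrite rji andbT.
- have -> : i = j by rewrite -(nth_index j (p_mem i)) ij nth_index.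
  by rewrite eqxx.
Qed.

Lemma card_top_set (j : 'I_n) : #|top_set x j| = index j p.
Proof.
rewrite top_setE cardsE (card_uniqP _) ?take_uniq//.
by rewrite size_take index_mem p_mem.
Qed.

(** The order [r] is linear, so ranks run through [0, ..., n-1] without repetition, and the events
    that [j] has rank [k] partition the sample space. *)
Lemma exists_rank k : (k < n)%N ->
  exists j : 'I_n, forall j' : 'I_n, (#|top_set x j'| == k) = (j' == j).
Proof.
move=> kn; have j0 : 'I_n := Ordinal kn; exists (nth j0 p k) => j'.
rewrite card_top_set; apply/eqP/eqP => [<-|->]; first by rewrite nth_index.
by rewrite index_uniq ?p_size.
Qed.

Lemma nth_rank k (j : 'I_n) : #|top_set x j| = k -> nth 0 dsort k = x j.
Proof.
rewrite card_top_set => <-.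
by rewrite dsortE (nth_map j) ?nth_index// index_mem.
Qed.

(** Serves for the Hill sum of [k.+1] terms; the summand of [x j] is split off because there it is
    [ln 1 = 0]. *)
Lemma sum_top k (j : 'I_n) (F : R -> R) : #|top_set x j| = k ->
  \sum_(1 <= i < k.+2) F (nth 0 dsort i.-1) = \sum_(i in top_set x j) F (x i) + F (x j).
Proof.
move=> kE; have kn : (k < n)%N by rewrite -kE card_top_set -[X in (_ < X)%N]p_size index_mem.
rewrite big_add1 big_nat_recr//= (nth_rank kE); congr (_ + _).
have -> : top_set x j = [set i in take k p] by rewrite top_setE -card_top_set kE.
transitivity (\sum_(i <- take k p) F (x i)); last first.
  rewrite big_uniq ?take_uniq//=.
  by apply: eq_bigl => i; rewrite inE.
rewrite (big_nth j) size_take p_size kn !big_nat; apply: eq_bigr => i /andP[_ ik].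
by rewrite dsortE (nth_map j) ?p_size ?(ltn_trans ik)// nth_take.
Qed.

End Ranking.

(** * Uniform convergence for slowly and regularly varying functions *)

Section UniformConvergence.
Context {R : realType}.
Local Notation mu := (@lebesgue_measure R).

Lemma lebesgue_measure_translate (y : R) (A : set R) : measurable A ->
  mu [set u | A (u - y)] = mu A.
Proof.
have ms : measurable_fun setT (fun u : measurableTypeR R => u - y : measurableTypeR R).
  exact: measurable_funB.
move=> mA; apply/esym.
apply: (lebesgue_measure_unique (mu := pushforward mu (fun u : measurableTypeR R => u - y : measurableTypeR R))) => //= _ [[a b]] _ <-.
rewrite /pushforward.
have -> : (fun u : measurableTypeR R => u - y : measurableTypeR R) @^-1` `]a, b]%classic =
    `](a + y), (b + y)]%classic.
  by apply/seteqP; split => u /=; rewrite !in_itv/=; lra.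
rewrite !lebesgue_measure_itv/= !lte_fin ltrD2r.
by case: ifP => // _; rewrite -!EFinD; congr (_%:E); lra.
Qed.

Variables (v : R -> R) (mv : measurable_fun setT v).
Hypothesis v_slow : forall y, v (s + y) / v s @[s --> +oo] --> (1 : R).

(** Sets of the measure-theoretic proof of Karamata's uniform convergence theorem; when [t] tends to
    infinity, pointwise convergence says that they exhaust [[0, 2]] as [n] grows. *)
Let good (eta : R) (t : nat -> R) (n : nat) : set R :=
  [set z | 0 <= z <= 2 /\ forall m, (n <= m)%N -> `|v (t m + z) / v (t m) - 1| < eta].

Let measurable_good eta t n : measurable (good eta t n).
Proof.
have -> : good eta t n = `[0, 2]%classic `&`
   \bigcap_(m in [set m | (n <= m)%N]) [set z | `|v (t m + z) / v (t m) - 1| < eta].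
  apply/seteqP; split => z /=; rewrite in_itv/=.
    by move=> [z02 h]; split => // m mn; exact: h.
  by move=> [z02 h]; split => // m mn; exact: h.
apply: measurableI => //; apply: bigcap_measurable; first by exists n => /=.
move=> m _.
rewrite -[X in measurable X]setTI.
apply: (measurable_fun_ltr _ _ measurableT) => //.
apply: measurableT_comp => //; apply: measurable_funB => //.
apply: measurable_funM => //.
apply: (measurableT_comp mv).
exact: measurable_funD.
Qed.

Let good_large eta t : 0 < eta -> (forall m, m%:R <= t m) ->
  exists N, forall n, (N <= n)%N -> (3 / 2 < fine (mu (good eta t n)))%R.
Proof.
move=> eta0 tge.
have tcvg : t @ \oo --> +oo.
  apply/cvgryPge => M; near=> n; apply: (le_trans _ (tge n)).
  by near: n; exact: nbhs_infty_ger.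
have cup : \bigcup_n good eta t n = `[0, 2]%classic.
  apply/seteqP; split => z /=; rewrite in_itv/=; first by move=> [n _ []].
  move=> z02.
  have : v (t m + z) / v (t m) @[m --> \oo] --> (1 : R).
    exact: (cvg_comp _ _ tcvg (v_slow z)).
  move=> /cvgrPdistC_lt /(_ _ eta0) [n _ hN]; exists n => //.
have : mu (good eta t n) @[n --> \oo] --> mu `[0, 2]%classic.
  rewrite -cup; apply: nondecreasing_cvg_mu => //.
    by move=> n; exact: measurable_good.
    by rewrite cup; exact: measurable_itv.
  move=> a b ab; apply/subsetPset => z [z02 h]; split => // m bm.
  by apply: h; exact: leq_trans ab bm.
rewrite lebesgue_measure_itv/= lte_fin ltr0n/= -EFinD subr0.
move=> /fine_cvg/= /cvgrPdist_lt /(_ (1 / 2)) []; first by lra.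
move=> N _ h; exists N => n Nn; have := h n Nn.
by rewrite ltr_norml => /andP[_]; rewrite /= => h1; lra.
Unshelve. all: by end_near. Qed.

(** If uniformity fails along [s n], [y n], the good set of [s n] and that of [s n + y n] translated
    by [y n] both lie in [[0, 3]] and both have measure above 3/2, so they meet. At a common point
    [z], [v (s + z)] is close to both [v s] and [v (s + y)], which makes these two close to each
    other. *)
Lemma slowly_varying_uniform (eps : R) : 0 < eps ->
  exists s0, forall s y, s0 <= s -> 0 <= y <= 1 -> `|v (s + y) / v s - 1| <= eps.
Proof.
move=> eps0; apply: contrapT => H.
have {H} /choice [sy hsy] : forall n : nat, exists p : R * R,
    [/\ n%:R <= p.1, 0 <= p.2 <= 1 & eps < `|v (p.1 + p.2) / v p.1 - 1|].
  move=> n; apply: contrapT => H'; apply: H; exists n%:R => s y ns y01.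
  by rewrite leNgt; apply/negP => h; apply: H'; exists (s, y).
pose s n := (sy n).1; pose y n := (sy n).2.
have sn n : n%:R <= s n by have [] := hsy n.
have y01 n : 0 <= y n <= 1 by have [] := hsy n.
(* If [p] and [q] are within [eta] of 1, then [p - q] is at most [eps / 2] in absolute value and [q]
   is at least 1/2, so [p / q] is within [eps] of 1. *)
pose eta := Num.min (1 / 2) (eps / 4).
have eta0 : 0 < eta by rewrite lt_min; apply/andP; split; lra.
have [N1 h1] := good_large eta0 sn.
have syn n : n%:R <= s n + y n by have := y01 n; have := sn n; lra.
have [N2 h2] := good_large eta0 syn.
pose n := maxn N1 N2.
have {h1} h1 := h1 n (leq_maxl _ _); have {h2} h2 := h2 n (leq_maxr _ _).
pose E := good eta s n; pose F := [set u | good eta (fun n => s n + y n) n (u - y n)].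
have mE : measurable E by exact: measurable_good.
have mF : measurable F.
  have : measurable_fun setT (fun u : R => u - y n) by exact: measurable_funB.
  move=> /(_ measurableT _ (measurable_good eta (fun n => s n + y n) n)).
  by rewrite setTI.
have E03 : E `<=` `[0, 3]%classic by move=> z [+ _]; rewrite /= in_itv/=; lra.
have F03 : F `<=` `[0, 3]%classic.
  by move=> z [+ _]; rewrite /= in_itv/=; have := y01 n; lra.
have mu03 : mu `[0, 3]%classic = 3%:E by rewrite lebesgue_measure_itv/= lte_fin ltr0n/= -EFinD subr0.
have finm (A : set R) : measurable A -> A `<=` `[0, 3]%classic -> mu A \is a fin_num.
  move=> mA sA; rewrite ge0_fin_numE//.
  apply: (@le_lt_trans _ _ (mu `[0, 3]%classic)); last by rewrite mu03 ltry.
  by apply: le_measure => //; rewrite inE.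
have [z [[_ Ez] [_ Fz]]] : exists z, (E `&` F) z.
  apply/set0P/negP => /eqP EF0.
  have : (mu (E `|` F) <= 3%R%:E)%E.
    rewrite -mu03; apply: le_measure; rewrite ?inE//; first exact: measurableU.
    by move=> z [/E03|/F03].
  have -> : (mu (E `|` F) = mu E + mu F)%E by exact: measureU.
  have -> : mu F = mu (good eta (fun n => s n + y n) n).
    exact: (lebesgue_measure_translate (y n) (measurable_good _ _ _)).
  rewrite -(fineK (finm _ mE E03)) -[X in (_ + X)%E]fineK.
    by rewrite -EFinD lee_fin; lra.
  apply: finm; first exact: measurable_good.
  by move=> u [+ _]; rewrite /= in_itv/=; lra.
have {}Ez := Ez n (leqnn _); have {}Fz := Fz n (leqnn _).
have [_ _] := hsy n; rewrite -/(s n) -/(y n) ltNge => /negP; apply.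
have e : s n + y n + (z - y n) = s n + z by lra.
rewrite e in Fz.
move: Ez Fz; set p := v (s n + z) / v (s n); set q := v (s n + z) / v (s n + y n).
have eta12 : eta <= 1 / 2 by rewrite ge_min lexx.
have eta4 : eta <= eps / 4 by rewrite ge_min lexx orbT.
rewrite !ltr_norml => /andP[p1 p2] /andP[q1 q2].
have vz0 : v (s n + z) != 0.
  by apply/eqP => v0; move: q1; rewrite /q v0 mul0r; lra.
have vy0 : v (s n + y n) != 0.
  by apply/eqP => v0; move: q1; rewrite /q v0 invr0 mulr0; lra.
have vs0 : v (s n) != 0.
  by apply/eqP => v0; move: p1; rewrite /p v0 invr0 mulr0; lra.
have -> : v (s n + y n) / v (s n) = p / q by rewrite /p /q; field; rewrite vz0 vy0.
have q0 : 0 < q by lra.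
have -> : p / q - 1 = (p - q) / q by field; rewrite gt_eqF.
rewrite normrM normfV (gtr0_norm q0) ler_pdivrMr// ler_norml.
apply/andP; split; nra.
Qed.

End UniformConvergence.

(** * Limit of a function with geometrically decaying increments *)

Section Telescoping.
Context {R : realType}.

Lemma near_pinfty_ge_ex (Q : R -> Prop) :
  (\forall s \near +oo, Q s) -> exists s0, forall s, s0 <= s -> Q s.
Proof.
move=> [M [_ h]]; exists (M + 1) => s hs; apply: h.
by rewrite (lt_le_trans _ hs)// ltrDl.
Qed.

Variables (f a : R -> R) (rho : R).
Hypothesis rho_lt0 : rho < 0.
Hypothesis f_step : forall eps, 0 < eps ->
  \forall s \near +oo,
    `|f (s + 1) - f s - a s * ((expR rho - 1) / rho)| <= eps * `|a s|.
Hypothesis f_shift : forall y, f (s + y) - f s @[s --> +oo] --> (0 : R).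
Hypothesis a_ratio : a (s + 1) / a s @[s --> +oo] --> expR rho.
Hypothesis a_neq0 : \forall s \near +oo, a s != 0.

(** As [a (s + 1)] is close to [expR rho * a s], the function [a / rho] has the same unit increments
    as [f] up to [o(a)]; their difference [g] has increments [o(a)]. The ratio [q] below is a number
    strictly between [expR rho] and 1, which leaves room for the error in the decay of [a]. *)
Let g s := f s - a s / rho.
Let q := (1 + expR rho) / 2.

Let erho_lt1 : expR rho < 1. Proof. by rewrite expR_lt1. Qed.
Let q_gt0 : 0 < q. Proof. by rewrite /q; have := expR_gt0 rho; lra. Qed.
Let q_lt1 : q < 1. Proof. by rewrite /q; have := erho_lt1; lra. Qed.

Let g_step eps : 0 < eps ->
  \forall s \near +oo, `|g (s + 1) - g s| <= eps * `|a s|.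
Proof.
move=> eps0.
have e1 : 0 < eps / 2 by lra.
have e2 : 0 < eps / 2 * - rho by rewrite mulr_gt0// oppr_gt0.
near=> s.
have a0 : a s != 0 by near: s; exact: a_neq0.
have h1 : `|f (s + 1) - f s - a s * ((expR rho - 1) / rho)| <= eps / 2 * `|a s|.
  by near: s; exact: f_step.
have h2 : `|expR rho - a (s + 1) / a s| <= eps / 2 * - rho.
  by near: s; move/cvgrPdist_le : a_ratio; exact.
have r0 : rho != 0 by rewrite lt_eqF.
have -> : g (s + 1) - g s = (f (s + 1) - f s - a s * ((expR rho - 1) / rho)) +
    (expR rho - a (s + 1) / a s) * (a s / rho).
  by rewrite /g; field; rewrite a0 r0.
apply: (le_trans (ler_normD _ _)).
have -> : eps * `|a s| = eps / 2 * `|a s| + (eps / 2 * - rho) * `|a s / rho|.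
  by rewrite normrM normfV (ltr0_norm rho_lt0); field; rewrite lt_eqF.
by apply: lerD => //; rewrite normrM ler_wpM2r.
Unshelve. all: by end_near. Qed.

Let a_step : \forall s \near +oo, `|a (s + 1)| <= q * `|a s|.
Proof.
have e0 : 0 < q - expR rho by rewrite /q; have := erho_lt1; lra.
near=> s.
have a0 : a s != 0 by near: s; exact: a_neq0.
have h2 : `|expR rho - a (s + 1) / a s| <= q - expR rho.
  by near: s; move/cvgrPdist_le : a_ratio; exact.
have -> : a (s + 1) = a (s + 1) / a s * a s by field.
rewrite normrM ler_wpM2r//.
move: h2; rewrite ler_norml => /andP[h2 h3].
rewrite ler_norml; have := expR_gt0 rho; lra.
Unshelve. all: by end_near. Qed.

Let geometric eps s : 0 < eps ->
  (forall u, s <= u -> `|g (u + 1) - g u| <= eps * `|a u|) ->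
  (forall u, s <= u -> `|a (u + 1)| <= q * `|a u|) ->
  forall j : nat, `|a (s + j%:R)| <= q ^+ j * `|a s| /\
    `|g (s + j%:R) - g s| <= eps * `|a s| * (1 - q ^+ j) / (1 - q).
Proof.
move=> eps0 gs as_; elim=> [|j [IH1 IH2]].
  by rewrite addr0 subrr normr0 expr0 subrr mulr0 mul0r mul1r.
have sj : s <= s + j%:R by rewrite lerDl.
rewrite -natr1 addrA; split.
  apply: (le_trans (as_ _ sj)); rewrite exprS -mulrA ler_wpM2l//; exact: ltW.
have -> : g (s + j%:R + 1) - g s = (g (s + j%:R + 1) - g (s + j%:R)) + (g (s + j%:R) - g s).
  by ring.
apply: (le_trans (ler_normD _ _)).
have q1 : 1 - q != 0 by rewrite subr_eq0 gt_eqF.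
have -> : eps * `|a s| * (1 - q ^+ j.+1) / (1 - q) =
   eps * (q ^+ j * `|a s|) + eps * `|a s| * (1 - q ^+ j) / (1 - q).
  by rewrite exprS; field.
apply: lerD => //; apply: (le_trans (gs _ sj)).
by rewrite ler_wpM2l// ltW.
Qed.

Let g_bound eps : 0 < eps -> exists s0, forall s, s0 <= s ->
  forall j : nat, `|g (s + j%:R) - g s| <= eps * `|a s|.
Proof.
move=> eps0.
(* The factor [1 - q] compensates the sum [1 / (1 - q)] of the geometric series. *)
have e0 : 0 < eps * (1 - q) by rewrite mulr_gt0// subr_gt0.
have /near_pinfty_ge_ex[s1 h1] := g_step e0.
have /near_pinfty_ge_ex[s2 h2] := a_step.
exists (Num.max s1 s2) => s; rewrite ge_max => /andP[s1s s2s] j.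
have [_ h] := geometric e0 (fun u su => h1 u (le_trans s1s su))
  (fun u su => h2 u (le_trans s2s su)) j.
apply: (le_trans h).
have q1 : 1 - q != 0 by rewrite subr_eq0 gt_eqF.
have -> : eps * (1 - q) * `|a s| * (1 - q ^+ j) / (1 - q) = eps * `|a s| * (1 - q ^+ j).
  by field.
rewrite ler_piMr//; first by rewrite mulr_ge0// ltW.
by rewrite gerBl exprn_ge0// ltW.
Qed.

Let q_cvg0 : q ^+ j @[j --> \oo] --> (0 : R).
Proof. by apply: cvg_expr; rewrite gtr0_norm. Qed.

(* The limit of [f (s + j)] along integers j is 1-periodic in s, and constant
   because [f (s + y) - f s] tends to 0 for every y; no uniformity in y is
   needed. *)
Lemma telescoping_limit : exists L, forall eps, 0 < eps ->
  \forall s \near +oo, `|f s - L - a s / rho| <= eps * `|a s|.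
Proof.
have /near_pinfty_ge_ex[s1 h1] := g_step ltr01.
have /near_pinfty_ge_ex[s2 h2] := a_step.
pose s := Num.max s1 s2.
have s1s : s1 <= s by rewrite le_max lexx.
have s2s : s2 <= s by rewrite le_max lexx orbT.
have H := geometric ltr01 (fun u su => h1 u (le_trans s1s su))
  (fun u su => h2 u (le_trans s2s su)).
have q1 : 0 < 1 - q by rewrite subr_gt0.
(* The added term bounds the total variation of [g] still to come, so [w] is nonincreasing and
   converges by monotonicity; the term itself tends to 0. *)
pose w j := g (s + j%:R) + q ^+ j * `|a s| / (1 - q).
have w_cvg : cvgn w.
  apply: nonincreasing_is_cvgn.
    apply/nonincreasing_seqP => j; rewrite /w.
    have [ha _] := H j.
    have := h1 (s + j%:R) (le_trans s1s _); rewrite lerDl ler0n mul1r => /(_ isT).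
    rewrite ler_norml => /andP[_]; rewrite -[s + j%:R + 1]addrA natr1 => hg.
    have -> : q ^+ j * `|a s| / (1 - q) = q ^+ j * `|a s| + q ^+ j.+1 * `|a s| / (1 - q).
      by rewrite exprS; field; rewrite gt_eqF.
    lra.
  exists (g s - 1 * `|a s| / (1 - q)) => _ [j _ <-]; rewrite /w.
  have [_ +] := H j; rewrite ler_norml => /andP[+ _].
  have : 0 <= q ^+ j * `|a s| / (1 - q) by rewrite !mulr_ge0// ?exprn_ge0 ?invr_ge0// ltW.
  have -> : 1 * `|a s| * (1 - q ^+ j) / (1 - q) = 1 * `|a s| / (1 - q) - q ^+ j * `|a s| / (1 - q).
    by field; rewrite gt_eqF.
  lra.
pose L := limn w; exists L.
have gL : g (s + j%:R) @[j --> \oo] --> L.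
  have -> : (fun j : nat => g (s + j%:R)) = (fun j => w j - q ^+ j * (`|a s| / (1 - q))).
    by apply/funext => j; rewrite /w; ring.
  rewrite -[L]subr0 -(mul0r (`|a s| / (1 - q))); apply: cvgB => //.
  exact: cvgMr_tmp.
have aL u : s <= u -> a (u + j%:R) @[j --> \oo] --> (0 : R).
  move=> su; apply/norm_cvg0P.
  have H' := geometric ltr01 (fun z uz => h1 z (le_trans s1s (le_trans su uz)))
    (fun z uz => h2 z (le_trans s2s (le_trans su uz))).
  apply: (@squeeze_cvgr _ _ _ _ (fun=> 0) (fun j => q ^+ j * `|a u|)).
  - by near=> j; rewrite normr_ge0; have [-> _] := H' j.
  - exact: cvg_cst.
  - by rewrite -(mul0r `|a u|); exact: cvgMr_tmp.
have fE u : f u = g u + a u / rho by rewrite /g; ring.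
have fL : f (s + j%:R) @[j --> \oo] --> L.
  under eq_fun do rewrite fE.
  by rewrite -[L]addr0 -(mul0r rho^-1); apply: cvgD => //; apply: cvgMr_tmp; exact: aL.
have natcvg (u : R) : u + j%:R @[j --> \oo] --> +oo.
  apply/cvgryPge => M; near=> j; rewrite -lerBlDl.
  by near: j; exact: nbhs_infty_ger.
have gLu u : s <= u -> g (u + j%:R) @[j --> \oo] --> L.
  move=> su; have -> : (fun j : nat => g (u + j%:R)) =
    (fun j => f (s + j%:R) + (f ((s + j%:R) + (u - s)) - f (s + j%:R)) - a (u + j%:R) / rho).
    apply/funext => j; rewrite (_ : s + j%:R + (u - s) = u + j%:R); last by ring.
    by rewrite /g; ring.
  have -> : L = L + 0 - 0 * rho^-1 by ring.
  apply: cvgB; last by apply: cvgMr_tmp; exact: aL.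
  apply: (cvgD fL); exact: (cvg_comp _ _ (natcvg s) (f_shift (u - s))).
move=> eps eps0; have [s3 h3] := g_bound eps0.
near=> u.
have su : s <= u by near: u; apply: nbhs_pinfty_ge; exact: num_real.
have s3u : s3 <= u by near: u; apply: nbhs_pinfty_ge; exact: num_real.
have -> : f u - L - a u / rho = g u - L by rewrite /g; ring.
(* The bound of [g_bound] is uniform in [j]: letting [j] tend to infinity replaces [g (u + j)] by
   [L]. *)
apply/ler_addgt0Pr => e e0.
have /cvgrPdist_le /(_ e e0) [N _ hN] := gLu u su.
have -> : g u - L = - (g (u + N%:R) - g u) - (L - g (u + N%:R)) by ring.
apply: (le_trans (ler_normB _ _)); rewrite normrN; apply: lerD; first exact: h3.
by apply: hN => /=.
Unshelve. all: by end_near. Qed.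

End Telescoping.

(** * Uniform estimates for regularly varying functions of negative index *)

Section RegularlyVaryingUniform.
Context {R : realType}.
Variables (b : R -> R) (rho : R).
Hypothesis rho_lt0 : rho < 0.
Hypothesis mb : measurable_fun setT b.
Hypothesis b_ratio : forall y, b (s + y) / b s @[s --> +oo] --> expR (rho * y).

(** The case [y = 0] of [b_ratio]: since division by 0 gives 0, the quotient [b s / b s] is 0 at a
    zero of [b], whereas its limit is 1. *)
Let b_neq0 : exists s0, forall s, s0 <= s -> b s != 0.
Proof.
apply: near_pinfty_ge_ex; near=> s; apply/eqP => b0.
have : `|expR (rho * 0) - b (s + 0) / b s| <= 1 / 2.
  by near: s; move/cvgrPdist_le: (@b_ratio 0); apply; lra.
by rewrite b0 invr0 mulr0 mulr0 expR0 subr0 normr1; lra.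
Unshelve. all: by end_near. Qed.

Let regular_uniform01 eps : 0 < eps ->
  exists s0, forall s y, s0 <= s -> 0 <= y <= 1 ->
    `|b (s + y) - expR (rho * y) * b s| <= eps * `|b s|.
Proof.
move=> eps0.
(* Dividing [b] by [expR (rho * s)] leaves a slowly varying function. *)
pose v (s : R) : R := b s * expR (- rho * s).
have mv : measurable_fun setT v.
  apply: measurable_funM => //.
  by apply: (measurableT_comp (@measurable_expR R)); apply: measurable_funM.
have v_slow y : v (s + y) / v s @[s --> +oo] --> (1 : R).
  have -> : (fun s => v (s + y) / v s) = (fun s => b (s + y) / b s * expR (- rho * y)).
    apply/funext => s; rewrite /v mulrDr expRD.
    have [->|b0] := eqVneq (b s) 0; first by rewrite mul0r invr0 !mulr0 mul0r.
    by field; rewrite b0 gt_eqF// expR_gt0.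
  have -> : (1 : R) = expR (rho * y) * expR (- rho * y).
    by rewrite -expRD mulNr subrr expR0.
  exact: cvgMr_tmp.
have [s1 h1] := slowly_varying_uniform mv v_slow eps0.
have [s2 h2] := b_neq0.
exists (Num.max s1 s2) => s y; rewrite ge_max => /andP[s1s s2s] y01.
have b0 := h2 _ s2s.
have -> : b (s + y) - expR (rho * y) * b s =
    expR (rho * y) * b s * (v (s + y) / v s - 1).
  rewrite /v [- rho * (s + y)]mulrDr expRD (_ : expR (rho * y) = (expR (- rho * y))^-1); last first.
    by rewrite mulNr expRN invrK.
  by field; rewrite b0 !gt_eqF// expR_gt0.
rewrite !normrM ger0_norm ?expR_ge0// mulrC.
apply: ler_pM => //; first exact: h1.
by rewrite ler_piMl// expR_le1 mulr_le0_ge0 ?(ltW rho_lt0)//; case/andP: y01.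
Qed.

(** A unit step multiplies the accumulated error by [expR rho < 1] before adding a new one, so the
    error stays bounded over arbitrarily many steps; this extends the estimate from [[0, 1]] to all
    [y >= 0]. *)
Lemma regularly_varying_uniform eps : 0 < eps ->
  exists s0, forall s y, s0 <= s -> 0 <= y ->
    `|b (s + y) - expR (rho * y) * b s| <= eps * `|b s|.
Proof.
move=> eps0.
have er1 : expR rho < 1 by rewrite expR_lt1.
have er0 := expR_gt0 rho.
(* Fixed point of the error recursion: [K = 2 + expR rho * K]. *)
pose K := 2 / (1 - expR rho).
have K2 : 2 <= K by rewrite /K ler_pdivlMr; nra.
(* The bound [K * e1 <= 1] keeps [b (s + w)] below twice [b s] in absolute value, whence the 2 in
   the recursion. *)
pose e1 := Num.min eps 1 / K.
have K0 : 0 < K by lra.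
have e10 : 0 < e1 by rewrite divr_gt0// lt_min eps0 ltr01.
have [s0 h0] := regular_uniform01 e10.
have Ke : K * e1 = Num.min eps 1 by rewrite /e1 mulrC divfK// gt_eqF.
exists s0 => s y s0s y0.
suff H : forall (n : nat) z, 0 <= z <= 1 ->
    `|b (s + (n%:R + z)) - expR (rho * (n%:R + z)) * b s| <= K * e1 * `|b s|.
  pose n := Num.truncn y.
  have /andP[ny yn] := truncn_itv y0.
  have -> : y = n%:R + (y - n%:R) by ring.
  apply: (le_trans (H n (y - n%:R) _)).
    by rewrite subr_ge0 ny lerBlDl natr1 ltW.
  by rewrite Ke ler_wpM2r// ge_min lexx.
elim=> [|n IH] z z01.
  rewrite add0r; apply: (le_trans (h0 _ _ s0s z01)).
  by rewrite ler_wpM2r// ler_peMl; lra.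
have -> : n.+1%:R + z = (n%:R + z) + 1 by rewrite -natr1; ring.
set w := n%:R + z; rewrite -/w in IH.
have w0 : 0 <= w by rewrite /w addr_ge0//; case/andP: z01.
have {}IH := IH z z01; rewrite -/w in IH.
have step : `|b (s + w + 1) - expR (rho * 1) * b (s + w)| <= e1 * `|b (s + w)|.
  by apply: h0; lra.
have big : `|b (s + w)| <= 2 * `|b s|.
  have -> : b (s + w) = (b (s + w) - expR (rho * w) * b s) + expR (rho * w) * b s by ring.
  apply: (le_trans (ler_normD _ _)); rewrite normrM ger0_norm ?expR_ge0//.
  have : expR (rho * w) <= 1 by rewrite expR_le1 mulr_le0_ge0 ?(ltW rho_lt0).
  have : K * e1 <= 1 by rewrite Ke ge_min lexx orbT.
  have := normr_ge0 (b s); nra.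
rewrite mulrDr expRD addrA.
have -> : b (s + w + 1) - expR (rho * w) * expR (rho * 1) * b s =
  (b (s + w + 1) - expR (rho * 1) * b (s + w)) +
  expR (rho * 1) * (b (s + w) - expR (rho * w) * b s) by ring.
apply: (le_trans (ler_normD _ _)); rewrite normrM ger0_norm ?expR_ge0// mulr1.
have -> : K * e1 * `|b s| = e1 * (2 * `|b s|) + expR rho * (K * e1 * `|b s|).
  by rewrite /K; field; lra.
apply: lerD.
  by rewrite mulr1 in step; apply: (le_trans step); rewrite ler_wpM2l// ltW.
by rewrite ler_wpM2l// ltW.
Qed.

(** For a backward shift the forward estimate starts from [s2], and the resulting bound in terms of
    [b s2] is converted into one in terms of [b s1]. *)
Lemma regularly_varying_local eps : 0 < eps ->
  exists delta, 0 < delta /\ exists s0, forall s1 s2, s0 <= s1 ->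
    `|s2 - s1| <= delta -> `|b s2 - b s1| <= eps * `|b s1|.
Proof.
move=> eps0.
pose e1 := Num.min (eps / 4) (1 / 4).
have e10 : 0 < e1 by rewrite lt_min; apply/andP; split; lra.
have e1a : e1 <= eps / 4 by rewrite ge_min lexx.
have e1b : e1 <= 1 / 4 by rewrite ge_min lexx orbT.
have [s0 h0] := regularly_varying_uniform e10.
(* On [[0, delta]] one has [1 - expR (rho * y) <= - rho * y <= e1]; and [delta <= 1] keeps [s2]
   above [s0] once [s1] is above [s0 + 1]. *)
pose delta := Num.min 1 (e1 / - rho).
have d0 : 0 < delta by rewrite lt_min ltr01 divr_gt0// oppr_gt0.
exists delta; split => //; exists (s0 + 1) => s1 s2 s01.
rewrite ler_norml => /andP[d1 d2].
have dd1 : delta <= 1 by rewrite ge_min lexx.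
have dd2 : delta * - rho <= e1 by rewrite -ler_pdivlMr ?oppr_gt0// ge_min lexx orbT.
have close y : 0 <= y <= delta -> 1 - e1 <= expR (rho * y) <= 1.
  move=> /andP[y0 yd]; rewrite expR_le1 mulr_le0_ge0 ?(ltW rho_lt0)// andbT.
  apply: (le_trans _ (expR_ge1Dx _)).
  have : 0 <= (delta - y) * - rho by rewrite mulr_ge0 ?oppr_ge0 ?(ltW rho_lt0)// subr_ge0.
  by lra.
have aux u y : s0 <= u -> 0 <= y <= delta -> `|b (u + y) - b u| <= 2 * e1 * `|b u|.
  move=> su /[dup] /close /andP[c1 c2] /andP[y0 _].
  have -> : b (u + y) - b u = (b (u + y) - expR (rho * y) * b u) + (expR (rho * y) - 1) * b u.
    by ring.
  apply: (le_trans (ler_normD _ _)).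
  have -> : 2 * e1 * `|b u| = e1 * `|b u| + e1 * `|b u| by ring.
  apply: lerD.
    exact: h0.
  by rewrite normrM ler_wpM2r// ler_norml; lra.
have [s12|s21] := leP s1 s2.
  have := aux s1 (s2 - s1); rewrite (_ : s1 + (s2 - s1) = s2); last by ring.
  move=> H; apply: (le_trans (H _ _)); try lra.
  have := normr_ge0 (b s1); nra.
have := aux s2 (s1 - s2); rewrite (_ : s2 + (s1 - s2) = s1); last by ring.
move=> H; have {}H : `|b s1 - b s2| <= 2 * e1 * `|b s2| by apply: H; lra.
rewrite distrC; apply: (le_trans H).
have : `|b s2| <= `|b s1| + `|b s1 - b s2|.
  by rewrite -lerBlDl (le_trans (lerB_dist _ _))// distrC.
move: H; move: `|b s1 - b s2| (normr_ge0 (b s1)) (normr_ge0 (b s2)) => z.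
move: `|b s1| `|b s2| => u w u0 w0 h1 h2.
have wu : w <= 2 * u by nra.
by nra.
Qed.

End RegularlyVaryingUniform.

(** * Elementary integrals and logarithms *)

Section Calculus.
Context {R : realType}.

Lemma cvgy_expR : expR s @[s --> +oo] --> (+oo : set_system R).
Proof.
apply/cvgryPge => M; near=> s; apply: (le_trans _ (expR_ge1Dx s)).
by rewrite -lerBlDl; near: s; apply: nbhs_pinfty_ge; exact: num_real.
Unshelve. all: by end_near. Qed.

(** The integral in the second-order condition at [x = e], that is, for a unit step in the
    logarithmic scale. *)
Lemma oriented_int_powR (rho : R) : rho != 0 ->
  oriented_int 1 (expR 1) (fun u => u `^ (rho - 1)) = (expR rho - 1) / rho.
Proof.
move=> rho0; rewrite /oriented_int ifT; last first.
  by rewrite (le_trans _ (expR_ge1Dx _))// lerDl.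
have lt1e : 1 < expR 1 :> R by rewrite expR_gt1.
have dpow (r x : R) : 0 < x -> derivable (fun u : R => u `^ r) x 1.
  by move=> x0; apply: derivable_powR; rewrite in_itv/= x0.
have cpow (r x : R) : 0 < x -> {for x, continuous (fun u : R => u `^ r)}.
  by move=> x0; apply: differentiable_continuous; exact/derivable1_diffP/dpow.
rewrite /Rintegral (@continuous_FTC2 _ _ (fun u => rho^-1 * u `^ rho))//.
- by rewrite powR1 mulr1 -expRM mul1r -EFinD/=; field.
- apply: continuous_in_subspaceT => x; rewrite inE/= in_itv/= => /andP[x1 _].
  by apply: cpow; lra.
- split.
  + move=> x; rewrite in_itv/= => /andP[x1 _].
    by apply: derivableM => //; apply: dpow; lra.
  + apply: cvg_at_right_filter; apply: cvgM; first exact: cvg_cst.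
    by apply: cpow; lra.
  + apply: cvg_at_left_filter; apply: cvgM; first exact: cvg_cst.
    by apply: cpow; lra.
- move=> x; rewrite in_itv/= => /andP[x1 _].
  have x0 : 0 < x by lra.
  rewrite derive1E deriveM//; last exact: dpow.
  rewrite derive_cst scaler0 addr0.
  have -> : 'D_1 (fun u : R => u `^ rho) x = rho * x `^ (rho - 1).
    by apply: derive_val; exact: is_derive1_powR.
  by rewrite /GRing.scale/= mulrA mulVf// mul1r.
Qed.

Lemma ln1D_approx (u : R) : `|u| <= 1 / 2 -> `|ln (1 + u) - u| <= 2 * u ^+ 2.
Proof.
rewrite ler_norml => /andP[u1 u2].
have h1 : ln (1 + u) <= u by apply: le_ln1Dx; lra.
have h2 : - (u / (1 + u)) >= ln ((1 + u)^-1).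
  have e : (1 + u)^-1 = 1 + - (u / (1 + u)) by field; rewrite gt_eqF//; lra.
  rewrite [X in ln X]e.
  by apply: le_ln1Dx; rewrite ltrN2 ltr_pdivrMr; lra.
move: h2; rewrite lnV ?posrE; last by lra.
move=> h2.
have h3 : u / (1 + u) = u - u ^+ 2 / (1 + u) by field; rewrite gt_eqF//; lra.
have h4 : u ^+ 2 / (1 + u) <= 2 * u ^+ 2.
  by rewrite ler_pdivrMr; [have := sqr_ge0 u; nra|lra].
have := sqr_ge0 u.
by rewrite ler_norml; lra.
Qed.

End Calculus.

(** * Second-order expansion of the tail quantile function *)

Section TailQuantile.
Context {R : realType}.
Variables (alpha rho : R) (U A : R -> R).
Hypothesis alpha_gt0 : 0 < alpha.
Hypothesis U_RV : RV' (alpha^-1) U.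
Hypothesis U_A : second_order alpha rho U A.
Hypothesis rho_lt0 : rho < 0.

Let a s := A (expR s).

(* Extending U \o expR by 0 makes it nondecreasing, hence measurable. *)
Definition expU (s : R) : R := if 0 < s then U (expR s) else 0.

Lemma expUE s : 0 < s -> expU s = U (expR s).
Proof. by rewrite /expU => ->. Qed.

Lemma U_expR_gt0 s : 0 < s -> 0 < U (expR s).
Proof. by move=> s0; case: U_RV => _ + _ _; apply; rewrite expR_gt1. Qed.

Lemma U_expR_le s t : 0 < s -> s <= t -> U (expR s) <= U (expR t).
Proof.
by move=> s0 st; case: U_RV => _ _ + _; apply; rewrite ?expR_gt1// ler_expR.
Qed.

Lemma expU_nondecreasing : {homo expU : s t / s <= t}.
Proof.
move=> s t st; rewrite /expU; case: ifPn => s0.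
  by rewrite (lt_le_trans s0 st) U_expR_le.
by case: ifP => // t0; exact/ltW/U_expR_gt0.
Qed.

Lemma measurable_expU : measurable_fun setT expU.
Proof. exact: nondecreasing_measurable expU_nondecreasing. Qed.

(** The slowly varying part of [U] in logarithmic scale, where multiplication by [x] becomes an
    additive shift. *)
Let f s := ln (expU s) - s / alpha.

Let fB s y : 0 < s -> 0 < s + y ->
  f (s + y) - f s = ln (U (expR s * expR y) / U (expR s)) - y / alpha.
Proof.
move=> s0 sy0; rewrite /f !expUE// -expRD ln_div ?posrE ?U_expR_gt0//.
by ring.
Qed.

Let f_shift y : f (s + y) - f s @[s --> +oo] --> (0 : R).
Proof.
have [H _ _ _] := U_RV.
have : ln (U (expR s * expR y) / U (expR s)) - y / alpha @[s --> +oo] -->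
    ln (expR y `^ alpha^-1) - y / alpha.
  apply: cvgB; last exact: cvg_cst.
  apply: (cvg_comp _ _ (cvg_comp _ _ cvgy_expR (H _ (expR_gt0 y)))).
  by apply: continuous_ln; rewrite powR_gt0// expR_gt0.
rewrite -expRM expRK subrr.
apply: cvg_trans; apply: near_eq_cvg; near=> s.
have s0 : 0 < s by near: s; apply: nbhs_pinfty_gt; exact: num_real.
have sy : - y < s by near: s; apply: nbhs_pinfty_gt; exact: num_real.
by rewrite fB//; lra.
Unshelve. all: by end_near. Qed.

Let a_neq0 : \forall s \near +oo, a s != 0.
Proof. by have [_ _ _ + _] := U_A; exact: cvgy_expR. Qed.

Let a_cvg0 : a s @[s --> +oo] --> (0 : R).
Proof. by have [_ _ + _ _] := U_A; exact: (cvg_comp _ _ cvgy_expR). Qed.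

Let a_ratio y : a (s + y) / a s @[s --> +oo] --> expR (rho * y).
Proof.
have [_ + _ _ _] := U_A => /(_ _ (expR_gt0 y)) /(cvg_comp _ _ cvgy_expR).
rewrite -expRM mulrC; apply: cvg_trans; apply: near_eq_cvg; near=> s.
by rewrite /a expRD.
Unshelve. all: by end_near. Qed.

(** At [x = e] the second-order condition reads [U (e^{s+1}) / U (e^s) = E * (1 + a s * kappa s)]
    with [kappa] tending to [psi]; the logarithm is linear in [a s] up to [O(a^2) = o(a)]. *)
Let f_step eps : 0 < eps -> \forall s \near +oo,
  `|f (s + 1) - f s - a s * ((expR rho - 1) / rho)| <= eps * `|a s|.
Proof.
move=> eps0.
have rho0 : rho != 0 by rewrite lt_eqF.
pose psi := (expR rho - 1) / rho; pose E := expR (alpha^-1).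
have E0 : 0 < E by exact: expR_gt0.
pose kappa s := (U (expR s * expR 1) / U (expR s) - E) / a s / E.
have kappa_cvg : kappa s @[s --> +oo] --> psi.
  have [_ _ _ _ /(_ _ (expR_gt0 1))] := U_A.
  move=> /(cvg_comp _ _ cvgy_expR); rewrite oriented_int_powR// -expRM mul1r -/E -/psi.
  move=> /(cvgMr_tmp (b := E^-1)); rewrite mulrAC divff ?gt_eqF// mul1r.
  exact.
have c1 : 0 < eps / 2 by lra.
pose M := `|psi| + 1.
have M1 : 1 <= M by rewrite /M lerDr.
(* [M] will bound [kappa]. The threshold [c3] gives [a * M <= 1 / 2], the range of [ln1D_approx],
   and [c2] makes its error [2 * (a * M) ^+ 2] at most [eps / 2 * a], for [a] the absolute value of
   [a s]. *)
have c2 : 0 < eps / (4 * M ^+ 2) by rewrite divr_gt0// mulr_gt0// exprn_gt0//; lra.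
have c3 : 0 < 1 / (2 * M) by rewrite divr_gt0// mulr_gt0//; lra.
near=> s.
have a0 : a s != 0 by near: s; exact: a_neq0.
have s0 : 0 < s by near: s; apply: nbhs_pinfty_gt; exact: num_real.
have k1 : `|psi - kappa s| <= 1 by near: s; move/cvgrPdist_le: kappa_cvg; exact.
have k2 : `|psi - kappa s| <= eps / 2 by near: s; move/cvgrPdist_le: kappa_cvg; exact.
have a1 : `|a s| <= eps / (4 * M ^+ 2).
  near: s; have /cvgrPdistC_le /(_ _ c2) := a_cvg0.
  by apply: filterS => s; rewrite subr0.
have a2 : `|a s| <= 1 / (2 * M).
  near: s; have /cvgrPdistC_le /(_ _ c3) := a_cvg0.
  by apply: filterS => s; rewrite subr0.
have kM : `|kappa s| <= M.
  have -> : kappa s = psi - (psi - kappa s) by ring.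
  by apply: (le_trans (ler_normB _ _)); rewrite /M lerD2l.
have s1 : 0 < s + 1 by lra.
have -> : f (s + 1) - f s = ln (1 + a s * kappa s).
  rewrite fB// -[1 / alpha]expRK div1r -/E -ln_div ?posrE//; last first.
    by rewrite -expRD divr_gt0// U_expR_gt0.
  by congr ln; rewrite /kappa; field; rewrite gt_eqF ?a0 ?gt_eqF// U_expR_gt0.
have ak : `|a s * kappa s| <= `|a s| * M by rewrite normrM ler_wpM2l.
have -> : ln (1 + a s * kappa s) - a s * psi =
  (ln (1 + a s * kappa s) - a s * kappa s) - a s * (psi - kappa s) by ring.
apply: (le_trans (ler_normB _ _)).
have -> : eps * `|a s| = eps / 2 * `|a s| + eps / 2 * `|a s| by field.
apply: lerD; last by rewrite normrM mulrC ler_wpM2r.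
have a2M : `|a s| * M <= 1 / 2.
  apply: le_trans (_ : 1 / (2 * M) * M <= _); first by rewrite ler_wpM2r//; lra.
  by rewrite le_eqVlt; apply/orP; left; apply/eqP; field; rewrite gt_eqF//; lra.
apply: (le_trans (ln1D_approx (le_trans ak a2M))).
rewrite -real_normK ?num_real//.
apply: le_trans (_ : 2 * (`|a s| * M) ^+ 2 <= _).
  by rewrite ler_wpM2l// ler_sqr// ?nnegrE// mulr_ge0//; lra.
have -> : 2 * (`|a s| * M) ^+ 2 = (2 * M ^+ 2 * `|a s|) * `|a s| by ring.
rewrite ler_wpM2r//.
apply: le_trans (_ : 2 * M ^+ 2 * (eps / (4 * M ^+ 2)) <= _).
  by rewrite ler_wpM2l// mulr_ge0// exprn_ge0//; lra.
by rewrite le_eqVlt; apply/orP; left; apply/eqP; field; rewrite gt_eqF//; lra.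
Unshelve. all: by end_near. Qed.

Let shift_cvgy (y : R) : s + y @[s --> +oo] --> (+oo : set_system R).
Proof.
apply/cvgryPge => M; near=> s; rewrite -lerBlDr.
by near: s; apply: nbhs_pinfty_ge; exact: num_real.
Unshelve. all: by end_near. Qed.

Let tail_limit : exists L, forall eps, 0 < eps ->
  \forall s \near +oo, `|f s - L - a s / rho| <= eps * `|a s|.
Proof.
by apply: telescoping_limit => //; have := @a_ratio 1; rewrite mulr1.
Qed.

(** [b = f - L0] is asymptotic to [a / rho], so it is regularly varying of index [rho]; being
    measurable as well, it obeys the uniform estimates, after which [a] is put back at the reference
    point [s1]. The level [xi] stands for [alpha * ln x] where [x] is a threshold crossed by
    [U (e^e)] at [e = s]; it may lie inside a jump of [U], hence the two one-sided hypotheses in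
    place of an equation. *)
Lemma tail_expansion : exists L,
  (forall eps, 0 < eps -> exists s0, forall s, s0 <= s ->
    `|alpha * ln (U (expR s)) - s - L| <= eps) /\
  forall eps, 0 < eps -> exists delta, 0 < delta /\ exists s0,
    forall s1 s xi, s0 <= s1 -> `|s - s1| <= delta -> 
      (forall e, 0 < e -> e < s -> alpha * ln (U (expR e)) <= xi) ->
      (forall e, s < e -> xi <= alpha * ln (U (expR e))) ->
    [/\ 0 < s & forall y, 0 < y ->
      `|alpha * ln (U (expR (s + y))) - xi - y -
        alpha / rho * A (expR s1) * (expR (rho * y) - 1)| <= eps * `|A (expR s1)|].
Proof.
have [L0 hL] := tail_limit.
have rho0 : rho != 0 by rewrite lt_eqF.
pose b (s : R) : R := f s - L0.
have tauE s : 0 < s -> alpha * ln (U (expR s)) = s + alpha * L0 + alpha * b s.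
  by move=> s0; rewrite /b /f expUE//; field; rewrite gt_eqF.
have mb : measurable_fun setT b.
  apply: measurable_funB => //; apply: measurable_funB.
    apply: (measurableT_comp (@measurable_ln R)); exact: measurable_expU.
  exact: measurable_funM.
(* The limit [rho^-1] of this ratio transfers regular variation and eventual nonvanishing from [a]
   to [b]. *)
pose c s := b s / a s.
have c_cvg : c s @[s --> +oo] --> rho^-1.
  apply/cvgrPdistC_le => eps eps0; near=> s.
  have a0 : a s != 0 by near: s; exact: a_neq0.
  have -> : c s - rho^-1 = (f s - L0 - a s / rho) / a s.
    by rewrite /c /b; field; rewrite a0 rho0.
  rewrite normrM normfV ler_pdivrMr ?normr_gt0//.
  by near: s; exact: hL.
have c_neq0 : \forall s \near +oo, c s != 0.
  near=> s; apply/eqP => c0.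
  have : `|rho^-1 - c s| <= `|rho^-1| / 2.
    near: s; move/cvgrPdist_le : c_cvg; apply.
    by rewrite divr_gt0// normr_gt0 invr_eq0.
  have : 0 < `|rho^-1| by rewrite normr_gt0 invr_eq0.
  by rewrite c0 subr0; lra.
have b_ratio y : b (s + y) / b s @[s --> +oo] --> expR (rho * y).
  have : c (s + y) * (a (s + y) / a s) * (c s)^-1 @[s --> +oo] -->
      rho^-1 * expR (rho * y) * (rho^-1)^-1.
    apply: cvgM; last by apply: cvgV; rewrite ?invr_eq0.
    apply: cvgM; last exact: a_ratio.
    exact: (cvg_comp _ _ (@shift_cvgy y) c_cvg).
  rewrite mulrAC divff ?invr_eq0// mul1r.
  have a_shift : \forall s \near +oo, a (s + y) != 0.
    exact: (@shift_cvgy y _ a_neq0).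
  apply: cvg_trans; apply: near_eq_cvg; near=> s.
  have a0 : a s != 0 by near: s; exact: a_neq0.
  have c0 : c s != 0 by near: s; exact: c_neq0.
  have a1 : a (s + y) != 0 by near: s; exact: a_shift.
  have b0 : b s != 0 by move: c0; rewrite /c mulf_eq0 negb_or => /andP[].
  by rewrite /c; field; rewrite a0 b0 a1.
have b_neq0 : exists s0, forall s, s0 <= s -> b s != 0.
  apply: near_pinfty_ge_ex; apply: filterS c_neq0 => s.
  by rewrite /c mulf_eq0 negb_or => /andP[].
have b_cvg0 : b s @[s --> +oo] --> (0 : R).
  have : c s * a s @[s --> +oo] --> rho^-1 * 0 by exact: cvgM.
  rewrite mulr0; apply: cvg_trans; apply: near_eq_cvg; near=> s.
  by rewrite /c divfK//; near: s; exact: a_neq0.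
exists (alpha * L0); split.
  move=> eps eps0.
  have e0 : 0 < eps / alpha by rewrite divr_gt0.
  apply: near_pinfty_ge_ex; near=> s.
  have s0 : 0 < s by near: s; apply: nbhs_pinfty_gt; exact: num_real.
  rewrite tauE// (_ : s + alpha * L0 + alpha * b s - s - alpha * L0 = alpha * b s); last by ring.
  rewrite normrM gtr0_norm// mulrC -ler_pdivlMr//.
  near: s; have /cvgrPdistC_le /(_ _ e0) := b_cvg0.
  by apply: filterS => s; rewrite subr0.
move=> eps eps0.
pose M := `|rho^-1| + 1.
(* The final error is [e1] times [(4 * alpha + 1)] of [b s1] and [alpha] of [a s1], in absolute
   values; [M >= 1] bounds the ratio of the former to the latter. *)
pose K := (5 * alpha + 1) * M.
have M1 : 1 <= M by rewrite /M lerDr.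
have M0 : 0 < M by exact: lt_le_trans M1.
have a5 : 0 < 5 * alpha + 1 by rewrite addr_gt0// mulr_gt0.
have K0 : 0 < K by rewrite /K mulr_gt0.
pose e1 := Num.min 1 (eps / K).
have e10 : 0 < e1 by rewrite lt_min ltr01 divr_gt0.
have e11 : e1 <= 1 by rewrite ge_min lexx.
have e1K : e1 * K <= eps by rewrite -ler_pdivlMr// ge_min lexx orbT.
have [d [d0 [r1 h1]]] := regularly_varying_local rho_lt0 mb b_ratio e10.
have [r2 h2] := regularly_varying_uniform rho_lt0 mb b_ratio e10.
have /near_pinfty_ge_ex[r3 h3] := hL _ e10.
have [r4 h4] := b_neq0.
pose r := Num.max (Num.max r1 r2) (Num.max r3 r4).
exists (d / 2); split; first by lra.
exists (Num.max r 0 + d + 1) => s1 s xi rs1 ss1 xi1 xi2.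
have r0 : 0 <= Num.max r 0 by rewrite le_max lexx orbT.
have rr : r <= Num.max r 0 by rewrite le_max lexx.
have rs (t : R) : r <= t -> [/\ r1 <= t, r2 <= t, r3 <= t & r4 <= t].
  by rewrite /r !ge_max => /andP[/andP[-> ->] /andP[-> ->]].
move: (ss1); rewrite ler_norml => /andP[ss2 ss3].
have s0 : 0 < s by lra.
split => // y y0.
have [t1 t2 t3 t4] : [/\ r1 <= s1, r2 <= s1, r3 <= s1 & r4 <= s1] by apply: rs; lra.
have [_ t5 _ _] : [/\ r1 <= s, r2 <= s, r3 <= s & r4 <= s] by apply: rs; lra.
(* The level [xi] is squeezed between the values at [s - eta] and [s + eta]; a shift that is itself
   small compared with [b s1] costs no more than the other errors. *)
pose eta := Num.min (d / 2) (e1 * `|b s1|).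
have eta0 : 0 < eta by rewrite lt_min; apply/andP; split; [lra|rewrite mulr_gt0// normr_gt0 h4].
have eta1 : eta <= d / 2 by rewrite ge_min lexx.
have eta2 : eta <= e1 * `|b s1| by rewrite ge_min lexx orbT.
have near_b t : `|t - s1| <= d -> `|b t - b s1| <= e1 * `|b s1| by move=> ht; exact: h1.
have lo := xi1 (s - eta) ltac:(lra) ltac:(lra).
have hi := xi2 (s + eta) ltac:(lra).
rewrite tauE in lo; last by lra.
rewrite tauE in hi; last by lra.
have xiE : `|s + alpha * L0 + alpha * b s1 - xi| <= (alpha + 1) * (e1 * `|b s1|).
  have : `|b (s - eta) - b s1| <= e1 * `|b s1| by apply: near_b; rewrite ler_norml; lra.
  have : `|b (s + eta) - b s1| <= e1 * `|b s1| by apply: near_b; rewrite ler_norml; lra.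
  rewrite !ler_norml => /andP[_ p] /andP[q _].
  have := ler_wpM2l (ltW alpha_gt0) p; have := ler_wpM2l (ltW alpha_gt0) q.
  move: lo hi eta2; move: (e1 * `|b s1|) => z lo hi eta2 q' p'.
  by apply/andP; split; lra.
have bs : `|b s - b s1| <= e1 * `|b s1| by apply: near_b; rewrite ler_norml; lra.
have bs2 : `|b s| <= 2 * `|b s1|.
  have -> : b s = (b s - b s1) + b s1 by ring.
  apply: (le_trans (ler_normD _ _)); rewrite mulr_natl mulr2n lerD2r.
  by apply: (le_trans bs); rewrite ler_piMl.
have bM : `|b s1| <= M * `|a s1|.
  have -> : b s1 = (f s1 - L0 - a s1 / rho) + a s1 * rho^-1 by rewrite /b; ring.
  apply: (le_trans (ler_normD _ _)); rewrite normrM /M mulrDl mul1r addrC mulrC.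
  by rewrite lerD2l; apply: (le_trans (h3 _ t3)); rewrite ler_piMl.
have u1 := h2 _ _ t5 (ltW y0).
have u3 := h3 _ t3.
rewrite tauE; last by lra.
rewrite -/(a s1).
set ey := expR (rho * y).
have ey1 : ey <= 1 by rewrite expR_le1 mulr_le0_ge0 ?(ltW rho_lt0)// ltW.
have ey0 : 0 <= ey by exact: expR_ge0.
(* Four errors: regular variation of [b] from [s], passage from [s] to [s1], replacement of [b] by
   [a / rho], and position of [xi]. *)
have -> : s + y + alpha * L0 + alpha * b (s + y) - xi - y - alpha / rho * a s1 * (ey - 1) =
   alpha * (b (s + y) - ey * b s) + (alpha * ey) * (b s - b s1) +
   (alpha * (ey - 1)) * (f s1 - L0 - a s1 / rho) + (s + alpha * L0 + alpha * b s1 - xi).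
  by rewrite /b; ring.
have al0 := ltW alpha_gt0.
have T1 : `|alpha * (b (s + y) - ey * b s)| <= alpha * (e1 * (2 * `|b s1|)).
  rewrite normrM (ger0_norm al0) ler_wpM2l//; apply: (le_trans u1).
  by rewrite ler_wpM2l// ltW.
have T2 : `|alpha * ey * (b s - b s1)| <= alpha * (e1 * `|b s1|).
  rewrite normrM normrM (ger0_norm al0) (ger0_norm ey0) -mulrA ler_wpM2l//.
  by apply: le_trans bs; rewrite ler_piMl.
have T3 : `|alpha * (ey - 1) * (f s1 - L0 - a s1 / rho)| <= alpha * (e1 * `|a s1|).
  rewrite normrM normrM (ger0_norm al0) -mulrA ler_wpM2l//.
  apply: le_trans u3; rewrite ler_piMl// ler_norml; lra.
apply: (le_trans (ler_normD _ _)).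
apply: le_trans (_ : (alpha * (e1 * (2 * `|b s1|)) + alpha * (e1 * `|b s1|) +
   alpha * (e1 * `|a s1|)) + (alpha + 1) * (e1 * `|b s1|) <= _).
  apply: lerD => //; apply: (le_trans (ler_normD _ _)); apply: lerD => //.
  by apply: (le_trans (ler_normD _ _)); apply: lerD.
apply: le_trans (_ : e1 * K * `|a s1| <= _); last by rewrite ler_wpM2r.
have -> : alpha * (e1 * (2 * `|b s1|)) + alpha * (e1 * `|b s1|) +
   alpha * (e1 * `|a s1|) + (alpha + 1) * (e1 * `|b s1|) =
   e1 * ((4 * alpha + 1) * `|b s1| + alpha * `|a s1|) by ring.
rewrite -mulrA ler_wpM2l ?(ltW e10)//.
have -> : K * `|a s1| = (4 * alpha + 1) * (M * `|a s1|) + alpha * (M * `|a s1|).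
  by rewrite /K; ring.
apply: lerD; first by rewrite ler_wpM2l//; lra.
by rewrite ler_wpM2l// ler_peMl.
Unshelve. all: by end_near. Qed.

End TailQuantile.

(** * Exponential moments of an excess *)

Section Density.
Import HBNNSimple.
Local Open Scope ereal_scope.

(** Holds for indicators by assumption, hence for simple functions, and then in general by monotone
    convergence. It will turn the law of [X] into an integral against the exponential density. *)
Lemma ge0_integral_density d1 d2 (T1 : measurableType d1) (T2 : measurableType d2)
    (R : realType) (mu : {measure set T1 -> \bar R}) (nu : {measure set T2 -> \bar R})
    (D : set T1) (phi : T1 -> T2) (p : T1 -> R) (h : T2 -> \bar R) :
  measurable D -> measurable_fun setT phi -> measurable_fun setT p ->
  (forall x, (0 <= p x)%R) ->
  (forall B, measurable B ->
    nu B = \int[mu]_(x in D `&` phi @^-1` B) (p x)%:E) ->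
  measurable_fun setT h -> (forall y, 0 <= h y) ->
  \int[nu]_y h y = \int[mu]_(x in D) (h (phi x) * (p x)%:E).
Proof.
move=> mD mphi mp p0 nuE mh h0.
pose g := nnsfun_approx measurableT mh.
have mpE : measurable_fun D (EFin \o p).
  by apply/measurable_EFinP; exact: measurable_funTS.
have -> : \int[nu]_y h y = lim (\int[nu]_y (EFin \o g n) y @[n --> \oo]).
  have hE x : h x = lim ((EFin \o g n) x @[n --> \oo]).
    by apply/esym/cvg_lim => //; exact: cvg_nnsfun_approx.
  under eq_integral => x _ do rewrite hE.
  apply: monotone_convergence => //.
  - by move=> n; apply/measurable_EFinP.
  - by move=> n x _ //=; rewrite lee_fin.
  - by move=> x _ a b ab; rewrite lee_fin; exact/lefP/nd_nnsfun_approx.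
have -> : \int[mu]_(x in D) (h (phi x) * (p x)%:E) =
    lim (\int[mu]_(x in D) ((EFin \o g n) (phi x) * (p x)%:E) @[n --> \oo]).
  have hE x : h (phi x) * (p x)%:E =
      lim ((EFin \o g n) (phi x) * (p x)%:E @[n --> \oo]).
    apply/esym/cvg_lim => //; apply: cvgeZr => //.
    exact: cvg_nnsfun_approx.
  under eq_integral => x _ do rewrite hE.
  apply: monotone_convergence => [//| | |].
  - move=> n; apply: emeasurable_funM => //; apply/measurable_EFinP.
    by apply: measurable_funTS; exact: measurableT_comp.
  - by move=> n x _ /=; rewrite mule_ge0 ?lee_fin.
  - move=> x _ a b ab/=; rewrite lee_wpmul2r ?lee_fin//.
    exact/lefP/nd_nnsfun_approx.
suff suf n : \int[nu]_y (EFin \o g n) y =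
    \int[mu]_(x in D) ((EFin \o g n) (phi x) * (p x)%:E).
  by under eq_fun do rewrite suf.
have mg r : measurable (g n @^-1` [set r]) by [].
transitivity (\int[nu]_y (\sum_(r \in range (g n)) (r * \1_(g n @^-1` [set r]) y)%:E)).
  by apply: eq_integral => t tE; rewrite /= fimfunE -fsumEFin.
rewrite ge0_integral_fsum//; first last.
- by move=> r y _; exact: nnfun_muleindic_ge0.
- by move=> r; apply/measurable_EFinP; exact: measurable_funM.
transitivity (\int[mu]_(x in D) (\sum_(r \in range (g n))
    (r * \1_(g n @^-1` [set r]) (phi x))%:E * (p x)%:E)); last first.
  under eq_integral => x _.
    rewrite -ge0_mule_fsuml => [|r]; last exact: nnfun_muleindic_ge0.
    rewrite fsumEFin // -(fimfunE _ (phi x)); over.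
  by [].
rewrite ge0_integral_fsum//; first last.
- by move=> r x _; rewrite mule_ge0 ?lee_fin//; exact: nnfun_muleindic_ge0.
- move=> r; apply: emeasurable_funM => //; apply/measurable_EFinP.
  apply: measurable_funTS; apply: measurable_funM => //.
  exact: (measurableT_comp (measurable_indic _)).
apply: eq_fsbigr => r; rewrite inE => -[y _ <-].
have r0 : (0 <= g n y)%R by [].
under eq_integral do rewrite EFinM.
rewrite ge0_integralZl//; last exact/measurable_EFinP.
rewrite integral_indic// setIT nuE//.
under [RHS]eq_integral do rewrite EFinM -muleA.
rewrite [RHS]ge0_integralZl//; first last.
- by move=> x _; rewrite mule_ge0// lee_fin.
- apply: emeasurable_funM => //; apply/measurable_EFinP; apply: measurable_funTS.
  exact: (measurableT_comp (measurable_indic _)).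
congr (_ * _).
rewrite integral_mkcondr; apply: eq_integral => x _.
rewrite patchE/= indicE.
have -> : (x \in phi @^-1` (g n @^-1` [set g n y])) = (phi x \in g n @^-1` [set g n y]).
  by apply/idP/idP; rewrite !inE.
by case: ifP; rewrite ?mul1e ?mul0e.
Qed.
End Density.

Section ExponentialMoment.
Context {R : realType}.
Local Notation mu := (@lebesgue_measure R).

(** The tilted excess density, once linearised, is a combination of two exponentials whose
    coefficients may have opposite signs; hence positivity is asked of the sum only. *)
Lemma integral_exp2 (s p q c1 c2 : R) : 0 < c1 -> 0 < c2 ->
  (forall y, 0 <= y -> 0 <= p * expR (- c1 * y) + q * expR (- c2 * y)) ->
  (\int[mu]_(e in `]s, +oo[)
     (p * expR (- c1 * (e - s)) + q * expR (- c2 * (e - s)))%:E =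
   (p / c1 + q / c2)%:E)%E.
Proof.
move=> c10 c20 pos.
have cE (c : R) : continuous (fun e : R => expR (- c * (e - s))).
  move=> e; apply: continuous_comp; last exact: continuous_expR.
  by apply: cvgM; [exact: cvg_cst|apply: cvgB => //; exact: cvg_cst].
have cf : continuous (fun e : R => p * expR (- c1 * (e - s)) + q * expR (- c2 * (e - s))).
  by move=> e; apply: cvgD; apply: cvgM; [exact: cvg_cst|exact: cE|exact: cvg_cst|exact: cE].
have mf : measurable_fun setT
    (fun e : R => (p * expR (- c1 * (e - s)) + q * expR (- c2 * (e - s)))%:E).
  by apply/measurable_EFinP; exact: continuous_measurable_fun.
rewrite integral_itv_obnd_cbnd; last exact: measurable_funTS.
have expE (c : R) : 0 < c -> expR (- c * (e - s)) @[e --> +oo] --> (0 : R).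
  move=> c0.
  rewrite (_ : (fun e => expR (- c * (e - s))) = (fun x => expR (- x)) \o (fun e => c * (e - s))); last first.
    by apply/funext => e /=; rewrite mulNr.
  apply: (@cvg_comp _ _ _ _ _ _ (pinfty_nbhs R)); last exact: cvgr_expR.
  apply: gt0_cvgMry => //.
  apply/cvgryPge => M; near=> e; rewrite lerBrDr.
  by near: e; apply: nbhs_pinfty_ge; exact: num_real.
pose F e := - (p / c1 * expR (- c1 * (e - s)) + q / c2 * expR (- c2 * (e - s))).
have dE (c e : R) : is_derive e (1 : R) (fun e : R => expR (- c * (e - s))) (- c * expR (- c * (e - s))).
  apply: is_derive_eq.
  by rewrite /GRing.scale/=; ring.
have dF e : is_derive e (1 : R) F (p * expR (- c1 * (e - s)) + q * expR (- c2 * (e - s))).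
  apply: is_derive_eq.
  by rewrite /GRing.scale/=; field; rewrite !gt_eqF.
rewrite (@ge0_continuous_FTC2y _ _ F _ 0).
- by rewrite /F subrr !mulr0 expR0 !mulr1 -EFinB/= sub0r opprK.
- by move=> e se; apply: pos; rewrite subr_ge0.
- exact: continuous_subspaceT.
- have -> : (0 : R) = - (p / c1 * 0 + q / c2 * 0) by ring.
  by apply: cvgN; apply: cvgD; apply: cvgM; [exact: cvg_cst|exact: expE|exact: cvg_cst|exact: expE].
- by move=> e _; have [] := dF e.
- apply: cvg_at_right_filter; apply: cvgN.
  by apply: cvgD; apply: cvgM; [exact: cvg_cst|exact: cE|exact: cvg_cst|exact: cE].
- by move=> e _; rewrite derive1E; exact: derive_val.
Unshelve. all: by end_near. Qed.

(** Mean value theorem for the remainder, whose derivative is [u ^+ 2 / (1 - u)]. The quadratic term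
    is the origin of the rate [k / 2 * theta ^+ 2]. *)
Lemma lnV1B_approx (x : R) : `|x| <= 1 / 2 ->
  `|- ln (1 - x) - x - x ^+ 2 / 2| <= 2 * `|x| ^+ 3.
Proof.
move=> xle.
pose g (u : R) := - ln (1 - u) - u - u ^+ 2 / 2.
have dg (u : R) : u < 1 -> is_derive u (1 : R) g (u ^+ 2 / (1 - u)).
  move=> u1; have h : 0 < 1 - u by rewrite subr_gt0.
  have dl : is_derive (1 - u) (1 : R) (@ln R) ((1 - u)^-1) by exact: is_derive1_ln.
  apply: is_derive_eq.
  by rewrite /GRing.scale/=; field; rewrite gt_eqF.
have g0 : g 0 = 0 by rewrite /g [1 - 0]subr0 ln1; field.
have cg (u : R) : u < 1 -> {for u, continuous g}.
  move=> /dg[+ _] => du.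
  by apply: differentiable_continuous; exact/derivable1_diffP.
have bound (u : R) : `|u| <= `|x| -> `|u ^+ 2 / (1 - u)| <= 2 * `|x| ^+ 2.
  move=> ux; rewrite normrM normrX normfV.
  have u1 : 1 / 2 <= `|1 - u|.
    have := ler_norm u; have := lerB_dist 1 u; rewrite normr1; lra.
  rewrite ler_pdivrMr; last by lra.
  have : `|u| ^+ 2 <= `|x| ^+ 2 by rewrite ler_sqr ?nnegrE.
  have := sqr_ge0 `|x|; nra.
rewrite -/(g x); suff [c cx ->] : exists2 c, `|c| <= `|x| & g x = c ^+ 2 / (1 - c) * x.
  rewrite normrM [X in _ <= 2 * X]exprSr mulrA ler_wpM2r//; exact: bound.
move: xle; rewrite ler_norml => /andP[xl xr].
have [x0|x0] := leP 0 x.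
  have [c| |c] := @MVT_segment _ g (fun u => u ^+ 2 / (1 - u)) 0 x x0.
  - by rewrite in_itv/= => /andP[_ cx]; apply: dg; lra.
  - apply: continuous_in_subspaceT => u; rewrite inE/= in_itv/= => /andP[_ ux].
    by apply: cg; lra.
  - rewrite in_itv/= => /andP[c0 cx]; rewrite g0 !subr0 => ->.
    by exists c => //; rewrite !ger0_norm.
have [c| |c] := @MVT_segment _ g (fun u => u ^+ 2 / (1 - u)) x 0 (ltW x0).
- by rewrite in_itv/= => /andP[_ cx]; apply: dg; lra.
- apply: continuous_in_subspaceT => u; rewrite inE/= in_itv/= => /andP[_ ux].
  by apply: cg; lra.
- rewrite in_itv/= => /andP[xc c0]; rewrite g0 !sub0r => gE.
  exists c; first by rewrite !ler0_norm ?lerN2// ltW.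
  by apply: oppr_inj; rewrite gE mulrN.
Qed.

Lemma expR_le1DxD2x2 (u : R) : `|u| <= 1 / 2 -> expR u <= 1 + u + 2 * u ^+ 2.
Proof.
rewrite ler_norml => /andP[u1 u2].
have := expR_ge1Dx (- u); rewrite expRN => h.
have {}h : expR u <= (1 - u)^-1.
  by rewrite -[expR u]invrK lef_pV2 ?posrE ?invr_gt0 ?expR_gt0//; lra.
apply: (le_trans h).
rewrite -div1r ler_pdivrMr; last by lra.
have := sqr_ge0 u; nra.
Qed.

Lemma expR_sub2x2_le1D (v : R) : `|v| <= 1 / 2 -> expR (v - 2 * v ^+ 2) <= 1 + v.
Proof.
move=> vle; have := ln1D_approx vle.
rewrite ler_norml => /andP[+ _].
move: vle; rewrite ler_norml => /andP[v1 v2] h.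
have v0 : 0 < 1 + v by lra.
by rewrite -[leRHS](lnK v0) ler_expR; lra.
Qed.

Section TiltedExponential.
Variables (s lambda B rho eta : R) (T : R -> R).
Hypothesis rho_lt0 : rho < 0.
Hypothesis lambda_le : `|lambda| <= 1 / 2.
Hypothesis lambdaB_le : `|lambda * B| <= 1 / 2.
Hypothesis mT : measurable_fun `]s, +oo[ T.
Hypothesis T_approx : forall y, 0 < y ->
  `|T (s + y) - y - B * (expR (rho * y) - 1)| <= eta.

(** The mean of [E + B * (expR (rho * E) - 1)] for a standard exponential [E]. *)
Let m := 1 + B * rho / (1 - rho).
(** In order: error in the approximation of [T]; cubic remainder of [- ln (1 - lambda)]; quadratic
    remainder in the perturbation [lambda * B]; change of the mean of the perturbation under the
    tilt. *)
Let err := `|lambda| * eta + 2 * `|lambda| ^+ 3 + 2 * (lambda * B) ^+ 2 +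
  2 * lambda ^+ 2 * `|B|.
Let c1 := 1 - lambda.
Let c2 := 1 - lambda - rho.
(** The mean of [lambda * B * (expR (rho * Y) - 1)] for [Y] exponential of rate [c1], the law of the
    excess after tilting. *)
Let v := lambda * B * (rho / c2).

Let c1_gt0 : 0 < c1.
Proof. by move: lambda_le; rewrite ler_norml /c1; lra. Qed.
Let c2_gt0 : 0 < c2.
Proof. by have := c1_gt0; rewrite /c2 /c1; have := rho_lt0; lra. Qed.

Let v_approx : `|v - lambda * (m - 1)| <= 2 * lambda ^+ 2 * `|B|.
Proof.
have r1 : 0 < 1 - rho by have := rho_lt0; lra.
have -> : v - lambda * (m - 1) = lambda ^+ 2 * B * (rho / (1 - rho)) / c2.
  by rewrite /v /m /c2; field; rewrite !gt_eqF.
rewrite normrM normrM normrM normfV (gtr0_norm c2_gt0) normrX real_normK ?num_real//.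
have h1 : `|rho / (1 - rho)| <= 1.
  rewrite normrM normfV (gtr0_norm r1) (ltr0_norm rho_lt0) ler_pdivrMr//.
  by have := rho_lt0; lra.
have h2 : c2^-1 <= 2.
  rewrite -[leRHS]invrK lef_pV2 ?posrE ?invr_gt0//.
  by move: lambda_le; rewrite ler_norml /c2; have := rho_lt0; lra.
have -> : 2 * lambda ^+ 2 * `|B| = lambda ^+ 2 * `|B| * 1 * 2 by ring.
have l0 : 0 <= lambda ^+ 2 by exact: sqr_ge0.
apply: ler_pM => //; first by do 2![apply: mulr_ge0 => //].
  by rewrite invr_ge0 ltW.
by apply: ler_wpM2l => //; exact: mulr_ge0.
Qed.

Let v_le : `|v| <= `|lambda * B|.
Proof.
rewrite /v [X in X <= _]normrM ler_piMr// normrM normfV (gtr0_norm c2_gt0) (ltr0_norm rho_lt0).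
by rewrite ler_pdivrMr// mul1r /c2; move: c1_gt0; rewrite /c1; lra.
Qed.

Let c1_approx : `|ln (c1^-1) - lambda - lambda ^+ 2 / 2| <= 2 * `|lambda| ^+ 3.
Proof. by rewrite lnV ?posrE//; exact: lnV1B_approx. Qed.

Let u_le y : 0 <= y -> `|lambda * B * (expR (rho * y) - 1)| <= `|lambda * B|.
Proof.
move=> y0; rewrite normrM ler_piMr// ler_norml.
have : expR (rho * y) <= 1 by rewrite expR_le1 mulr_le0_ge0 ?(ltW rho_lt0).
by have := expR_ge0 (rho * y); lra.
Qed.

Let mexp2 (p q : R) : measurable_fun setT
  (fun e : R => p * expR (- c1 * (e - s)) + q * expR (- c2 * (e - s))).
Proof.
have mE (c : R) : measurable_fun setT (fun e : R => expR (- c * (e - s))).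
  apply: (measurableT_comp (@measurable_expR R)).
  by apply: measurable_funM => //; exact: measurable_funB.
by apply: measurable_funD; apply: measurable_funM.
Qed.

(** The tilt turns the excess into an exponential of rate [1 - lambda] with normalising factor
    [c1^-1], whose logarithm is [lambda + lambda ^+ 2 / 2] up to a cubic error; the perturbation
    contributes a factor close to [1 + v], where [v] is close to [lambda * (m - 1)]. *)
Lemma exp_moment_ub :
  (\int[mu]_(e in `]s, +oo[) (expR (- e + lambda * T e))%:E <=
   (expR (- s) * expR (lambda * m + lambda ^+ 2 / 2 + err))%:E)%E.
Proof.
(* The coefficients come from [expR u <= 1 + u + 2 * u ^+ 2] with
   [u = lambda * B * (expR (rho * y) - 1)], the square being bounded by that of [lambda * B]. *)
pose p := 1 - lambda * B + 2 * (lambda * B) ^+ 2; pose q := lambda * B.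
pose K := expR (- s) * expR (`|lambda| * eta).
have K0 : 0 <= K by rewrite mulr_ge0 ?expR_ge0.
have uE y : 0 <= y -> p * expR (- c1 * y) + q * expR (- c2 * y) =
    expR (- c1 * y) * (1 + lambda * B * (expR (rho * y) - 1) + 2 * (lambda * B) ^+ 2).
  move=> y0; rewrite /p /q (_ : - c2 * y = - c1 * y + rho * y); last first.
    by rewrite /c1 /c2; ring.
  by rewrite expRD; ring.
have u2_le y : 0 <= y -> (lambda * B * (expR (rho * y) - 1)) ^+ 2 <= (lambda * B) ^+ 2.
  move=> y0; rewrite -[leLHS]real_normK ?num_real// -[leRHS]real_normK ?num_real//.
  by rewrite ler_sqr ?nnegrE// u_le.
have pos y : 0 <= y -> 0 <= p * expR (- c1 * y) + q * expR (- c2 * y).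
  move=> y0; rewrite uE// mulr_ge0 ?expR_ge0//.
  have := sqr_ge0 (lambda * B).
  by move: (le_trans (u_le y0) lambdaB_le); rewrite ler_norml; lra.
apply: (@le_trans _ _ (\int[mu]_(e in `]s, +oo[)
   (K%:E * (p * expR (- c1 * (e - s)) + q * expR (- c2 * (e - s)))%:E))%E).
  apply: ge0_le_integral => //.
  - apply/measurable_EFinP; apply: (measurableT_comp (@measurable_expR R)).
    by apply: measurable_funD => //; apply: measurable_funM.
  - apply: emeasurable_funM => //; apply/measurable_EFinP; apply: measurable_funTS.
    exact: mexp2.
  - move=> e; rewrite /= in_itv/= andbT => se.
    have e0 : 0 <= e - s by rewrite subr_ge0 ltW.
    rewrite -EFinM lee_fin uE//.
    have hT : (`|T e - (e - s) - B * (expR (rho * (e - s)) - 1)| <= eta).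
      by have := @T_approx (e - s); rewrite subr_gt0 => /(_ se); rewrite subrKC.
    have hl : lambda * (T e - (e - s) - B * (expR (rho * (e - s)) - 1)) <= `|lambda| * eta.
      by apply: (le_trans (ler_norm _)); rewrite normrM ler_wpM2l.
    set u := lambda * B * (expR (rho * (e - s)) - 1).
    apply: (@le_trans _ _ (K * expR (- c1 * (e - s)) * expR u)).
      rewrite /K -!expRD ler_expR /u /c1.
      by rewrite -subr_ge0; move: hl; rewrite -subr_ge0; lra.
    rewrite -mulrA ler_wpM2l// ler_wpM2l ?expR_ge0//.
    apply: (le_trans (expR_le1DxD2x2 (le_trans (u_le e0) lambdaB_le))).
    by rewrite lerD2l ler_wpM2l// u2_le.
rewrite ge0_integralZl//; first last.
- by move=> e; rewrite /= in_itv/= andbT => se; rewrite lee_fin pos// subr_ge0 ltW.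
- by apply/measurable_EFinP; apply: measurable_funTS; exact: mexp2.
rewrite integral_exp2// -EFinM lee_fin /K -mulrA ler_wpM2l ?expR_ge0//.
have -> : p / c1 + q / c2 = c1^-1 * (1 + v + 2 * (lambda * B) ^+ 2).
  by rewrite /p /q /v /c1 /c2; field; rewrite !gt_eqF.
have -> : lambda * m + lambda ^+ 2 / 2 + err = `|lambda| * eta +
  ((lambda + lambda ^+ 2 / 2 + 2 * `|lambda| ^+ 3) +
   (lambda * (m - 1) + 2 * lambda ^+ 2 * `|B| + 2 * (lambda * B) ^+ 2)).
  by rewrite /err; ring.
rewrite expRD ler_wpM2l ?expR_ge0// expRD.
apply: ler_pM.
- by rewrite invr_ge0 ltW.
- by have := sqr_ge0 (lambda * B); move: (le_trans v_le lambdaB_le); rewrite ler_norml; lra.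
- have c1i : 0 < c1^-1 by rewrite invr_gt0.
  rewrite -[leLHS](lnK c1i) ler_expR.
  by move: c1_approx; rewrite ler_norml; lra.
- apply: (le_trans _ (expR_ge1Dx _)).
  by move: v_approx; rewrite ler_norml; lra.
Qed.

(** As for the upper bound, with [expR u >= 1 + u] inside the integral; the quadratic error now
    appears when [1 + v] is bounded below by an exponential. *)
Lemma exp_moment_lb :
  ((expR (- s) * expR (lambda * m + lambda ^+ 2 / 2 - err))%:E <=
   \int[mu]_(e in `]s, +oo[) (expR (- e + lambda * T e))%:E)%E.
Proof.
pose p := 1 - lambda * B; pose q := lambda * B.
pose K := expR (- s) * expR (- (`|lambda| * eta)).
have K0 : 0 <= K by rewrite mulr_ge0 ?expR_ge0.
have uE y : 0 <= y -> p * expR (- c1 * y) + q * expR (- c2 * y) =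
    expR (- c1 * y) * (1 + lambda * B * (expR (rho * y) - 1)).
  move=> y0; rewrite /p /q (_ : - c2 * y = - c1 * y + rho * y); last first.
    by rewrite /c1 /c2; ring.
  by rewrite expRD; ring.
have pos y : 0 <= y -> 0 <= p * expR (- c1 * y) + q * expR (- c2 * y).
  move=> y0; rewrite uE// mulr_ge0 ?expR_ge0//.
  by move: (le_trans (u_le y0) lambdaB_le); rewrite ler_norml; lra.
apply: (@le_trans _ _ (\int[mu]_(e in `]s, +oo[)
   (K%:E * (p * expR (- c1 * (e - s)) + q * expR (- c2 * (e - s)))%:E))%E); last first.
  apply: ge0_le_integral => //.
  - move=> e; rewrite /= in_itv/= andbT => se; rewrite -EFinM lee_fin mulr_ge0//.
    by rewrite pos// subr_ge0 ltW.
  - apply: emeasurable_funM => //; apply/measurable_EFinP; apply: measurable_funTS.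
    exact: mexp2.
  - apply/measurable_EFinP; apply: (measurableT_comp (@measurable_expR R)).
    by apply: measurable_funD => //; apply: measurable_funM.
  - move=> e; rewrite /= in_itv/= andbT => se.
    have e0 : 0 <= e - s by rewrite subr_ge0 ltW.
    rewrite -EFinM lee_fin uE//.
    have hT : (`|T e - (e - s) - B * (expR (rho * (e - s)) - 1)| <= eta).
      by have := @T_approx (e - s); rewrite subr_gt0 => /(_ se); rewrite subrKC.
    have hl : - (`|lambda| * eta) <= lambda * (T e - (e - s) - B * (expR (rho * (e - s)) - 1)).
      rewrite lerNl; apply: (le_trans (ler_norm _)); rewrite normrN normrM ler_wpM2l//.
    set u := lambda * B * (expR (rho * (e - s)) - 1).
    apply: (@le_trans _ _ (K * expR (- c1 * (e - s)) * expR u)).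
      by rewrite -mulrA ler_wpM2l// ler_wpM2l ?expR_ge0// expR_ge1Dx.
    rewrite /K -!expRD ler_expR /u /c1.
    by rewrite -subr_ge0; move: hl; rewrite -subr_ge0; lra.
rewrite ge0_integralZl//; first last.
- by move=> e; rewrite /= in_itv/= andbT => se; rewrite lee_fin pos// subr_ge0 ltW.
- by apply/measurable_EFinP; apply: measurable_funTS; exact: mexp2.
rewrite integral_exp2// -EFinM lee_fin /K -[leRHS]mulrA ler_wpM2l ?expR_ge0//.
have -> : p / c1 + q / c2 = c1^-1 * (1 + v).
  by rewrite /p /q /v /c1 /c2; field; rewrite !gt_eqF.
have -> : lambda * m + lambda ^+ 2 / 2 - err = - (`|lambda| * eta) +
  ((lambda + lambda ^+ 2 / 2 - 2 * `|lambda| ^+ 3) +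
   (lambda * (m - 1) - 2 * lambda ^+ 2 * `|B| - 2 * (lambda * B) ^+ 2)).
  by rewrite /err; ring.
rewrite expRD ler_wpM2l ?expR_ge0// expRD.
apply: ler_pM; rewrite ?expR_ge0//.
- have c1i : 0 < c1^-1 by rewrite invr_gt0.
  rewrite -[leRHS](lnK c1i) ler_expR.
  by move: c1_approx; rewrite ler_norml; lra.
- apply: (le_trans _ (expR_sub2x2_le1D (le_trans v_le lambdaB_le))).
  rewrite ler_expR.
  have : v ^+ 2 <= (lambda * B) ^+ 2.
    rewrite -[leLHS]real_normK ?num_real// -[leRHS]real_normK ?num_real//.
    by rewrite ler_sqr ?nnegrE.
  by move: v_approx; rewrite ler_norml; lra.
Qed.

End TiltedExponential.
End ExponentialMoment.

(** * Excesses over a threshold near the typical value *)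

Section ConditionalMoments.
Context {R : realType} {d : measure_display} {T : measurableType d}.
Variables (P : probability T R) (alpha rho : R) (U A : R -> R).
Hypothesis alpha_gt0 : 0 < alpha.
Hypothesis U_RV : RV' (alpha^-1) U.
Hypothesis U_A : second_order alpha rho U A.
Hypothesis rho_lt0 : rho < 0.
Variable Y : {RV P >-> R}.
Hypothesis Y_dist : dist_RV U Y.
Local Notation mu := (@lebesgue_measure R).

(** The boolean will be [i <= j], so that an equal value ranks above exactly when its index comes
    first. *)
Definition exceeds (b : bool) (x y : R) : bool := if b then x <= y else x < y.

Lemma expectation_expU (h : R -> \bar R) :
  measurable_fun setT h -> (forall y, (0 <= h y)%E) ->
  (\int[P]_w h (Y w) =
   \int[mu]_(e in `]0%R, +oo[) (h (expU U e) * (expR (- e))%:E))%E.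
Proof.
move=> mh h0.
rewrite -(ge0_integral_distribution Y mh)//.
apply: (@ge0_integral_density _ _ (measurableTypeR R) R R mu (distribution P Y)
  `]0%R, +oo[%classic (expU U) (fun e => expR (- e)) h) => //.
- exact: (measurable_expU U_RV).
- apply: (measurableT_comp (@measurable_expR R)); exact: oppr_measurable.
- move=> B mB; rewrite [LHS](Y_dist mB) /exponential_prob.
  have -> : [set e : R | 0 < e /\ B (U (expR e))] = `]0%R, +oo[ `&` expU U @^-1` B.
    apply/seteqP; split => e /=; rewrite in_itv/= andbT => -[e0];
    by rewrite expUE.
  apply: eq_integral => e; rewrite inE/= in_itv/= andbT => -[e0 _].
  by rewrite exponential_pdfE ?ltW// mul1r mulN1r.
Qed.

(** As [U] is nondecreasing, the set of [e] with [Q (U (expR e))] is a ray starting at its infimum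
    [s]; whether the endpoint belongs to it does not change the integral. The points [e0] and [e1]
    bracket [s]. *)
Lemma integral_upper_set (Q : R -> bool) (F : R -> R) (e0 e1 : R) :
  (forall y z, y <= z -> Q y -> Q z) ->
  measurable_fun setT F -> (forall e, 0 <= F e) ->
  0 < e0 -> 0 < e1 -> ~~ Q (U (expR e0)) -> Q (U (expR e1)) ->
  exists s, [/\ e0 <= s <= e1,
    forall e, 0 < e -> e < s -> ~~ Q (U (expR e)),
    forall e, s < e -> Q (U (expR e)) &
    (\int[mu]_(e in `]0%R, +oo[) ((Q (expU U e))%:R * F e)%:E =
     \int[mu]_(e in `]s, +oo[) (F e)%:E)%E].
Proof.
move=> Qup mF F0 e00 e10 nQ0 Q1.
pose W := [set e | 0 < e /\ Q (U (expR e))].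
have W1 : W e1 by [].
have Wlb : lbound W e0.
  move=> e [e_gt0 Qe]; rewrite leNgt; apply/negP => ee0.
  by move/negP: nQ0; apply; apply: Qup Qe; apply: (U_expR_le U_RV) => //; exact: ltW.
have hiW : has_inf W by split; [exists e1|exists e0].
pose s := inf W.
have s0 : e0 <= s by apply: lb_le_inf => //; exists e1.
have s1 : s <= e1 by apply: ge_inf => //; exists e0.
have below e : 0 < e -> e < s -> ~~ Q (U (expR e)).
  move=> e_gt0 es; apply/negP => Qe.
  by have := @ge_inf _ W (ex_intro _ e0 Wlb) e (conj e_gt0 Qe); rewrite -/s leNgt es.
have above e : s < e -> Q (U (expR e)).
  move=> se; have := @inf_adherent _ W (e - s) _ hiW; rewrite subr_gt0 => /(_ se).
  move=> [z [z0 Qz]]; rewrite -/s subrKC => ze.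
  by apply: Qup Qz; apply: (U_expR_le U_RV) => //; exact: ltW.
exists s; split => //; first by rewrite s0.
have mFE (D : set R) : measurable_fun D (fun e => (F e)%:E).
  by apply/measurable_EFinP; exact: measurable_funTS.
transitivity (\int[mu]_(e in W) (F e)%:E)%E.
  have -> : W = `]0%R, +oo[ `&` W.
    by apply/seteqP; split => e /=; rewrite in_itv/= andbT => -[e_gt0]; [|case].
  rewrite integral_mkcondr; apply: eq_integral => e.
  rewrite inE/= in_itv/= andbT => e_gt0; rewrite patchE expUE//.
  case: ifPn; first by rewrite inE => -[_ ->]; rewrite mul1r.
  rewrite notin_setE => nW; case: (boolP (Q _)) => Qe; last by rewrite mul0r.
  by exfalso; apply: nW.
have [Ws|nWs] := pselect (W s).
  have -> : W = `[s, +oo[%classic.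
    apply/seteqP; split => e /=; rewrite in_itv/= andbT.
      by move=> We; apply: ge_inf => //; exists e0.
    rewrite le_eqVlt => /predU1P[<-//|se]; split; last exact: above.
    by apply: lt_trans se; exact: lt_le_trans s0.
  by rewrite integral_itv_obnd_cbnd.
have -> : W = `]s, +oo[%classic => //.
apply/seteqP; split => e /=; rewrite in_itv/= andbT.
  move=> We; rewrite lt_neqAle; apply/andP; split; first by apply: contra_notN nWs => /eqP ->.
  by apply: ge_inf => //; exists e0.
move=> se; split; last exact: above.
by apply: lt_trans se; exact: lt_le_trans s0.
Qed.

Lemma integral_expRN (s : R) :
  (\int[mu]_(e in `]s, +oo[) (expR (- e))%:E = (expR (- s))%:E)%E.
Proof.
transitivity (\int[mu]_(e in `]s, +oo[)
    (expR (- s) * expR (- 1 * (e - s)) + 0 * expR (- 1 * (e - s)))%:E)%E.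
  apply: eq_integral => e _; rewrite mul0r addr0 -expRD; congr (expR _)%:E; ring.
rewrite integral_exp2//; first by rewrite mul0r divr1 addr0.
Qed.

Lemma exceeds_le b (x y z : R) : y <= z -> exceeds b x y -> exceeds b x z.
Proof. by rewrite /exceeds; case: b => yz xy; [exact: le_trans yz|exact: lt_le_trans yz]. Qed.

Lemma measurable_exceeds b (x : R) :
  measurable_fun setT (fun y : R => (exceeds b x y)%:R : R).
Proof.
have -> : (fun y : R => (exceeds b x y)%:R : R) =
    \1_[set` Interval (BSide b x) +oo%O].
  apply/funext => y; rewrite indicE; congr (nat_of_bool _)%:R.
  by apply/idP/idP; rewrite inE/= in_itv/= /exceeds andbT; case: b.
exact: measurable_indic.
Qed.

(** Exceeding [x] means that the exponential variable behind [Y] exceeds [s], so [s] is minus the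
    log-probability of an exceedance, whether or not [x] is a value of [U]. *)
Lemma exceed_expectation b (x e0 e1 lambda : R) : 0 < x ->
  0 < e0 -> 0 < e1 -> ~~ exceeds b x (U (expR e0)) -> exceeds b x (U (expR e1)) ->
  exists s, [/\ e0 <= s <= e1,
    forall e, 0 < e -> e < s -> alpha * ln (U (expR e)) <= alpha * ln x,
    forall e, s < e -> alpha * ln x <= alpha * ln (U (expR e)),
    (\int[P]_w ((exceeds b x (Y w))%:R)%:E = (expR (- s))%:E)%E &
    (\int[P]_w ((exceeds b x (Y w))%:R * expR (lambda * (alpha * ln (Y w) - alpha * ln x)))%:E =
    \int[mu]_(e in `]s, +oo[)
      (expR (- e + lambda * (alpha * ln (expU U e) - alpha * ln x)))%:E)%E].
Proof.
move=> x0 e00 e10 nQ0 Q1.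
have al0 := ltW alpha_gt0.
pose F l (e : R) := expR (- e + l * (alpha * ln (expU U e) - alpha * ln x)).
have mln (g : R -> R) : measurable_fun setT g ->
    measurable_fun setT (fun e => alpha * ln (g e) - alpha * ln x).
  move=> mg; apply: measurable_funB => //; apply: measurable_funM => //.
  exact: (measurableT_comp (@measurable_ln R)).
have mF l : measurable_fun setT (F l).
  apply: (measurableT_comp (@measurable_expR R)); apply: measurable_funD => //.
  by apply: measurable_funM => //; apply: mln; exact: (measurable_expU U_RV).
have F0 l e : 0 <= F l e by exact: expR_ge0.
have [s [s01 below above sE]] := integral_upper_set (@exceeds_le b x) (mF lambda)
  (F0 lambda) e00 e10 nQ0 Q1.
have [s' [s01' below' above' sE']] := integral_upper_set (@exceeds_le b x) (mF 0)
  (F0 0) e00 e10 nQ0 Q1.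
(* The two applications return separate endpoints; a point strictly between them would both satisfy
   and violate the predicate. *)
have ss' : s' = s.
  apply/eqP; rewrite eq_le !leNgt; apply/andP; split; apply/negP => lt_s.
    pose z := (s + s') / 2.
    have /negP := below' z ltac:(rewrite /z; lra) ltac:(rewrite /z; lra).
    by apply; apply: above; rewrite /z; lra.
  pose z := (s + s') / 2.
  have /negP := below z ltac:(rewrite /z; lra) ltac:(rewrite /z; lra).
  by apply; apply: above'; rewrite /z; lra.
have tauLe e y : 0 < e -> U (expR e) <= y -> alpha * ln (U (expR e)) <= alpha * ln y.
  move=> ep uy; rewrite ler_wpM2l// ler_ln ?posrE// ?(U_expR_gt0 U_RV)//.
  by apply: lt_le_trans uy; exact: (U_expR_gt0 U_RV).
have inE' l : (\int[P]_w ((exceeds b x (Y w))%:R * expR (l * (alpha * ln (Y w) - alpha * ln x)))%:E =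
    \int[mu]_(e in `]0%R, +oo[) ((exceeds b x (expU U e))%:R * F l e)%:E)%E.
  rewrite (@expectation_expU (fun y => ((exceeds b x y)%:R * expR (l * (alpha * ln y - alpha * ln x)))%:E)).
  - by apply: eq_integral => e _; rewrite -EFinM /F expRD; congr _%:E; ring.
  - apply/measurable_EFinP; apply: measurable_funM; first exact: measurable_exceeds.
    apply: (measurableT_comp (@measurable_expR R)); apply: measurable_funM => //.
    exact: mln.
  - by move=> y; rewrite lee_fin mulr_ge0// expR_ge0.
exists s; split => //.
- move=> e ep /(below _ ep) nQ; apply: tauLe => //.
  by move: nQ; rewrite /exceeds; case: (b); rewrite -?ltNge -?leNgt // => /ltW.
- move=> e se; have ep : 0 < e by case/andP: s01 => s0 _; apply: lt_trans se; exact: lt_le_trans s0.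
  rewrite ler_wpM2l// ler_ln ?posrE// ?(U_expR_gt0 U_RV)//.
  by have := above e se; rewrite /exceeds; case: (b) => // /ltW.
- transitivity (\int[P]_w ((exceeds b x (Y w))%:R * expR (0 * (alpha * ln (Y w) - alpha * ln x)))%:E)%E.
    by apply: eq_integral => w _; rewrite mul0r expR0 mulr1.
  rewrite inE' sE' ss' -integral_expRN; apply: eq_integral => e _.
  by rewrite /F mul0r addr0.
- by rewrite inE' sE.
Qed.

(** The factor [expR (- s)] is common to [I] and [I0], so what remains is the moment generating
    function of an excess at tilt [c * theta]. With [A = O(theta)] the perturbation [B] is
    [O(theta)], and all terms of [err] are [O(theta^3)] except the first, which is a small multiple
    of [theta^2]. *)
Lemma conditional_mgf (eps K c : R) : 0 < eps -> 0 <= K ->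
  exists delta, 0 < delta /\ exists s0 th0, [/\ delta < s0, 0 < th0 &
  forall (s1 theta x : R) b, s0 <= s1 -> 0 < theta -> theta <= th0 ->
  `|A (expR s1)| <= K * theta ->
  U (expR (s1 - delta)) < x -> x < U (expR (s1 + delta)) ->
  let m := 1 + alpha * A (expR s1) / (1 - rho) in
  let I0 := (\int[P]_w ((exceeds b x (Y w))%:R)%:E)%E in
  let I := (\int[P]_w ((exceeds b x (Y w))%:R *
     expR (c * theta * (alpha * ln (Y w) - alpha * ln x)))%:E)%E in
  ((expR (c * theta * m + (c * theta) ^+ 2 / 2 - eps * theta ^+ 2))%:E * I0 <= I /\
   I <= (expR (c * theta * m + (c * theta) ^+ 2 / 2 + eps * theta ^+ 2))%:E * I0)%E].
Proof.
move=> eps0 K0.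
have [L [_ hexp]] := tail_expansion alpha_gt0 U_RV U_A rho_lt0.
pose K1 := `|alpha / rho| * K.
have K10 : 0 <= K1 by rewrite mulr_ge0.
(* Makes the first term of [err] at most [eps / 2 * theta ^+ 2]. *)
pose e1 := eps / (2 * (`|c| * K + 1)).
have cK1 : 0 < `|c| * K + 1 by rewrite ltr_wpDl// mulr_ge0.
have e10 : 0 < e1 by rewrite divr_gt0// mulr_gt0.
have [delta [delta0 [r hr]]] := hexp _ e10.
pose C := 1 + `|c| + 2 * `|c| ^+ 3 + 2 * c ^+ 2 * K1 ^+ 2 + 2 * c ^+ 2 * K1 + `|c| * K1.
have c20 : 0 <= c ^+ 2 by exact: sqr_ge0.
have K120 : 0 <= K1 ^+ 2 by exact: sqr_ge0.
have t1 : 0 <= 2 * `|c| ^+ 3 by rewrite mulr_ge0// exprn_ge0.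
have t2 : 0 <= 2 * c ^+ 2 * K1 ^+ 2 by apply: mulr_ge0 => //; apply: mulr_ge0.
have t3 : 0 <= 2 * c ^+ 2 * K1 by apply: mulr_ge0 => //; apply: mulr_ge0.
have t4 : 0 <= `|c| * K1 by rewrite mulr_ge0.
have t5 : 0 <= `|c| by [].
have C1 : 1 <= C by rewrite /C; lra.
(* [C] sums the coefficients of the higher-order terms of [err] and those of the tilts [c * theta]
   and [c * theta * B]: the second entry makes the former at most [eps / 2 * theta ^+ 2], the third
   keeps the tilts below 1/2. *)
pose th0 := Num.min 1 (Num.min (eps / (2 * C)) (1 / (2 * C))).
have C20 : 0 < 2 * C by lra.
exists delta; split => //; exists (Num.max r delta + 1), th0; split.
- by rewrite ltr_pwDr// le_max lexx orbT.
- by rewrite /th0 !lt_min ltr01 !divr_gt0.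
move=> s1 theta x b rs1 th_gt0 th_le A_le xlo xhi m I0 I.
have th1 : theta <= 1 by apply: (le_trans th_le); rewrite ge_min lexx.
have th2 : C * theta <= eps / 2.
  have : theta <= eps / (2 * C) by apply: (le_trans th_le); rewrite !ge_min lexx !orbT.
  by rewrite ler_pdivlMr//; lra.
have th3 : C * theta <= 1 / 2.
  have : theta <= 1 / (2 * C) by apply: (le_trans th_le); rewrite !ge_min lexx !orbT.
  by rewrite ler_pdivlMr//; lra.
have rle : r <= Num.max r delta by rewrite le_max lexx.
have dle : delta <= Num.max r delta by rewrite le_max lexx orbT.
have p0 : 0 < s1 - delta by lra.
have p1 : 0 < s1 + delta by lra.
have x0 : 0 < x by apply: lt_trans xlo; exact: (U_expR_gt0 U_RV).
have nQ : ~~ exceeds b x (U (expR (s1 - delta))).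
  by rewrite /exceeds; case: (b); rewrite -?ltNge -?leNgt// ltW.
have Q : exceeds b x (U (expR (s1 + delta))).
  by rewrite /exceeds; case: (b) => //; rewrite ltW.
have [s [/andP[sl sr] below above I0E IE]] :=
  exceed_expectation (c * theta) x0 p0 p1 nQ Q.
have ss1 : `|s - s1| <= delta by rewrite ler_norml; lra.
have rs1' : r <= s1 by lra.
have [s_gt0 hT] := hr s1 s (alpha * ln x) rs1' ss1 below above.
pose a1 := A (expR s1); rewrite -/a1 in A_le hT.
pose B := alpha / rho * a1.
have rho0 : rho != 0 by rewrite lt_eqF.
have r1 : 1 - rho != 0 by rewrite gt_eqF//; have := rho_lt0; lra.
have mE : m = 1 + B * rho / (1 - rho) by rewrite /m -/a1 /B; field; rewrite rho0 r1.
have B_le : `|B| <= K1 * theta by rewrite /B normrM /K1 -mulrA ler_wpM2l.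
have lam_le : `|c * theta| <= 1 / 2.
  rewrite normrM (gtr0_norm th_gt0); apply: le_trans th3; rewrite ler_wpM2r ?(ltW th_gt0)//.
  by rewrite /C; lra.
have lamB_le : `|c * theta * B| <= 1 / 2.
  rewrite normrM; apply: le_trans th3.
  apply: (@le_trans _ _ (`|c| * K1 * theta)); last first.
    by rewrite ler_wpM2r ?(ltW th_gt0)// /C; lra.
  have -> : `|c * theta| * `|B| = `|c| * (theta * `|B|).
    by rewrite normrM (gtr0_norm th_gt0) mulrA.
  have : theta * `|B| <= `|B| by rewrite ler_piMl.
  by move=> tB; rewrite -mulrA ler_wpM2l// (le_trans tB).
pose Tf e := alpha * ln (expU U e) - alpha * ln x.
have mT : measurable_fun `]s, +oo[ Tf.
  apply: measurable_funTS; apply: measurable_funB => //; apply: measurable_funM => //.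
  by apply: (measurableT_comp (@measurable_ln R)); exact: (measurable_expU U_RV).
have T_approx y : 0 < y -> `|Tf (s + y) - y - B * (expR (rho * y) - 1)| <= e1 * K * theta.
  move=> y0; rewrite /Tf expUE; last by rewrite addr_gt0.
  apply: (le_trans (hT _ y0)); by rewrite -mulrA ler_wpM2l// ltW.
have ub := exp_moment_ub rho_lt0 lam_le lamB_le mT T_approx.
have lb := exp_moment_lb rho_lt0 lam_le lamB_le mT T_approx.
rewrite -mE in ub lb.
set err := _ + _ + _ + _ in ub lb.
have err_le : err <= eps * theta ^+ 2.
  have th20 : 0 <= theta ^+ 2 by exact: sqr_ge0.
  have q1 : `|c * theta| * (e1 * K * theta) <= eps / 2 * theta ^+ 2.
    rewrite normrM (gtr0_norm th_gt0).
    have -> : `|c| * theta * (e1 * K * theta) = (`|c| * K) * e1 * theta ^+ 2 by ring.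
    rewrite ler_wpM2r// /e1.
    have -> : `|c| * K * (eps / (2 * (`|c| * K + 1))) = eps / 2 * (`|c| * K / (`|c| * K + 1)).
      by field; rewrite gt_eqF.
    rewrite ler_piMr ?divr_ge0 ?(ltW eps0)// ler_pdivrMr//; lra.
  have q2 : 2 * `|c * theta| ^+ 3 = 2 * `|c| ^+ 3 * theta * theta ^+ 2.
    by rewrite normrM (gtr0_norm th_gt0); ring.
  have q3 : 2 * (c * theta * B) ^+ 2 <= 2 * c ^+ 2 * K1 ^+ 2 * theta * theta ^+ 2.
    have -> : 2 * (c * theta * B) ^+ 2 = 2 * c ^+ 2 * theta ^+ 2 * `|B| ^+ 2.
      by rewrite real_normK ?num_real//; ring.
    have -> : 2 * c ^+ 2 * K1 ^+ 2 * theta * theta ^+ 2 =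
      2 * c ^+ 2 * theta ^+ 2 * (K1 ^+ 2 * theta) by ring.
    apply: ler_wpM2l; first by apply: mulr_ge0 => //; apply: mulr_ge0.
    apply: (@le_trans _ _ ((K1 * theta) ^+ 2)).
      by rewrite ler_sqr ?nnegrE// mulr_ge0// ltW.
    rewrite exprMn ler_wpM2l// expr2 ler_piMl// ltW//.
  have q4 : 2 * (c * theta) ^+ 2 * `|B| <= 2 * c ^+ 2 * K1 * theta * theta ^+ 2.
    have -> : 2 * c ^+ 2 * K1 * theta * theta ^+ 2 = 2 * (c * theta) ^+ 2 * (K1 * theta) by ring.
    apply: ler_wpM2l => //; apply: mulr_ge0 => //; exact: sqr_ge0.
  have q5 : (2 * `|c| ^+ 3 + 2 * c ^+ 2 * K1 ^+ 2 + 2 * c ^+ 2 * K1) * theta * theta ^+ 2 <=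
      eps / 2 * theta ^+ 2.
    rewrite ler_wpM2r//; apply: le_trans th2; rewrite ler_wpM2r ?(ltW th_gt0)//.
    by rewrite /C; lra.
  move: q5; rewrite /err q2 !mulrDl => q5.
  by lra.
rewrite /I0 /I I0E IE; split.
- apply: le_trans lb; rewrite -EFinM lee_fin mulrC ler_wpM2l ?expR_ge0//.
  by rewrite ler_expR lerD2l lerN2.
- apply: (le_trans ub); rewrite -EFinM lee_fin [leRHS]mulrC ler_wpM2l ?expR_ge0//.
  by rewrite ler_expR lerD2l.
Qed.

(** The first part of [tail_expansion] says that [alpha * ln (U (expR s))] is [s] plus a constant up
    to a small error, so moving the level by [delta] moves the tail exponent by at least
    [delta / 2]. *)
Lemma tail_probability delta : 0 < delta -> exists s0, forall s1, s0 <= s1 ->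
  [/\ 0 < s1 - delta,
   (\int[P]_w ((exceeds true (U (expR (s1 + delta))) (Y w))%:R)%:E <=
     (expR (- (s1 + delta / 2)))%:E)%E &
   ((expR (- (s1 - delta / 2)))%:E <=
     \int[P]_w ((exceeds false (U (expR (s1 - delta))) (Y w))%:R)%:E)%E].
Proof.
move=> delta0.
have [L [hL _]] := tail_expansion alpha_gt0 U_RV U_A rho_lt0.
(* Two errors of [delta / 8] leave a positive gap out of [delta / 2], so [U] increases strictly over
   such a step. *)
have d8 : 0 < delta / 8 by lra.
have [s0 h0] := hL _ d8.
have U_lt s t : s0 <= s -> 0 < s -> s + delta / 2 <= t -> U (expR s) < U (expR t).
  move=> s0s sp st.
  have t0 : 0 < t by lra.
  rewrite -ltr_ln ?posrE ?(U_expR_gt0 U_RV)// -(ltr_pM2l alpha_gt0).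
  have := h0 s s0s; have := h0 t ltac:(lra); rewrite !ler_norml => /andP[? ?] /andP[? ?].
  by lra.
exists (Num.max s0 0 + delta + 1) => s1 s1_ge.
have m1 : s0 <= Num.max s0 0 by rewrite le_max lexx.
have m2 : 0 <= Num.max s0 0 by rewrite le_max lexx orbT.
have p0 : 0 < s1 - delta by lra.
have p1 : 0 < s1 + delta by lra.
have p2 : 0 < s1 + delta / 2 by lra.
have p3 : 0 < s1 - delta / 2 by lra.
split => //.
- have u : U (expR (s1 + delta / 2)) < U (expR (s1 + delta)) by apply: U_lt; lra.
  have nQ : ~~ exceeds true (U (expR (s1 + delta))) (U (expR (s1 + delta / 2))).
    by rewrite /exceeds -ltNge.
  have Q : exceeds true (U (expR (s1 + delta))) (U (expR (s1 + delta))) by rewrite /exceeds.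
  have [s [/andP[sl _] _ _ -> _]] := exceed_expectation 0 (U_expR_gt0 U_RV p1) p2 p1 nQ Q.
  by rewrite lee_fin ler_expR lerN2.
- have u : U (expR (s1 - delta)) < U (expR (s1 - delta / 2)) by apply: U_lt; lra.
  have nQ : ~~ exceeds false (U (expR (s1 - delta))) (U (expR (s1 - delta))).
    by rewrite /exceeds ltxx.
  have [s [/andP[_ sr] _ _ -> _]] := exceed_expectation 0 (U_expR_gt0 U_RV p0) p0 p3 nQ u.
  by rewrite lee_fin ler_expR lerN2.
Qed.

End ConditionalMoments.

(** * Order statistics of the sample *)

Section OrderStatistics.
Context {R : realType} {d : measure_display} {T : measurableType d}.
Variable P : probability T R.
Variable X : nat -> {RV P >-> R}.

Lemma ranks_aboveE (x : nat -> R) i j :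
  ranks_above x i j = exceeds (i <= j)%N (x j) (x i).
Proof.
by rewrite /ranks_above /exceeds; case: (i <= j)%N; rewrite ?andbF ?orbF// andbT orbC
  [in RHS]le_eqVlt eq_sym.
Qed.

Lemma measurable_natr_bool d' (T' : measurableType d') (f : T' -> bool) : measurable_fun setT f ->
  measurable_fun setT (fun w => (f w)%:R : R).
Proof.
move=> mf; have -> : (fun w => (f w)%:R : R) = (fun w => if f w then 1 else 0).
  by apply/funext => w; case: (f w).
exact: measurable_fun_ifT.
Qed.

Lemma measurable_invr : measurable_fun setT (fun x : R => x^-1).
Proof.
rewrite (_ : (fun x : R => x^-1) = fun x =>
  (0 < x)%R%:R * expR (- ln x) - (x < 0)%R%:R * expR (- ln (- x))).
  apply: measurable_funB; apply: measurable_funM.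
  - by apply: measurable_natr_bool; exact: measurable_fun_ltr.
  - apply: (measurableT_comp (@measurable_expR R)).
    by apply: (measurableT_comp (@oppr_measurable R setT)); exact: measurable_ln.
  - by apply: measurable_natr_bool; exact: measurable_fun_ltr.
  - apply: (measurableT_comp (@measurable_expR R)).
    apply: (measurableT_comp (@oppr_measurable R setT)).
    by apply: (measurableT_comp (@measurable_ln R)); exact: oppr_measurable.
apply/funext => x; case: (ltgtP x 0) => [x0|x0|->].
- by rewrite mul0r mul1r sub0r expRN lnK ?posrE ?oppr_gt0// invrN opprK.
- by rewrite mul0r mul1r subr0 expRN lnK.
- by rewrite !mul0r subr0 invr0.
Qed.

Lemma measurable_exceeds_rv b i j :
  measurable_fun setT (fun w => exceeds b (X j w) (X i w)).
Proof. by case: b; [exact: measurable_fun_ler|exact: measurable_fun_ltr]. Qed.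

Let rank n (j : 'I_n) w : R := #|top_set (fun i => X i w) j|%:R.

Lemma rankE n (j : 'I_n) w : rank j w =
  \sum_(i < n) ((i != j) && exceeds (i <= j)%N (X j w) (X i w))%:R.
Proof.
rewrite /rank -sum1_card natr_sum big_mkcond/=; apply: eq_bigr => i _.
by rewrite inE ranks_aboveE; case: ifP.
Qed.

Lemma measurable_rank n (j : 'I_n) k :
  measurable_fun setT (fun w => #|top_set (fun i => X i w) j| == k).
Proof.
have -> : (fun w => #|top_set (fun i => X i w) j| == k) = (fun w => rank j w == k%:R).
  by apply/funext => w; rewrite /rank eqr_nat.
apply: measurable_fun_eqr => //.
rewrite (_ : rank j = fun w =>
  \sum_(i < n) ((i != j) && exceeds (i <= j)%N (X j w) (X i w))%:R); last first.
  by apply/funext => w; exact: rankE.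
apply: measurable_sum => i; apply: measurable_natr_bool.
apply: measurable_and => //; exact: measurable_exceeds_rv.
Qed.

(** Exactly one index has rank [k]; this glues the order statistic from the [X j] on measurable
    events. *)
Lemma order_statE n k w : (k < n)%N -> order_stat X k.+1 n w =
  \sum_(j < n) (#|top_set (fun i => X i w) j| == k)%:R * X j w.
Proof.
move=> kn; have [j hj] := exists_rank (fun i => X i w) kn.
rewrite (bigD1 j)//= hj eqxx mul1r big1 ?addr0; last first.
  by move=> i ij; rewrite hj (negbTE ij) mul0r.
by apply: nth_rank; apply/eqP; rewrite hj.
Qed.

Lemma measurable_order_stat k n : (0 < k <= n)%N ->
  measurable_fun setT (order_stat X k n).
Proof.
case: k => // k /= kn.
rewrite (_ : order_stat X k.+1 n = fun w =>
  \sum_(j < n) (#|top_set (fun i => X i w) j| == k)%:R * X j w); last first.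
  by apply/funext => w; rewrite order_statE.
apply: measurable_sum => j; apply: measurable_funM => //.
by apply: measurable_natr_bool; exact: measurable_rank.
Qed.

Lemma measurable_hill k n : (0 < k <= n)%N -> measurable_fun setT (hill X k n).
Proof.
move=> /andP[k0 kn].
rewrite (_ : hill X k n = fun w => k%:R^-1 *
  \sum_(i < k) ln (order_stat X i.+1 n w / order_stat X k n w)); last first.
  by apply/funext => w; rewrite /hill big_add1/= big_mkord.
apply: measurable_funM => //; apply: measurable_sum => i.
apply: (measurableT_comp (@measurable_ln R)); apply: measurable_funM.
  by apply: measurable_order_stat; rewrite /= (leq_trans (ltn_ord i) kn).
apply: (measurableT_comp measurable_invr).
by apply: measurable_order_stat; rewrite k0.
Qed.

Variables (b : bool) (x : R).
Definition exceedances n (w : T) : R := \sum_(i < n) (exceeds b x (X i w))%:R.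

Lemma measurable_exceedances n : measurable_fun setT (exceedances n).
Proof.
by apply: measurable_sum => i; apply: (measurableT_comp (measurable_exceeds b x)).
Qed.

Hypothesis X_indep : mutually_independent X.

(** A binomial moment generating function is below the Poisson one, by [1 + u <= expR u]. The factor
    [expR h - 1] in the hypothesis makes [p] an upper bound of the exceedance probability for
    [h > 0] and a lower bound for [h < 0]. *)
Lemma exceedances_mgf n (h p : R) :
  (forall i, (fine (\int[P]_w ((exceeds b x (X i w))%:R)%:E) * (expR h - 1) <=
     p * (expR h - 1))%R) ->
  (\int[P]_w (expR (h * exceedances n w))%:E <=
     (expR (n%:R * (p * (expR h - 1))))%:E)%E.
Proof.
move=> hp.
have mb i : measurable_fun setT (fun w => (exceeds b x (X i w))%:R : R).
  by apply: (measurableT_comp (measurable_exceeds b x)).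
pose f (z : R * R) := (expR (h * (exceeds b x z.2)%:R))%:E.
have mf : measurable_fun setT f.
  apply/measurable_EFinP; apply: (measurableT_comp (@measurable_expR R)).
  apply: measurable_funM => //; apply: (measurableT_comp (measurable_exceeds b x)).
  exact: measurable_snd.
(* Index [n], outside the sample, serves as a dummy conditioning variable on which the factors do
   not depend. *)
have := expectation_prod_indep X_indep (j := n) (s := index_iota 0 n) (g := fun=> 1%E)
  (h := fun=> f) _ _ _ (fun=> mf) _.
have un : uniq (n :: index_iota 0 n) by rewrite /= mem_index_iota ltnn andbF iota_uniq.
move=> /(_ un (measurable_cst _)) H.
have {}H : (\int[P]_w (1 * \prod_(i <- index_iota 0 n) f (X n w, X i w)) =
    \int[P]_w (1 * \prod_(i <- index_iota 0 n) \int[P]_v f (X n w, X i v)))%E.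
  by apply: H => // *; rewrite lee_fin expR_ge0.
have -> : (\int[P]_w (expR (h * exceedances n w))%:E =
    \int[P]_w (1 * \prod_(i <- index_iota 0 n) f (X n w, X i w)))%E.
  apply: eq_integral => w _; rewrite mul1e /f/= prodEFin/=.
  by rewrite -expR_sum big_mkord mulr_sumr.
rewrite H.
have bound i (y : R) : (\int[P]_v f (y, X i v) <= (expR (p * (expR h - 1)))%:E)%E.
  have := hp i; set I1 := (\int[P]_w _)%E.
  pose I0 := (\int[P]_w ((~~ exceeds b x (X i w))%:R)%:E)%E.
  have mnb : measurable_fun setT (fun w => (~~ exceeds b x (X i w))%:R : R).
    rewrite (_ : (fun w => _) = (fun w => 1 - (exceeds b x (X i w))%:R)).
      exact: measurable_funB.
    by apply/funext => w; case: exceeds; rewrite ?subrr ?subr0.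
  have I1_ge0 : (0 <= I1)%E by apply: integral_ge0 => w _; rewrite lee_fin.
  have I0_ge0 : (0 <= I0)%E by apply: integral_ge0 => w _; rewrite lee_fin.
  have I01 : (I1 + I0 = 1)%E.
    rewrite /I1 /I0 -ge0_integralD//.
    - transitivity (\int[P]_w (cst 1 w))%E; last first.
        by rewrite integral_cst// mul1e; exact: probability_setT.
      by apply: eq_integral => w _; rewrite -EFinD; case: exceeds; rewrite /= ?addr0 ?add0r.
    - exact/measurable_EFinP.
    - exact/measurable_EFinP.
  have I1fin : I1 \is a fin_num.
    by rewrite ge0_fin_numE// (@le_lt_trans _ _ 1%E) ?ltry// -I01 leeDl.
  have -> : (\int[P]_v f (y, X i v) = (expR h)%:E * I1 + I0)%E.
    rewrite /I1 -ge0_integralZl ?lee_fin ?expR_ge0//; last exact/measurable_EFinP.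
    rewrite -ge0_integralD//.
    - apply: eq_integral => w _; rewrite /f/= -EFinM -EFinD; congr _%:E.
      by case: exceeds; rewrite /= ?mulr1 ?mulr0 ?addr0 ?add0r ?expR0.
    - by apply/measurable_EFinP; exact: measurable_funM.
    - exact/measurable_EFinP.
  have -> : I0 = (1 - fine I1)%:E.
    by rewrite EFinB fineK// -I01 addeAC subee// add0e.
  rewrite -[I1]fineK// -EFinM -EFinD lee_fin => hp'.
  have -> : expR h * fine I1 + (1 - fine I1) = 1 + fine I1 * (expR h - 1) by ring.
  by apply: (le_trans (expR_ge1Dx _)); rewrite ler_expR.
have -> : (\int[P]_w (1 * \prod_(i <- index_iota 0 n) \int[P]_v f (X n w, X i v)) =
    \prod_(i <- index_iota 0 n) \int[P]_v f (0%R, X i v))%E.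
  transitivity (\int[P]_w (cst (\prod_(i <- index_iota 0 n) \int[P]_v f (0%R, X i v)) w))%E.
    by apply: eq_integral => w _; rewrite mul1e.
  by rewrite integral_cst// -[RHS]mule1; congr (_ * _)%E; exact: probability_setT.
rewrite -[X in (X%:R * _)](size_iota 0 n) /index_iota subn0.
have f_ge0 i : (0 <= \int[P]_v f (0%R, X i v))%E.
  by apply: integral_ge0 => v _; rewrite lee_fin expR_ge0.
elim: (iota 0 n) => [|i s IH]; first by rewrite big_nil mul0r expR0.
rewrite big_cons /= -natr1 mulrDl mul1r expRD EFinM muleC; apply: lee_pmul => //.
by apply: prode_ge0.
Qed.

End OrderStatistics.

(** * Exponential concentration of the order statistic *)

Section Concentration.
Context {R : realType} {d : measure_display} {T : measurableType d}.
Variable P : probability T R.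
Variable X : nat -> {RV P >-> R}.
Hypothesis X_indep : mutually_independent X.

Lemma chernoff_exceedances b (x h p a : R) n (E : set T) :
  measurable E ->
  (forall i, (fine (\int[P]_w ((exceeds b x (X i w))%:R)%:E) * (expR h - 1) <=
     p * (expR h - 1))%R) ->
  (forall w, E w -> h * a <= h * exceedances X b x n w) ->
  (P E <= (expR (n%:R * (p * (expR h - 1)) - h * a))%:E)%E.
Proof.
move=> mE hp hE.
have mN : measurable_fun setT (fun w => expR (h * exceedances X b x n w)).
  apply: (measurableT_comp (@measurable_expR R)); apply: measurable_funM => //.
  exact: measurable_exceedances.
rewrite expRD EFinM muleC.
apply: (@le_trans _ _ ((expR (- (h * a)))%:E * \int[P]_w (expR (h * exceedances X b x n w))%:E)%E); last first.
  by apply: lee_pmul => //; rewrite ?lee_fin ?expR_ge0//;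
    [apply: integral_ge0 => w _; rewrite lee_fin expR_ge0|exact: exceedances_mgf].
rewrite -ge0_integralZl ?lee_fin ?expR_ge0//; last exact/measurable_EFinP.
rewrite -[E]setIT -integral_indic//; apply: ge0_le_integral => //.
- exact/measurable_EFinP.
- by apply: emeasurable_funM => //; exact/measurable_EFinP.
- move=> w _; rewrite -EFinM lee_fin -expRD indicE.
  case: (boolP (w \in E)) => [|_]; last exact: expR_ge0.
  by rewrite inE => /hE hw; rewrite -expR0 ler_expR addrC subr_ge0.
Qed.

Lemma order_stat_exceedances_ge x k n w : (0 < k <= n)%N ->
  x <= order_stat X k n w -> k%:R <= exceedances X true x n w.
Proof.
case: k => // k /= kn xle.
have [j hj] := exists_rank (fun i => X i w) kn.
have kj : #|top_set (fun i => X i w) j| = k by apply/eqP; rewrite hj.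
have xj : order_stat X k.+1 n w = X j w := nth_rank kj.
rewrite /exceedances (bigD1 j)//= /exceeds -xj xle -natr1 addrC; apply: lerD => //.
rewrite -kj -sum1_card natr_sum big_mkcond/= [leRHS]big_mkcond/=.
apply: ler_sum => i _; rewrite inE ranks_aboveE.
case: eqVneq => //= ij; case: ifP => // h.
rewrite /exceeds (le_trans xle)//.
by rewrite xj; move: h; rewrite /exceeds; case: ifP => // _ /ltW.
Qed.

Lemma order_stat_exceedances_le x k n w : (0 < k <= n)%N ->
  order_stat X k n w <= x -> exceedances X false x n w <= k%:R.
Proof.
case: k => // k /= kn xle.
have [j hj] := exists_rank (fun i => X i w) kn.
have kj : #|top_set (fun i => X i w) j| = k by apply/eqP; rewrite hj.
have xj : order_stat X k.+1 n w = X j w := nth_rank kj.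
apply: (@le_trans _ _ k%:R); last by rewrite ler_nat.
rewrite -kj -sum1_card natr_sum [leRHS]big_mkcond/=.
apply: ler_sum => i _; rewrite inE ranks_aboveE.
rewrite [exceeds false _ _]/exceeds; case: ltP => [xi|_]; last by case: ifP.
have ji : X j w < X i w by rewrite -xj; exact: le_lt_trans xi.
have -> : exceeds (i <= j)%N (X j w) (X i w) by rewrite /exceeds ji (ltW ji) if_same.
rewrite andbT; case: eqVneq => // ij.
by move: ji; rewrite ij ltxx.
Qed.

Variables (alpha rho : R) (U A : R -> R).
Hypothesis alpha_gt0 : 0 < alpha.
Hypothesis U_RV : RV' (alpha^-1) U.
Hypothesis U_A : second_order alpha rho U A.
Hypothesis rho_lt0 : rho < 0.
Hypothesis X_dist : forall i, dist_RV U (X i).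

Lemma expectation_iid (h : R -> \bar R) i : measurable_fun setT h ->
  (forall y, (0 <= h y)%E) -> (\int[P]_w h (X i w) = \int[P]_w h (X 0 w))%E.
Proof.
move=> mh h0.
by rewrite (expectation_expU U_RV (X_dist i))// (expectation_expU U_RV (X_dist 0)).
Qed.

(** If [X_{k,n}] is off by [delta], the number of exceedances of a level crosses [k], although its
    mean differs from [k] by a factor at least [expR eta]. Chernoff's inequality with tilts [- eta]
    and [eta] treats the two sides. *)
Lemma order_stat_concentration (delta : R) : 0 < delta ->
  exists kappa : R, 0 < kappa /\ exists s0 : R, forall n k (s1 : R), (0 < k <= n)%N ->
    s1 = ln (n%:R / k%:R) -> s0 <= s1 ->
    (P [set w | (order_stat X k n w <= U (expR (s1 - delta)))%R] <=
       (expR (- (kappa * k%:R)))%:E)%E /\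
    (P [set w | (U (expR (s1 + delta)) <= order_stat X k n w)%R] <=
       (expR (- (kappa * k%:R)))%:E)%E.
Proof.
move=> delta0.
pose eta := delta / 2.
have eta0 : 0 < eta by rewrite /eta; lra.
(* The large-deviation rates, per unit of [k], for Poisson variables of means [k * expR (- eta)] and
   [k * expR eta] to cross [k]. *)
pose k1 := eta - 1 + expR (- eta).
pose k2 := expR eta - 1 - eta.
have k10 : 0 < k1.
  have := @expR_gt1Dx _ (- eta); rewrite oppr_eq0 gt_eqF// => /(_ isT).
  by rewrite /k1; lra.
have k20 : 0 < k2.
  have := @expR_gt1Dx _ eta; rewrite gt_eqF// => /(_ isT).
  by rewrite /k2; lra.
have [s0 h0] := tail_probability alpha_gt0 U_RV U_A rho_lt0 (X_dist 0) delta0.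
exists (Num.min k1 k2); split; first by rewrite lt_min k10 k20.
exists s0 => n k s1 kn s1E s0s; have [_ hi lo] := h0 _ s0s.
have [k0 n0] : (0 < k%:R :> R) /\ (0 < n%:R :> R).
  by rewrite !ltr0n; case/andP: kn => k0 kn; split => //; exact: leq_trans kn.
have es1 : expR (- s1) = k%:R / n%:R.
  by rewrite s1E expRN lnK ?posrE ?divr_gt0// invf_div.
have expE z : n%:R * expR (- (s1 + z)) = k%:R * expR (- z).
  by rewrite opprD expRD es1; field; rewrite !gt_eqF.
have mOS : measurable_fun setT (order_stat X k n) by exact: measurable_order_stat.
have I_fin b x : (\int[P]_w ((exceeds b x (X 0 w))%:R)%:E)%E \is a fin_num.
  rewrite ge0_fin_numE; last by apply: integral_ge0 => w _; rewrite lee_fin.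
  apply: (@le_lt_trans _ _ (\int[P]_w (cst 1 w))%E); last first.
    by rewrite integral_cst// mul1e (le_lt_trans (probability_le1 _ _)) ?ltry.
  apply: ge0_le_integral => //.
  - by apply/measurable_EFinP; apply: (measurableT_comp (measurable_exceeds b x)).
  - by move=> w _; rewrite lee_fin; case: exceeds.
have iE b x i : (\int[P]_w ((exceeds b x (X i w))%:R)%:E)%E =
    (\int[P]_w ((exceeds b x (X 0 w))%:R)%:E)%E.
  apply: (expectation_iid (h := fun y => ((exceeds b x y)%:R)%:E)) => //.
  by apply/measurable_EFinP; exact: measurable_exceeds.
split.
- apply: (@le_trans _ _ (expR (n%:R * (expR (- (s1 - eta)) * (expR (- eta) - 1)) - - eta * k%:R))%:E).
    apply: (@chernoff_exceedances false (U (expR (s1 - delta)))).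
    + rewrite -[X in measurable X]setTI.
      exact: (measurable_fun_ler mOS (measurable_cst _) measurableT (Y := [set true])).
    + move=> i; rewrite iE ler_wnM2r ?subr_le0 ?expR_le1 ?oppr_le0 ?(ltW eta0)//.
      by rewrite -lee_fin fineK.
    + move=> w /= hw; rewrite ler_wnM2l ?oppr_le0 ?(ltW eta0)//.
      exact: order_stat_exceedances_le.
  rewrite lee_fin ler_expR mulrA expE opprK.
  have -> : k%:R * expR eta * (expR (- eta) - 1) - - eta * k%:R = - (k2 * k%:R).
    have : expR eta * expR (- eta) = 1 by rewrite -expRD subrr expR0.
    by move=> e; rewrite -mulrA mulrBr e /k2; ring.
  by rewrite lerN2 ler_wpM2r ?ler0n// ge_min lexx orbT.
- apply: (@le_trans _ _ (expR (n%:R * (expR (- (s1 + eta)) * (expR eta - 1)) - eta * k%:R))%:E).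
    apply: (@chernoff_exceedances true (U (expR (s1 + delta)))).
    + rewrite -[X in measurable X]setTI.
      exact: (measurable_fun_ler (measurable_cst _) mOS measurableT (Y := [set true])).
    + have e1 : 0 <= expR eta - 1 by rewrite subr_ge0 (le_trans _ (expR_ge1Dx _))// lerDl ltW.
      move=> i; rewrite iE ler_wpM2r//.
      by rewrite -lee_fin fineK.
    + move=> w /= hw; rewrite ler_wpM2l ?(ltW eta0)//.
      exact: order_stat_exceedances_ge.
  rewrite lee_fin ler_expR mulrA expE.
  have -> : k%:R * expR (- eta) * (expR eta - 1) - eta * k%:R = - (k1 * k%:R).
    have : expR (- eta) * expR eta = 1 by rewrite -expRD addNr expR0.
    by move=> e; rewrite -mulrA mulrBr e /k1; ring.
  by rewrite lerN2 ler_wpM2r ?ler0n// ge_min lexx.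
Qed.

End Concentration.

(** * Exponential moments of the Hill statistic *)

Section HillMoment.
Context {R : realType} {d : measure_display} {T : measurableType d}.
Variable P : probability T R.
Variable X : nat -> {RV P >-> R}.
Hypothesis X_indep : mutually_independent X.
Variables (n q : nat) (alpha lo hi : R).
Hypothesis qn : (q < n)%N.
Hypothesis lo_ge0 : 0 <= lo.

Let mem_ord (J : {set 'I_n}) (i : nat) : bool := i \in map val (enum J).

Let mem_ordE (J : {set 'I_n}) (i : 'I_n) : mem_ord J i = (i \in J).
Proof. by rewrite /mem_ord mem_map ?mem_enum//; exact: val_inj. Qed.

(* The factor contributed by X_i to the event that J is the set of indices
   ranked above j, tilted by lambda when i belongs to J. *)
Let factor (lambda : R) (J : {set 'I_n}) (j i : nat) (z : R * R) : R :=
  if mem_ord J i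
  then (exceeds (i <= j)%N z.1 z.2)%:R * expR (lambda * (alpha * ln z.2 - alpha * ln z.1))
  else (~~ exceeds (i <= j)%N z.1 z.2)%:R.

Let factor_ge0 lambda J j i z : 0 <= factor lambda J j i z.
Proof. by rewrite /factor; case: ifP => // _; rewrite mulr_ge0// expR_ge0. Qed.

Let measurable_factor lambda J j i : measurable_fun setT (factor lambda J j i).
Proof.
have mex b : measurable_fun setT (fun z : R * R => exceeds b z.1 z.2).
  by case: b; [apply: measurable_fun_ler|apply: measurable_fun_ltr];
    [exact: measurable_fst|exact: measurable_snd|exact: measurable_fst|exact: measurable_snd].
rewrite /factor; case: mem_ord.
  apply: measurable_funM; first exact: measurable_natr_bool.
  apply: (measurableT_comp (@measurable_expR R)); apply: measurable_funM => //.
  apply: measurable_funB; apply: measurable_funM => //;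
    apply: (measurableT_comp (@measurable_ln R)); [exact: measurable_snd|exact: measurable_fst].
by apply: measurable_natr_bool; exact: measurable_neg.
Qed.

Let top w (j : 'I_n) := top_set (fun i => X i w) j.

(** If the top set of [j] is not [J], an index in the symmetric difference contributes a zero
    factor; otherwise all indicators are 1 and only the tilts over [J] remain. *)
Let prod_factor lambda (J : {set 'I_n}) (j : 'I_n) w : j \notin J ->
  \prod_(i < n | i != j) factor lambda J j i (X j w, X i w) =
  (top w j == J)%:R * expR (lambda * \sum_(i in J) (alpha * ln (X i w) - alpha * ln (X j w))).
Proof.
move=> jJ; case: eqP => [topJ|topJ].
  rewrite mul1r mulr_sumr expR_sum.
  rewrite [RHS]big_mkcond [LHS]big_mkcond/=; apply: eq_bigr => i _.
  rewrite /factor mem_ordE -topJ inE ranks_aboveE/=.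
  by case: eqVneq => //= ij; case: exceeds => //=; rewrite mul1r.
rewrite mul0r; case: (pickP (fun l => (l \in top w j) != (l \in J))) => [l hl|h]; last first.
  by exfalso; apply: topJ; apply/setP => l; apply/eqP; move/negbFE: (h l).
have lj : l != j.
  by apply: contraNneq hl => ->; rewrite (negbTE jJ) inE eqxx.
rewrite (bigD1 l)//= [X in X * _](_ : _ = 0) ?mul0r//.
move: hl; rewrite /factor mem_ordE inE lj ranks_aboveE/=.
by case: (l \in J); case: exceeds => //= _; rewrite mul0r.
Qed.

Variables (vlo vhi : R).
Hypothesis vlo_ge0 : 0 <= vlo.

Let inG (x : R) : bool := (vlo < x) && (x < vhi).
Let G w := inG (order_stat X q.+1 n w).
Definition log_excess w := alpha * (q.+1%:R * hill X q.+1 n w).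

(** [vlo >= 0] makes [X_{k,n}] and everything above it positive, so the logarithm of each quotient
    splits; the last term of the Hill sum is [ln 1]. *)
Let log_excessE w (j : 'I_n) : #|top w j| = q -> inG (X j w) ->
  log_excess w = \sum_(i in top w j) (alpha * ln (X i w) - alpha * ln (X j w)).
Proof.
move=> topq /andP[vX _].
have Xj : 0 < X j w by exact: le_lt_trans vX.
rewrite /log_excess /hill [q.+1%:R * _]mulrA divff ?pnatr_eq0// mul1r.
have jE : order_stat X q.+1 n w = X j w := nth_rank topq.
rewrite jE (sum_top (fun y => ln (y / X j w)) topq) divff ?gt_eqF// ln1 addr0 mulr_sumr.
apply: eq_bigr => i; rewrite inE => /andP[_]; rewrite ranks_aboveE => ij.
have Xi : 0 < X i w.
  by apply: (lt_le_trans Xj); move: ij; rewrite /exceeds; case: ifP => // _ /ltW.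
by rewrite ln_div ?posrE// mulrBr.
Qed.

Let pairs : pred ('I_n * {set 'I_n}) := fun p => (#|p.2| == q) && (p.1 \notin p.2).

(** At each [w] a single pair survives: the index of rank [q] with its own top set. *)
Let G_decomp lambda w : (G w)%:R * expR (lambda * log_excess w) =
  \sum_(p | pairs p) (inG (X p.1 w))%:R *
     \prod_(i < n | i != p.1) factor lambda p.2 p.1 i (X p.1 w, X i w).
Proof.
have [j hj] := exists_rank (fun i => X i w) qn.
have topq : #|top w j| = q by apply/eqP; rewrite hj.
have jE : order_stat X q.+1 n w = X j w := nth_rank topq.
rewrite (bigD1 (j, top w j))/=; last by rewrite /pairs/= topq eqxx inE eqxx.
rewrite [X in _ + X]big1 ?addr0; last first.
  move=> [i J] /andP[/andP[]] /= /eqP Jq iJ ne.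
  rewrite prod_factor//; case: eqP => [topJ|]; last by rewrite mul0r mulr0.
  have ij : i = j by apply/eqP; rewrite -hj -/(top w i) topJ Jq.
  by move: ne; rewrite -topJ ij eqxx.
rewrite prod_factor ?inE ?eqxx// mul1r /G jE.
case: (boolP (inG (X j w))) => [Gj|]; last by rewrite !mul0r.
by rewrite (log_excessE topq Gj).
Qed.

Let s (j : 'I_n) := [seq val i | i <- enum 'I_n & i != j].

Let s_uniq j : uniq (val j :: s j).
Proof.
rewrite /= map_inj_uniq; last exact: val_inj.
rewrite filter_uniq ?enum_uniq// andbT; apply/mapP => -[i].
by rewrite mem_filter => /andP[ij _] /val_inj ji; rewrite ji eqxx in ij.
Qed.

Let big_s (j : 'I_n) (F : nat -> \bar R) :
  (\prod_(i <- s j) F i = \prod_(i < n | i != j) F i)%E.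
Proof. by rewrite /s big_map big_filter big_enum_cond. Qed.

Let measurable_inG : measurable_fun setT (fun x => (inG x)%:R : R).
Proof.
by apply: measurable_natr_bool; apply: measurable_and; exact: measurable_fun_ltr.
Qed.

Local Open Scope ereal_scope.

Let term lambda (p : 'I_n * {set 'I_n}) w : R := ((inG (X p.1 w))%:R *
     \prod_(i < n | i != p.1) factor lambda p.2 p.1 i (X p.1 w, X i w))%R.

Let term_ge0 lambda p w : (0 <= term lambda p w)%R.
Proof. by rewrite mulr_ge0// prodr_ge0. Qed.

Let measurable_term lambda p : measurable_fun setT (term lambda p).
Proof.
apply: measurable_funM; first exact: (measurableT_comp measurable_inG).
under eq_fun do rewrite big_mkcond/=.
apply: measurable_prod => i _; case: (i != p.1) => //.
by apply: (measurableT_comp (measurable_factor _ _ _ _)); exact: measurable_fun_pair.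
Qed.

Let cond_factor lambda (p : 'I_n * {set 'I_n}) (i : nat) x :=
  \int[P]_v (factor lambda p.2 p.1 i (x, X i v))%:E.

Let cond_factor_ge0 lambda p i x : 0 <= cond_factor lambda p i x.
Proof. by apply: integral_ge0 => v _; rewrite lee_fin. Qed.

Let term_integral lambda p : \int[P]_w (term lambda p w)%:E =
  \int[P]_w ((inG (X p.1 w))%:R%:E * \prod_(i < n | i != p.1) cond_factor lambda p i (X p.1 w)).
Proof.
transitivity (\int[P]_w ((inG (X p.1 w))%:R%:E *
    \prod_(i <- s p.1) (factor lambda p.2 p.1 i (X p.1 w, X i w))%:E)).
  by apply: eq_integral => w _; rewrite big_s EFinM -prodEFin.
have -> := @expectation_prod_indep _ _ _ _ _ X_indep (val p.1) (s p.1)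
  (fun x => (inG x)%:R%:E) (fun i z => (factor lambda p.2 p.1 i z)%:E) (s_uniq p.1).
- by apply: eq_integral => w _; rewrite big_s.
- exact/measurable_EFinP.
- by move=> x; rewrite lee_fin.
- by move=> i; apply/measurable_EFinP.
- by move=> i z; rewrite lee_fin.
Qed.

Let lee_prod (I : Type) (r : seq I) (Q : pred I) (F1 F2 : I -> \bar R) :
  (forall i, Q i -> 0 <= F1 i) -> (forall i, Q i -> F1 i <= F2 i) ->
  \prod_(i <- r | Q i) F1 i <= \prod_(i <- r | Q i) F2 i.
Proof.
move=> F0 F12.
suff : 0 <= \prod_(i <- r | Q i) F1 i <= \prod_(i <- r | Q i) F2 i by case/andP.
elim/big_rec2: _ => [|i x y Qi /andP[y0 yx]]; first by rewrite lexx lee_fin ler01.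
by rewrite mule_ge0 ?F0//= lee_pmul ?F0 ?F12.
Qed.

Let measurable_cond_prod lambda (p : 'I_n * {set 'I_n}) : measurable_fun setT (fun w =>
  (inG (X p.1 w))%:R%:E * \prod_(i < n | i != p.1) cond_factor lambda p i (X p.1 w)).
Proof.
apply: emeasurable_funM.
  by apply/measurable_EFinP; exact: (measurableT_comp measurable_inG).
elim: (index_enum _) => [|i l IH].
  by under eq_fun do rewrite big_nil; exact: measurable_cst.
under eq_fun do rewrite big_cons; case: (i != p.1) => //.
apply: emeasurable_funM => //.
have mc : measurable_fun setT (cond_factor lambda p i).
  apply: (@measurable_indep_mean _ _ _ P X (fun z => (factor lambda p.2 p.1 i z)%:E)).
  - exact/measurable_EFinP.
  - by move=> z; rewrite lee_fin.
exact: (measurableT_comp mc).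
Qed.

Let prod_const (c : R) (p : 'I_n * {set 'I_n}) : pairs p ->
  \prod_(i < n | i != p.1) (if i \in p.2 then c else 1)%:E = (c ^+ q)%:E.
Proof.
move=> /andP[/eqP <- jJ]; rewrite prodEFin; congr _%:E.
rewrite -big_mkcondr/= -prodr_const; apply: eq_bigl => i.
by case: eqVneq => //= ->; rewrite (negbTE jJ).
Qed.

Variable lambda : R.
Hypothesis hi_ub : forall i b x, inG x ->
  \int[P]_w ((exceeds b x (X i w))%:R * expR (lambda * (alpha * ln (X i w) - alpha * ln x)))%:E <=
  hi%:E * \int[P]_w ((exceeds b x (X i w))%:R)%:E.
Hypothesis lo_lb : forall i b x, inG x ->
  lo%:E * \int[P]_w ((exceeds b x (X i w))%:R)%:E <=
  \int[P]_w ((exceeds b x (X i w))%:R * expR (lambda * (alpha * ln (X i w) - alpha * ln x)))%:E.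

Let cond_factor_ub (p : 'I_n * {set 'I_n}) (i : 'I_n) x : inG x -> cond_factor lambda p i x <=
  (if i \in p.2 then hi else 1%R)%:E * cond_factor 0 p i x.
Proof.
move=> Gx; rewrite /cond_factor /factor mem_ordE/=; case: ifP => _; last by rewrite mul1e.
apply: (le_trans (hi_ub _ _ Gx)); rewrite le_eqVlt; apply/orP; left; apply/eqP.
by congr (_ * _); apply: eq_integral => w _; rewrite mul0r expR0 mulr1.
Qed.

Let cond_factor_lb (p : 'I_n * {set 'I_n}) (i : 'I_n) x : inG x ->
  (if i \in p.2 then lo else 1%R)%:E * cond_factor 0 p i x <= cond_factor lambda p i x.
Proof.
move=> Gx; rewrite /cond_factor /factor mem_ordE/=; case: ifP => _; last by rewrite mul1e.
apply: le_trans (lo_lb _ _ Gx); rewrite le_eqVlt; apply/orP; left; apply/eqP.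
by congr (_ * _); apply: eq_integral => w _; rewrite mul0r expR0 mulr1.
Qed.

Hypothesis hi_ge0 : (0 <= hi)%R.

(** Each of the [q] indices in [J] contributes a factor [hi] relative to the untilted integrand; the
    other factors carry no tilt and are unchanged. *)
Let term_ub p : pairs p -> \int[P]_w (term lambda p w)%:E <=
  (hi ^+ q)%:E * \int[P]_w (term 0 p w)%:E.
Proof.
move=> pp; rewrite !term_integral -ge0_integralZl//; first last.
- by rewrite lee_fin exprn_ge0.
- by move=> w _; rewrite mule_ge0 ?lee_fin// prode_ge0.
apply: ge0_le_integral => //.
- by move=> w _; rewrite mule_ge0 ?lee_fin// prode_ge0.
- exact: emeasurable_funM.
move=> w _; rewrite muleCA.
case: (boolP (inG (X p.1 w))) => Gx; last by rewrite !mul0e.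
rewrite !mul1e -(prod_const _ pp) -big_split/=.
by apply: lee_prod => // i _; exact: cond_factor_ub.
Qed.

Let term_lb p : pairs p -> (lo ^+ q)%:E * \int[P]_w (term 0 p w)%:E <=
  \int[P]_w (term lambda p w)%:E.
Proof.
move=> pp; rewrite !term_integral -ge0_integralZl//; first last.
- by rewrite lee_fin exprn_ge0.
- by move=> w _; rewrite mule_ge0 ?lee_fin// prode_ge0.
apply: ge0_le_integral => //.
- by move=> w _; rewrite !mule_ge0 ?lee_fin ?exprn_ge0// prode_ge0.
- exact: emeasurable_funM.
move=> w _; rewrite muleCA.
case: (boolP (inG (X p.1 w))) => Gx; last by rewrite !mul0e.
rewrite !mul1e -(prod_const _ pp) -big_split/=.
apply: lee_prod => // i _; last exact: cond_factor_lb.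
by rewrite mule_ge0 ?lee_fin//; case: ifP.
Qed.

Let integral_decomp l : \int[P]_w ((G w)%:R * expR (l * log_excess w))%:E =
  \sum_(p | pairs p) \int[P]_w (term l p w)%:E.
Proof.
rewrite -big_filter -ge0_integral_sum//; last 2 first.
- by move=> p; apply/measurable_EFinP.
- by move=> p w _; rewrite lee_fin.
by apply: eq_integral => w _; rewrite big_filter G_decomp sumEFin.
Qed.

(** The sum over pairs is never evaluated: at tilt 0 the same decomposition adds up to the
    probability of [G]. *)
Lemma hill_moment_ub :
  \int[P]_w ((G w)%:R * expR (lambda * log_excess w))%:E <=
  (hi ^+ q)%:E * \int[P]_w ((G w)%:R)%:E.
Proof.
have -> : \int[P]_w ((G w)%:R)%:E = \int[P]_w ((G w)%:R * expR (0 * log_excess w))%:E.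
  by apply: eq_integral => w _; rewrite mul0r expR0 mulr1.
rewrite !integral_decomp ge0_sume_distrr; last first.
  by move=> p _; apply: integral_ge0 => w _; rewrite lee_fin.
by apply: lee_sum => p pp; exact: term_ub.
Qed.

Lemma hill_moment_lb :
  (lo ^+ q)%:E * \int[P]_w ((G w)%:R)%:E <=
  \int[P]_w ((G w)%:R * expR (lambda * log_excess w))%:E.
Proof.
have -> : \int[P]_w ((G w)%:R)%:E = \int[P]_w ((G w)%:R * expR (0 * log_excess w))%:E.
  by apply: eq_integral => w _; rewrite mul0r expR0 mulr1.
rewrite !integral_decomp ge0_sume_distrr; last first.
  by move=> p _; apply: integral_ge0 => w _; rewrite lee_fin.
by apply: lee_sum => p pp; exact: term_lb.
Qed.

End HillMoment.

(** * Deviation probabilities from exponential moments *)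

Section Tilting.
Context {R : realType} {d : measure_display} {T : measurableType d}.
Variables (P : probability T R) (W : T -> R) (g : T -> bool).
Hypotheses (mW : measurable_fun setT W) (mg : measurable_fun setT g).

Definition trunc_mgf (c : R) : \bar R := (\int[P]_w ((g w)%:R * expR (c * W w))%:E)%E.

Let measurable_integrand c : measurable_fun setT (fun w => ((g w)%:R * expR (c * W w))%:E).
Proof.
apply/measurable_EFinP; apply: measurable_funM; first exact: measurable_natr_bool.
by apply: (measurableT_comp (@measurable_expR R)); exact: measurable_funM.
Qed.

Lemma trunc_mgf_ge0 c : (0 <= trunc_mgf c)%E.
Proof. by apply: integral_ge0 => w _; rewrite lee_fin mulr_ge0// expR_ge0. Qed.

Lemma measurable_gtr (N : R) : measurable [set w | N < W w].
Proof.
rewrite -[X in measurable X]setTI.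
exact: (measurable_fun_ltr (measurable_cst _) mW measurableT (Y := [set true])).
Qed.

Lemma measurable_bool_set (f : T -> bool) : measurable_fun setT f -> measurable [set w | f w].
Proof. by move=> mf; rewrite -[X in measurable X]setTI; exact: (mf measurableT [set true]). Qed.

Lemma indic_boolE (f : T -> bool) w : \1_[set w | f w] w = (f w)%:R :> R.
Proof. by rewrite indicE; congr (nat_of_bool _)%:R; apply/idP/idP; rewrite inE. Qed.

Lemma tilting_ub (N : R) :
  (P [set w | (N < W w)%R] <= P [set w | ~~ g w] + (expR (- N))%:E * trunc_mgf 1)%E.
Proof.
have mA : measurable [set w | N < W w] by exact: measurable_gtr.
have mB : measurable [set w | ~~ g w].
  by apply: measurable_bool_set; exact: measurable_neg.
rewrite -[X in (P X <= _)%E]setIT -[X in (_ <= P X + _)%E]setIT -!integral_indic//.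
rewrite -ge0_integralZl ?lee_fin ?expR_ge0//.
rewrite -ge0_integralD//; last 2 first.
  exact/measurable_EFinP.
  exact: emeasurable_funM.
apply: ge0_le_integral => //.
- exact/measurable_EFinP.
- by apply: emeasurable_funD; [exact/measurable_EFinP|exact: emeasurable_funM].
move=> w _; rewrite -EFinM -EFinD lee_fin !indic_boolE mul1r.
case: (boolP (g w)) => gw /=; last first.
  by rewrite mul0r mulr0 addr0 ler_nat leq_b1.
rewrite add0r mul1r -expRD; case: ltP => NW; last exact: expR_ge0.
by rewrite -expR0 ler_expR addrC subr_ge0 ltW.
Qed.

(* Pointwise, [e^{lW}] is at most [e^{lb}] on (a, b], at most [e^{-hb} e^{(l+h)W}]
   above b and at most [e^{ha} e^{(l-h)W}] below a: the lower deviation bound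
   only needs moment generating functions, not a change of measure. *)
Lemma tilting_lb (l h a b : R) : 0 <= l -> 0 <= h ->
  (trunc_mgf l <= P [set w | (a < W w)%R] * (expR (l * b))%:E +
     ((expR (- (h * b)))%:E * trunc_mgf (l + h) + (expR (h * a))%:E * trunc_mgf (l - h)))%E.
Proof.
move=> l0 h0.
have mA : measurable [set w | a < W w] by exact: measurable_gtr.
rewrite -[X in (_ <= P X * _ + _)%E]setIT -!integral_indic// muleC.
rewrite -!ge0_integralZl ?lee_fin ?expR_ge0//; last exact/measurable_EFinP.
have m1 c e : measurable_fun setT (fun w => (c%:E * ((g w)%:R * expR (e * W w))%:E)%E).
  exact: emeasurable_funM.
have m2 c : measurable_fun setT (fun w => (c%:E * (\1_[set w | a < W w] w)%:E)%E).
  by apply: emeasurable_funM => //; exact/measurable_EFinP.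
rewrite -ge0_integralD// -ge0_integralD//; last 2 first.
  by move=> w _; rewrite -!EFinM -EFinD lee_fin addr_ge0// mulr_ge0 ?mulr_ge0 ?expR_ge0.
  exact: emeasurable_funD.
apply: ge0_le_integral => //.
- by apply: emeasurable_funD => //; exact: emeasurable_funD.
move=> w _; rewrite -!EFinM -!EFinD lee_fin indic_boolE.
case: (boolP (g w)) => gw /=; last first.
  by rewrite !mul0r !mulr0 !addr0 mulr_ge0// expR_ge0.
rewrite !mul1r -!expRD.
have e1 := expR_ge0 (- (h * b) + (l + h) * W w).
have e2 := expR_ge0 (h * a + (l - h) * W w).
have e3 := expR_ge0 (l * b).
case: (ltP a (W w)) => aW /=.
  rewrite mulr1; have [Wb|bW] := leP (W w) b.
    have : expR (l * W w) <= expR (l * b) by rewrite ler_expR ler_wpM2l.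
    by move: e1 e2; lra.
  have : expR (l * W w) <= expR (- (h * b) + (l + h) * W w).
    rewrite ler_expR mulrDl addrCA lerDl addrC subr_ge0 ler_wpM2l//; exact: ltW.
  by move: e2 e3; lra.
rewrite mulr0 add0r.
have : expR (l * W w) <= expR (h * a + (l - h) * W w).
  rewrite ler_expR mulrBl addrCA lerDl subr_ge0 ler_wpM2l//.
by move: e1; lra.
Qed.

Section DeviationRates.
Variables (N eta : R).
Hypotheses (N_gt0 : 0 < N) (eta_gt0 : 0 < eta) (eta_le1 : eta <= 1).
Let eps := eta ^+ 2 / 8.
Hypothesis mgf_ub : forall c, c \in [:: 1; 1 + eta; 1 + 2 * eta] ->
  (trunc_mgf c <= (expR (N * (c ^+ 2 / 2 + eps)))%:E)%E.
Hypothesis mgf_lb : ((1 / 2 * expR (N * ((1 + eta) ^+ 2 / 2 - eps)))%:E <= trunc_mgf (1 + eta))%E.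
Hypothesis g_likely : (P [set w | ~~ g w] <= (2 * expR (- N))%:E)%E.
Hypothesis N_large1 : 8 <= expR (N * (eta ^+ 2 / 4)).
Hypothesis N_large2 : 4 <= expR (N * eta).

Let p := fine (P [set w | N < W w]).

Let PE : P [set w | N < W w] = p%:E.
Proof. by rewrite /p fineK// fin_num_measure//; exact: measurable_gtr. Qed.

(** The complement of [g] decays at rate 1 and the Chernoff term at rate [1 / 2 - eps] with
    [eps <= eta], so both are controlled by [expR (- (N * (1 / 2 - eta)))]; the constant in front is
    absorbed by a further [expR (N * eta)]. *)
Lemma deviation_rate_ub : p <= expR (- (N * (1 / 2 - 2 * eta))).
Proof.
have := tilting_ub N; rewrite PE.
move=> /le_trans /(_ (leeD g_likely (lee_pmul _ _ (lexx _) (mgf_ub (mem_head _ _))))).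
rewrite lee_fin expR_ge0 trunc_mgf_ge0 => /(_ isT isT).
rewrite -EFinM -EFinD lee_fin -expRD => h; apply: (le_trans h).
have eps0 : 0 <= eps by rewrite divr_ge0// sqr_ge0.
have eps_eta : eps <= eta.
  by rewrite /eps; move: eta_gt0 eta_le1; nra.
set e := expR (- (N * (1 / 2 - eta))).
apply: (@le_trans _ _ (4 * e)).
  have h1 : expR (- N) <= e.
    rewrite ler_expR lerN2; move: N_gt0 eta_gt0; nra.
  have h2 : expR (- N + N * (1 ^+ 2 / 2 + eps)) <= e.
    rewrite ler_expR expr1n; move: N_gt0 eps_eta; move: eps => z; nra.
  have := expR_ge0 (- (N * (1 / 2 - eta))); rewrite -/e.
  by move: h1 h2; lra.
have -> : - (N * (1 / 2 - 2 * eta)) = N * eta + - (N * (1 / 2 - eta)) by ring.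
by rewrite expRD ler_wpM2r// expR_ge0.
Qed.

(** With [h = eta], [a = N] and [b = N * (1 + 2 * eta)] the terms of exponents 1 and [1 + 2 * eta]
    are both bounded by the same [B], whereas the main term exceeds [B] by the factor
    [expR (N * (eta ^+ 2 / 4))], up to 1/2. Since this factor is at least 8, subtracting [2 * B]
    still leaves [B]. *)
Lemma deviation_rate_lb : expR (- (N * (1 / 2 + 6 * eta))) <= p.
Proof.
have eta0 := ltW eta_gt0.
have := tilting_lb N (N * (1 + 2 * eta)) (addr_ge0 ler01 eta0) eta0.
rewrite PE (_ : 1 + eta + eta = 1 + 2 * eta); last by ring.
rewrite addrK.
move=> /(le_trans mgf_lb) /le_trans.
have m1 : 1 + 2 * eta \in [:: 1; 1 + eta; 1 + 2 * eta] by rewrite !inE eqxx !orbT.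
have u1 := lee_pmul (x1 := (expR (- (eta * (N * (1 + 2 * eta)))))%:E) _ _ (lexx _) (mgf_ub m1).
have u2 := lee_pmul (x1 := (expR (eta * N))%:E) _ _ (lexx _) (mgf_ub (mem_head _ _)).
move=> /(_ _ (leeD (lexx _) (leeD (u1 _ _) (u2 _ _)))).
have pos c : (0 <= (expR c)%:E :> \bar R)%E by rewrite lee_fin expR_ge0.
move=> /(_ (pos _) (trunc_mgf_ge0 _) (pos _) (trunc_mgf_ge0 _)).
rewrite -!EFinM -!EFinD lee_fin -!expRD.
set B := expR (N * (1 / 2 + eta + eta ^+ 2 / 8)).
have -> : expR (- (eta * (N * (1 + 2 * eta))) + N * ((1 + 2 * eta) ^+ 2 / 2 + eps)) = B.
  by rewrite /B /eps; congr expR; field.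
have -> : expR (eta * N + N * (1 ^+ 2 / 2 + eps)) = B.
  by rewrite /B /eps; congr expR; field.
have -> : expR (N * ((1 + eta) ^+ 2 / 2 - eps)) = expR (N * (eta ^+ 2 / 4)) * B.
  by rewrite /B /eps -expRD; congr expR; field.
have B0 : 0 < B by exact: expR_gt0.
have B1 : B * 8 <= expR (N * (eta ^+ 2 / 4)) * B by rewrite mulrC ler_wpM2r// ltW.
set Q := expR ((1 + eta) * (N * (1 + 2 * eta))).
have Q0 : 0 < Q by exact: expR_gt0.
move=> h.
have pQ : B <= p * Q by move: h B1 B0; move: (expR _ * B) (p * Q) => u v; lra.
have {}pQ : B / Q <= p by rewrite ler_pdivrMr.
apply: le_trans pQ.
(* The exponent of [B / Q] is [- N * (1 / 2 + 2 * eta + 15 / 8 * eta ^+ 2)], and [eta <= 1] puts it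
   above the claimed one. *)
rewrite /B /Q -expRN -expRD ler_expR -subr_ge0.
rewrite (_ : _ - _ = N * eta * (4 - 15 / 8 * eta)); last by field.
by rewrite !mulr_ge0 ?(ltW N_gt0) ?(ltW eta_gt0)//; move: eta_le1; lra.
Qed.

End DeviationRates.
End Tilting.

(** * Moment generating function of the bias-corrected deviation *)

Section CentralMoments.
Context {R : realType} {d : measure_display} {T : measurableType d}.
Variables (P : probability T R) (alpha rho : R) (U A : R -> R).
Variable X : nat -> {RV P >-> R}.
Hypothesis alpha_gt0 : 0 < alpha.
Hypothesis U_RV : RV' (alpha^-1) U.
Hypothesis U_A : second_order alpha rho U A.
Hypothesis rho_lt0 : rho < 0.
Hypothesis X_iid : iid_RV U X.

Let X_indep : mutually_independent X. Proof. by have [] := X_iid. Qed.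
Let X_dist : forall i, dist_RV U (X i). Proof. by have [] := X_iid. Qed.

Definition central (delta : R) (k n : nat) (w : T) : bool :=
  (U (expR (ln (n%:R / k%:R) - delta)) < order_stat X k n w) &&
  (order_stat X k n w < U (expR (ln (n%:R / k%:R) + delta))).

Definition deviation (sigma th : R) (k n : nat) (w : T) : R :=
  sigma * th * (k%:R * (alpha * hill_corrected rho A X k n w - 1)).

Lemma measurable_central delta k n : (0 < k <= n)%N -> measurable_fun setT (central delta k n).
Proof.
by move=> kn; apply: measurable_and; apply: measurable_fun_ltr => //; exact: measurable_order_stat.
Qed.

Lemma measurable_deviation sigma th k n : (0 < k <= n)%N ->
  measurable_fun setT (deviation sigma th k n).
Proof.
move=> kn; apply: measurable_funM => //; apply: measurable_funM => //.
apply: measurable_funB => //; apply: measurable_funM => //.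
by apply: measurable_funB => //; exact: measurable_hill.
Qed.

(** The bias correction makes the deviation equal to [sigma * th * (alpha * k * H - k * m)]. The
    [k - 1] excesses produce [k - 1] copies of the mean [m], so centring by [k * m] leaves the
    single term [sigma * c * th * m]. Any smaller [delta] is allowed because one window must later
    serve several values of [c]. *)
Lemma central_mgf (eps K c : R) : 0 < eps -> 0 <= K ->
  exists delta0 : R, 0 < delta0 /\ forall delta : R, 0 < delta -> delta <= delta0 ->
  exists s0 th0 : R, 0 < th0 /\ forall (k n : nat) (sigma th : R),
  (0 < k <= n)%N -> sigma ^+ 2 = 1 -> 
  s0 <= ln (n%:R / k%:R) -> 0 < th -> th <= th0 ->
  `|A (n%:R / k%:R)| <= K * th ->
  let m := 1 + alpha * A (n%:R / k%:R) / (1 - rho) in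
  ((expR (- (sigma * c * th * m) + (k.-1)%:R * (c ^+ 2 / 2 - eps) * th ^+ 2))%:E *
     P [set w | central delta k n w] <=
   trunc_mgf P (deviation sigma th k n) (central delta k n) c /\
   trunc_mgf P (deviation sigma th k n) (central delta k n) c <=
   (expR (- (sigma * c * th * m) + (k.-1)%:R * (c ^+ 2 / 2 + eps) * th ^+ 2))%:E)%E.
Proof.
move=> eps0 K0.
have [d1 [d10 [s1 [t1 [sd1 t10 H1]]]]] :=
  conditional_mgf alpha_gt0 U_RV U_A rho_lt0 (X_dist 0) c eps0 K0.
have [d2 [d20 [s2 [t2 [sd2 t20 H2]]]]] :=
  conditional_mgf alpha_gt0 U_RV U_A rho_lt0 (X_dist 0) (- c) eps0 K0.
exists (Num.min d1 d2); split; first by rewrite lt_min d10 d20.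
move=> delta delta0; rewrite le_min => /andP[dd1 dd2].
exists (Num.max s1 s2), (Num.min t1 t2); split; first by rewrite lt_min t10 t20.
move=> k n sigma th kn sigma2; rewrite ge_max => /andP[s1s s2s] th_gt0.
rewrite le_min => /andP[tht1 tht2] A_le m.
have [k0 n0] : (0 < k%:R :> R) /\ (0 < n%:R :> R).
  by rewrite !ltr0n; case/andP: kn => h1 h2; split => //; exact: leq_trans h2.
set s := ln (n%:R / k%:R) in s1s s2s *.
have es : expR s = n%:R / k%:R by rewrite lnK ?posrE ?divr_gt0.
pose lambda := sigma * c * th.
pose q := k.-1.
have kq : k = q.+1 by rewrite /q prednK//; case/andP: kn.
pose lo := expR (lambda * m + lambda ^+ 2 / 2 - eps * th ^+ 2).
pose hi := expR (lambda * m + lambda ^+ 2 / 2 + eps * th ^+ 2).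
have U_mono (e d' : R) : 0 < d' -> d' <= e -> 0 < s - e ->
    U (expR (s - e)) <= U (expR (s - d')) /\ U (expR (s + d')) <= U (expR (s + e)).
  move=> d'0 de se; split; apply: (U_expR_le U_RV); lra.
pose I0 (b : bool) (x : R) : \bar R := (\int[P]_w ((exceeds b x (X 0%N w))%:R)%:E)%E.
pose I (b : bool) (x : R) : \bar R := (\int[P]_w ((exceeds b x (X 0%N w))%:R *
  expR (lambda * (alpha * ln (X 0%N w) - alpha * ln x)))%:E)%E.
have bounds (b : bool) (x : R) : U (expR (s - delta)) < x -> x < U (expR (s + delta)) ->
  (lo%:E * I0 b x <= I b x)%E /\ (I b x <= hi%:E * I0 b x)%E.
  move=> xlo xhi.
  (* The lower deviation is the upper one with the tilt reversed: [conditional_mgf] at [- c]. *)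
  have : sigma = 1 \/ sigma = -1.
    by move/eqP: sigma2; rewrite sqrf_eq1 => /orP[] /eqP; [left|right].
  case=> sE.
    have [u1 u2] : U (expR (s - d1)) <= U (expR (s - delta)) /\
      U (expR (s + delta)) <= U (expR (s + d1)) by apply: U_mono => //; lra.
    have := H1 s th x b s1s th_gt0 tht1; rewrite es => /(_ A_le (le_lt_trans u1 xlo) (lt_le_trans xhi u2)).
    by rewrite /I /I0 /lo /hi /lambda sE mul1r.
  have [u1 u2] : U (expR (s - d2)) <= U (expR (s - delta)) /\
    U (expR (s + delta)) <= U (expR (s + d2)) by apply: U_mono => //; lra.
  have := H2 s th x b s2s th_gt0 tht2; rewrite es => /(_ A_le (le_lt_trans u1 xlo) (lt_le_trans xhi u2)).
  by rewrite /I /I0 /lo /hi /lambda sE mulN1r.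
have mex b (x : R) : measurable_fun setT (fun y : R => ((exceeds b x y)%:R : R)%:E).
  by apply/measurable_EFinP; exact: measurable_exceeds.
have mexl b (x : R) : measurable_fun setT (fun y : R =>
    ((exceeds b x y)%:R * expR (lambda * (alpha * ln y - alpha * ln x)))%:E).
  apply/measurable_EFinP; apply: measurable_funM; first exact: measurable_exceeds.
  apply: (measurableT_comp (@measurable_expR R)); apply: measurable_funM => //.
  apply: measurable_funB; last exact: measurable_cst.
  by apply: measurable_funM => //; exact: measurable_ln.
have iE1 b (x : R) i : (\int[P]_w ((exceeds b x (X i w))%:R)%:E)%E = I0 b x.
  by apply: (expectation_iid U_RV X_dist i (mex b x)) => y; rewrite lee_fin.
have iE2 b (x : R) i : (\int[P]_w ((exceeds b x (X i w))%:R *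
    expR (lambda * (alpha * ln (X i w) - alpha * ln x)))%:E)%E = I b x.
  apply: (expectation_iid U_RV X_dist i (mexl b x)) => y.
  by rewrite lee_fin mulr_ge0// expR_ge0.
have qn : (q < n)%N by rewrite -kq; case/andP: kn.
have vlo_ge0 : 0 <= U (expR (s - delta)) by apply/ltW/(U_expR_gt0 U_RV); lra.
have ub := @hill_moment_ub _ _ _ P X X_indep n q alpha hi qn (U (expR (s - delta)))
  (U (expR (s + delta))) vlo_ge0 lambda _ (expR_ge0 _).
have lb := @hill_moment_lb _ _ _ P X X_indep n q alpha lo qn (expR_ge0 _) (U (expR (s - delta)))
  (U (expR (s + delta))) vlo_ge0 lambda _.
have {}ub := ub ltac:(by move=> i b x /andP[h1 h2]; rewrite iE1 iE2; have [] := bounds b x h1 h2).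
have {}lb := lb ltac:(by move=> i b x /andP[h1 h2]; rewrite iE1 iE2; have [] := bounds b x h1 h2).
have gE w : (U (expR (s - delta)) < order_stat X q.+1 n w) &&
    (order_stat X q.+1 n w < U (expR (s + delta))) = central delta k n w.
  by rewrite /central -kq.
have Pg : (\int[P]_w ((central delta k n w)%:R)%:E)%E = P [set w | central delta k n w].
  rewrite -[in RHS](setIT [set w | central delta k n w]) -integral_indic//.
    by apply: eq_integral => w _; rewrite indic_boolE.
  by apply: measurable_bool_set; exact: measurable_central.
have mgfE : trunc_mgf P (deviation sigma th k n) (central delta k n) c =
    ((expR (- (lambda * k%:R * m)))%:E *
     \int[P]_w ((central delta k n w)%:R * expR (lambda * log_excess X n q alpha w))%:E)%E.
  rewrite -ge0_integralZl ?lee_fin ?expR_ge0//; last first.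
    apply/measurable_EFinP; apply: measurable_funM.
      by apply: measurable_natr_bool; exact: measurable_central.
    apply: (measurableT_comp (@measurable_expR R)); apply: measurable_funM => //.
    apply: measurable_funM => //; apply: measurable_funM => //.
    by apply: measurable_hill; rewrite -kq.
  apply: eq_integral => w _; rewrite -EFinM; congr _%:E.
  rewrite [RHS]mulrCA -expRD; congr (_ * expR _).
  rewrite /deviation /hill_corrected /log_excess -kq /lambda /m.
  by field; rewrite gt_eqF//; have := rho_lt0; lra.
have E1 : (\int[P]_w ((central delta k n w)%:R)%:E = \int[P]_w
    ((((U (expR (s - delta)) < order_stat X q.+1 n w) &&
    (order_stat X q.+1 n w < U (expR (s + delta))))%R)%:R)%:E)%E.
  by apply: eq_integral => w _; rewrite gE.
have E2 : (\int[P]_w ((central delta k n w)%:R * expR (lambda * log_excess X n q alpha w))%:E =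
    \int[P]_w ((((U (expR (s - delta)) < order_stat X q.+1 n w) &&
    (order_stat X q.+1 n w < U (expR (s + delta))))%R)%:R * expR (lambda * log_excess X n q alpha w))%:E)%E.
  by apply: eq_integral => w _; rewrite gE.
have ub' : (\int[P]_w ((central delta k n w)%:R * expR (lambda * log_excess X n q alpha w))%:E
    <= (hi ^+ q)%:E * P [set w | central delta k n w])%E.
  by rewrite -Pg E1 E2; exact: ub.
have lb' : ((lo ^+ q)%:E * P [set w | central delta k n w] <=
    \int[P]_w ((central delta k n w)%:R * expR (lambda * log_excess X n q alpha w))%:E)%E.
  by rewrite -Pg E1 E2; exact: lb.
have kr : k%:R = q%:R + 1 :> R by rewrite kq natr1.
rewrite mgfE; split.
- apply: (@le_trans _ _ ((expR (- (lambda * k%:R * m)))%:E * ((lo ^+ q)%:E * P [set w | central delta k n w]))%E); last first.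
    by rewrite lee_wpmul2l// lee_fin expR_ge0.
  rewrite muleA -EFinM; apply: lee_wpmul2r; first exact: measure_ge0.
  rewrite lee_fin /lo -expRM_natl -expRD ler_expR.
  rewrite kr -/q /lambda exprMn exprMn sigma2 le_eqVlt; apply/orP; left; apply/eqP; by field.
- apply: (@le_trans _ _ ((expR (- (lambda * k%:R * m)))%:E * (hi ^+ q)%:E)%E).
    rewrite lee_wpmul2l ?lee_fin ?expR_ge0//; apply: (le_trans ub').
    rewrite -[leRHS]mule1 lee_wpmul2l ?lee_fin ?exprn_ge0 ?expR_ge0//.
    apply: probability_le1; apply: measurable_bool_set; exact: measurable_central.
  rewrite -EFinM lee_fin /hi -expRM_natl -expRD ler_expR.
  rewrite kr -/q /lambda exprMn exprMn sigma2 le_eqVlt; apply/orP; left; apply/eqP; by field.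
Qed.

End CentralMoments.

(** * Limits along the intermediate sequence *)

Section Asymptotics.
Context {R : realType} {d : measure_display} {T : measurableType d}.
Variables (P : probability T R) (alpha rho : R) (U A : R -> R).
Variables (X : nat -> {RV P >-> R}) (k : nat -> nat) (theta : nat -> R).
Hypothesis alpha_gt0 : 0 < alpha.
Hypothesis U_RV : RV' (alpha^-1) U.
Hypothesis U_A : second_order alpha rho U A.
Hypothesis rho_lt0 : rho < 0.
Hypothesis X_iid : iid_RV U X.
Hypothesis k_int : intermediate (R := R) k.
Hypothesis theta_gt0 : forall j, (0 < j)%N -> 0 < theta j.
Hypothesis theta_cvg0 : theta (k n) @[n --> \oo] --> 0.
Hypothesis ktheta2_cvgy : (k n)%:R * theta (k n) ^+ 2 @[n --> \oo] --> +oo.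
Hypothesis A_bigO : (fun n => `|A (n%:R / (k n)%:R)| : R^o) =O_\oo
            (fun n => theta (k n) : R^o).

Let N n : R := (k n)%:R * theta (k n) ^+ 2.

Let k_bounds : \forall n \near \oo, (0 < k n <= n)%N.
Proof.
have [ky k0] := k_int.
near=> n.
have n0 : (0 < n)%N by near: n; exact: nbhs_infty_gt.
have -> /= : (0 < k n)%N by near: n; exact: (ky _ (nbhs_infty_ge 1)).
have : `|0 - (k n)%:R / n%:R| <= 1 :> R.
  by near: n; move/cvgrPdist_le: k0; apply.
rewrite sub0r normrN ger0_norm ?divr_ge0//.
by rewrite ler_pdivrMr ?ltr0n// mul1r ler_nat.
Unshelve. all: by end_near. Qed.

Let log_large (M : R) : \forall n \near \oo, M <= ln (n%:R / (k n)%:R).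
Proof.
have [_ k0] := k_int.
near=> n.
have /andP[kn1 kn2] : (0 < k n <= n)%N by near: n; exact: k_bounds.
have n0 : (0 < n)%N by exact: leq_trans kn2.
have : `|0 - (k n)%:R / n%:R| <= expR (- M) :> R.
  by near: n; move/cvgrPdist_le: k0; apply; exact: expR_gt0.
rewrite sub0r normrN ger0_norm ?divr_ge0// => h.
have q0 : 0 < n%:R / (k n)%:R :> R by rewrite divr_gt0 ?ltr0n.
rewrite -ler_expR lnK ?posrE// -[leRHS]invf_div -[leLHS]invrK -expRN.
by rewrite lef_pV2 ?posrE ?expR_gt0// divr_gt0 ?ltr0n.
Unshelve. all: by end_near. Qed.

Let theta_small (e : R) : 0 < e -> \forall n \near \oo, theta (k n) <= e.
Proof.
move=> e0; have /cvgrPdistC_le /(_ _ e0) := theta_cvg0.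
by apply: filterS => n; rewrite subr0; apply: le_trans; exact: ler_norm.
Qed.

Let N_large (M : R) : \forall n \near \oo, M <= N n.
Proof. by have /cvgryPge := ktheta2_cvgy; exact. Qed.

Let A_bound : exists K, 0 <= K /\
  \forall n \near \oo, `|A (n%:R / (k n)%:R)| <= K * theta (k n).
Proof.
have /eqO_bigO [M [_ hM]] := A_bigO.
pose K := Num.max M 0 + 1.
have MK : M < K by rewrite /K ltr_pwDr// le_max lexx.
have K0 : 0 <= K by rewrite /K addr_ge0// le_max lexx orbT.
exists K; split => //; have := hM _ MK => hK.
near=> n.
have /andP[kn1 kn2] : (0 < k n <= n)%N by near: n; exact: k_bounds.
have : `| `|A (n%:R / (k n)%:R)| | <= K * `|theta (k n)|.
  by near: n; exact: hK.
by rewrite normr_id (gtr0_norm (theta_gt0 kn1)).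
Unshelve. all: by end_near. Qed.

Lemma deviation_rate (sigma eta : R) : sigma ^+ 2 = 1 -> 0 < eta -> eta <= 1 ->
  \forall n \near \oo,
    let p := fine (P [set w | N n < deviation alpha rho A X sigma (theta (k n)) (k n) n w]) in
    expR (- (N n * (1 / 2 + 6 * eta))) <= p /\ p <= expR (- (N n * (1 / 2 - 2 * eta))).
Proof.
move=> sigma2 eta0 eta1.
have [K [K0 A_le]] := A_bound.
(* Half of the margin [eta ^+ 2 / 8] allowed in the deviation bounds; the other half, times [N],
   pays for the bounded terms. *)
pose eps := eta ^+ 2 / 16.
have eps0 : 0 < eps by rewrite divr_gt0// exprn_gt0.
pose cs := [:: 1; 1 + eta; 1 + 2 * eta].
have cs_range c : c \in cs -> 0 <= c /\ c <= 3.
  by rewrite !inE => /or3P[] /eqP ->; split; lra.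
have mgf c := central_mgf alpha_gt0 U_RV U_A rho_lt0 X_iid c eps0 K0.
have [d1 [d10 H1]] := mgf 1.
have [d2 [d20 H2]] := mgf (1 + eta).
have [d3 [d30 H3]] := mgf (1 + 2 * eta).
pose delta := Num.min d1 (Num.min d2 d3).
have delta0 : 0 < delta by rewrite !lt_min d10 d20 d30.
have [s1 [t1 [t10 {}H1]]] := H1 delta delta0 ltac:(by rewrite ge_min lexx).
have [s2 [t2 [t20 {}H2]]] := H2 delta delta0 ltac:(by rewrite !ge_min lexx orbT).
have [s3 [t3 [t30 {}H3]]] := H3 delta delta0 ltac:(by rewrite !ge_min lexx !orbT).
have [kappa [kappa0 [s4 H4]]] :=
  order_stat_concentration X_iid.1 alpha_gt0 U_RV U_A rho_lt0 X_iid.2 delta0.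
pose M := 1 + alpha * K / (1 - rho).
have r1 : 0 < 1 - rho by have := rho_lt0; lra.
have M0 : 0 <= M by rewrite addr_ge0// divr_ge0 ?(ltW r1)// mulr_ge0// ltW.
near=> n.
have kn : (0 < k n <= n)%N by near: n; exact: k_bounds.
have k0 : (0 < k n)%N by case/andP: kn.
have th_t1 : theta (k n) <= t1 by near: n; exact: theta_small.
have th_t2 : theta (k n) <= t2 by near: n; exact: theta_small.
have th_t3 : theta (k n) <= t3 by near: n; exact: theta_small.
have th_1 : theta (k n) <= 1 by near: n; apply: theta_small.
(* With [theta <= 1] this gives [k * theta ^+ 2 <= kappa * k], so the atypical event has probability
   at most [2 * expR (- N)]. *)
have th_k : theta (k n) <= kappa by near: n; exact: theta_small.
have s_1 : s1 <= ln (n%:R / (k n)%:R) by near: n; exact: log_large.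
have s_2 : s2 <= ln (n%:R / (k n)%:R) by near: n; exact: log_large.
have s_3 : s3 <= ln (n%:R / (k n)%:R) by near: n; exact: log_large.
have s_4 : s4 <= ln (n%:R / (k n)%:R) by near: n; exact: log_large.
have An : `|A (n%:R / (k n)%:R)| <= K * theta (k n) by near: n; exact: A_le.
(* [3 * M] bounds the term [sigma * c * th * m] for [c <= 3], and 5 covers the replacement of
   [k - 1] by [k]. The thresholds 7 and 3 below become 8 and 4 through [expR x >= 1 + x]. *)
have N1 : (3 * M + 5) / eps <= N n by near: n; exact: N_large.
have N2 : 7 / (eta ^+ 2 / 4) <= N n by near: n; exact: N_large.
have N3 : 3 / eta <= N n by near: n; exact: N_large.
have N4 : 3 <= N n by near: n; exact: N_large.
have th_gt0 : 0 < theta (k n) by exact: theta_gt0.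
set th := theta (k n) in th_t1 th_t2 th_t3 th_1 th_k An th_gt0 *.
have NE : N n = (k n)%:R * th ^+ 2 by [].
move: (N n) NE N1 N2 N3 N4 => NN NE N1 N2 N3 N4.
pose a := A (n%:R / (k n)%:R); rewrite -/a in An.
pose m := 1 + alpha * a / (1 - rho).
have m_le : `|m| <= M.
  apply: (le_trans (ler_normD _ _)); rewrite normr1 lerD2l normrM normfV (gtr0_norm r1).
  rewrite ler_wpM2r ?invr_ge0 ?(ltW r1)// normrM (gtr0_norm alpha_gt0) ler_wpM2l ?(ltW alpha_gt0)//.
  by apply: (le_trans An); rewrite ler_piMr.
have s_le1 : `|sigma| = 1.
  by move/eqP: sigma2; rewrite sqrf_eq1 => /orP[] /eqP ->; rewrite ?normrN normr1.
have smc c : 0 <= c -> c <= 3 -> `|sigma * c * th * m| <= 3 * M.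
  move=> c0 c3; rewrite !normrM s_le1 mul1r (ger0_norm c0) (gtr0_norm th_gt0).
  apply: ler_pM => //; first by rewrite mulr_ge0// ltW.
  by rewrite -[leRHS]mulr1; apply: ler_pM => //; exact: ltW.
have NE1 : (k n).-1%:R * th ^+ 2 = NN - th ^+ 2.
  by rewrite NE -{2}(prednK k0) -natr1; ring.
have th2 : th ^+ 2 <= th by rewrite expr2 ler_piMl// ltW.
have th20 : 0 <= th ^+ 2 by exact: sqr_ge0.
have N1' : 3 * M + 5 <= NN * eps by rewrite -ler_pdivrMr.
have NN0 : 0 < NN by lra.
have exp_ub c : 0 <= c -> c <= 3 ->
    - (sigma * c * th * m) + (k n).-1%:R * (c ^+ 2 / 2 + eps) * th ^+ 2 <=
    NN * (c ^+ 2 / 2 + eta ^+ 2 / 8).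
  move=> c0 c3; have := smc c c0 c3; rewrite ler_norml => /andP[h _].
  rewrite [(k n).-1%:R * _ * _]mulrAC NE1 mulrBl.
  have : 0 <= th ^+ 2 * (c ^+ 2 / 2 + eps).
    apply: mulr_ge0 => //; apply: addr_ge0; last exact: ltW.
    by apply: divr_ge0 => //; exact: sqr_ge0.
  have -> : NN * (c ^+ 2 / 2 + eta ^+ 2 / 8) = NN * (c ^+ 2 / 2 + eps) + NN * eps.
    by rewrite /eps; field.
  move: N1' h M0; move: (NN * (c ^+ 2 / 2 + eps)) (NN * eps) (th ^+ 2 * _) (sigma * c * th * m) => u1 u2 u3 u4.
  by lra.
have exp_lb c : 0 <= c -> c <= 3 ->
    NN * (c ^+ 2 / 2 - eta ^+ 2 / 8) <=
    - (sigma * c * th * m) + (k n).-1%:R * (c ^+ 2 / 2 - eps) * th ^+ 2.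
  move=> c0 c3; have := smc c c0 c3; rewrite ler_norml => /andP[_ h].
  rewrite [(k n).-1%:R * _ * _]mulrAC NE1 mulrBl.
  have : th ^+ 2 * (c ^+ 2 / 2 - eps) <= 5.
    apply: (@le_trans _ _ (1 * (9 / 2))); last by lra.
    apply: (@le_trans _ _ (th ^+ 2 * (9 / 2))).
      apply: ler_wpM2l => //; rewrite lerBlDr.
      have : c ^+ 2 <= 3 ^+ 2 by rewrite ler_sqr ?nnegrE.
      by rewrite [3 ^+ 2]expr2; move: eps0; move: (c ^+ 2) (eps) => z e; lra.
    by rewrite ler_wpM2r// (le_trans th2).
  have -> : NN * (c ^+ 2 / 2 - eta ^+ 2 / 8) = NN * (c ^+ 2 / 2 - eps) - NN * eps.
    by rewrite /eps; field.
  move: N1' h M0; move: (NN * (c ^+ 2 / 2 - eps)) (NN * eps) (th ^+ 2 * _) (sigma * c * th * m) => u1 u2 u3 u4.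
  by lra.
have [lb1 ub1] := H1 _ n sigma th kn sigma2 s_1 th_gt0 th_t1 An.
have [lb2 ub2] := H2 _ n sigma th kn sigma2 s_2 th_gt0 th_t2 An.
have [lb3 ub3] := H3 _ n sigma th kn sigma2 s_3 th_gt0 th_t3 An.
rewrite -/a -/m in lb1 ub1 lb2 ub2 lb3 ub3.
have mW := @measurable_deviation _ _ _ P alpha rho A X sigma th _ _ kn.
have mg := @measurable_central _ _ _ P U X delta _ _ kn.
have [c1 c2] := H4 n (k n) _ kn erefl s_4.
have central_likely : (P [set w | ~~ central U X delta (k n) n w] <= (2 * expR (- NN))%:E)%E.
  have mOS : measurable_fun setT (order_stat X (k n) n) by exact: measurable_order_stat.
  set E1 := [set w | _] in c1; set E2 := [set w | _] in c2.
  have mE1 : measurable E1.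
    by apply: measurable_bool_set; exact: measurable_fun_ler.
  have mE2 : measurable E2.
    by apply: measurable_bool_set; exact: measurable_fun_ler.
  apply: (@le_trans _ _ (P (E1 `|` E2))).
    apply: le_measure; rewrite ?inE.
    - by apply: measurable_bool_set; exact: measurable_neg.
    - exact: measurableU.
    - by move=> w /=; rewrite /central negb_and -!leNgt => /orP[]; [left|right].
  have := @measureU2 _ _ _ P _ _ mE1 mE2; move=> /le_trans; apply; apply: (le_trans (leeD c1 c2)).
  have h : expR (- (kappa * (k n)%:R)) <= expR (- NN).
    by rewrite ler_expR lerN2 NE mulrC ler_wpM2r// (le_trans th2).
  by rewrite -EFinD lee_fin mulr_natl mulr2n lerD.
have exp4 : 4 <= expR NN by apply: le_trans (expR_ge1Dx _); lra.
have half : ((1 / 2)%:E <= P [set w | central U X delta (k n) n w])%E.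
  have mc : measurable [set w | central U X delta (k n) n w] by exact: measurable_bool_set.
  have := probability_setC P mc.
  have -> : ~` [set w | central U X delta (k n) n w] = [set w | ~~ central U X delta (k n) n w].
    by apply/seteqP; split => w /= /negP.
  move=> e; move: central_likely; rewrite e.
  have fin : P [set w | central U X delta (k n) n w] \is a fin_num by exact: fin_num_measure.
  rewrite -(fineK fin) -EFinB !lee_fin.
  have : expR (- NN) <= 4^-1 by rewrite expRN lef_pV2 ?posrE ?expR_gt0.
  by lra.
have c_ub c : c \in cs -> (trunc_mgf P (deviation alpha rho A X sigma th (k n) n)
    (central U X delta (k n) n) c <= (expR (NN * (c ^+ 2 / 2 + eta ^+ 2 / 8)))%:E)%E.
  move=> cc; have [c0 c3] := cs_range c cc; move: cc c0 c3.
  rewrite !inE => /or3P[] /eqP -> c0 c3.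
  - by apply: (le_trans ub1); rewrite lee_fin ler_expR; exact: exp_ub.
  - by apply: (le_trans ub2); rewrite lee_fin ler_expR; exact: exp_ub.
  - by apply: (le_trans ub3); rewrite lee_fin ler_expR; exact: exp_ub.
have c_lb : ((1 / 2 * expR (NN * ((1 + eta) ^+ 2 / 2 - eta ^+ 2 / 8)))%:E <=
    trunc_mgf P (deviation alpha rho A X sigma th (k n) n) (central U X delta (k n) n) (1 + eta))%E.
  apply: le_trans lb2; rewrite mulrC EFinM; apply: lee_pmul => //; rewrite lee_fin ?expR_ge0 ?ler_expR//.
  by apply: exp_lb; lra.
have L1 : 8 <= expR (NN * (eta ^+ 2 / 4)).
  apply: le_trans (expR_ge1Dx _).
  have : 7 <= NN * (eta ^+ 2 / 4) by rewrite -ler_pdivrMr// divr_gt0// exprn_gt0.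
  by lra.
have L2 : 4 <= expR (NN * eta).
  apply: le_trans (expR_ge1Dx _).
  have : 3 <= NN * eta by rewrite -ler_pdivrMr.
  by lra.
split.
- exact: (deviation_rate_lb mW mg NN0 eta0 eta1 c_ub c_lb L1).
- exact: (deviation_rate_ub mW mg NN0 eta0 eta1 c_ub central_likely L2).
Unshelve. all: by end_near. Qed.

End Asymptotics.

(** The lower bound keeps [p n] finite and positive, so [lne] is an ordinary logarithm for large
    [n]; dividing the logarithmic bounds by [N / 2] gives limits 1 up to multiples of [eta]. *)
Lemma asymp_equiv_rate {R : realType} (p : nat -> \bar R) (N : nat -> R) :
  N n @[n --> \oo] --> +oo ->
  (forall eta, 0 < eta -> eta <= 1 -> \forall n \near \oo,
    expR (- (N n * (1 / 2 + 6 * eta))) <= fine (p n) /\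
    fine (p n) <= expR (- (N n * (1 / 2 - 2 * eta)))) ->
  asymp_equiv (fun n => - lne (p n))%E (fun n => N n / 2).
Proof.
move=> Ny rate; have N_gt0 : \forall n \near \oo, 0 < N n by move/cvgryPgt: Ny; exact.
have lnE n : 0 < fine (p n) -> (- lne (p n) * ((N n / 2)^-1)%:E)%E = (- ln (fine (p n)) / (N n / 2))%:E.
  by case: (p n) => [r||]; rewrite /= ?ltxx// leNgt => ->.
apply/fine_cvgP; split.
  have := rate 1 ltr01 (lexx _); apply: filterS => n [h _].
  by rewrite lnE// (lt_le_trans (expR_gt0 _) h).
apply/cvgrPdist_le => e e0.
(* The slack [6 * eta] relative to 1/2 is [12 * eta]. *)
pose eta := Num.min 1 (e / 12).
have eta0 : 0 < eta by rewrite lt_min ltr01 divr_gt0.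
have eta1 : eta <= 1 by rewrite ge_min lexx.
have etae : 12 * eta <= e by rewrite mulrC -ler_pdivlMr// ge_min lexx orbT.
move: N_gt0 (rate eta eta0 eta1); apply: filterS2 => n N0 [lb ub].
have p0 : 0 < fine (p n) := lt_le_trans (expR_gt0 _) lb.
rewrite /= lnE//= ler_distlC.
have lb' : - ln (fine (p n)) <= N n * (1 / 2 + 6 * eta).
  by rewrite lerNl -[leLHS]expRK ler_ln ?posrE ?expR_gt0.
have ub' : N n * (1 / 2 - 2 * eta) <= - ln (fine (p n)).
  by rewrite lerNr -[leRHS]expRK ler_ln ?posrE ?expR_gt0.
rewrite ler_pdivlMr ?divr_gt0// ler_pdivrMr ?divr_gt0//; apply/andP; split.
  apply: le_trans ub'; rewrite mulrCA ler_pM2l//; lra.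
apply: (le_trans lb'); rewrite [leRHS]mulrCA ler_pM2l//; lra.
Qed.

Theorem theorem3 (R : realType) (d : measure_display) (T : measurableType d)
  (P : probability T R) (alpha rho : R) (U A : R -> R)
  (X : nat -> {RV P >-> R}) (k : nat -> nat) (theta : nat -> R)
  (alpha_gt0 : 0 < alpha)
  (U_RV : RV' (alpha^-1) U)
  (U_A : second_order alpha rho U A)
  (rho_lt0 : rho < 0)
  (X_iid : iid_RV U X)
  (k_int : intermediate (R := R) k)
  (theta_gt0 : forall j, (0 < j)%N -> 0 < theta j)
  (theta_cvg0 : theta (k n) @[n --> \oo] --> 0)
  (ktheta2_cvgy : (k n)%:R * theta (k n) ^+ 2 @[n --> \oo] --> +oo)
  (A_bigO : (fun n => `|A (n%:R / (k n)%:R)| : R^o) =O_\oo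
            (fun n => theta (k n) : R^o)) :
  asymp_equiv
    (fun n => - lne (P [set w |
       (1 + theta (k n) < alpha * hill_corrected rho A X (k n) n w)%R]))%E
    (fun n => (k n)%:R / 2 * theta (k n) ^+ 2) /\
  asymp_equiv
    (fun n => - lne (P [set w |
       (alpha * hill_corrected rho A X (k n) n w < 1 - theta (k n))%R]))%E
    (fun n => (k n)%:R / 2 * theta (k n) ^+ 2).
Proof.
have k_gt0 : \forall n \near \oo, (0 < k n)%N by exact: (k_int.1 _ (nbhs_infty_gt 0)).
have rate sigma s2 eta eta0 eta1 := deviation_rate alpha_gt0 U_RV U_A rho_lt0 X_iid k_int
  theta_gt0 theta_cvg0 ktheta2_cvgy A_bigO (sigma := sigma) s2 (eta := eta) eta0 eta1.
have NE n : (k n)%:R / 2 * theta (k n) ^+ 2 = (k n)%:R * theta (k n) ^+ 2 / 2 by rewrite mulrAC.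
(* Both tails at once, with [sigma] equal to 1 or -1: multiplying the inequality by [k * theta > 0]
   gives the event [N < deviation]. *)
have evE sigma (E : nat -> set T) : sigma ^+ 2 = 1 ->
    (forall n w, (0 < k n)%N -> E n w <->
      (theta (k n) < sigma * (alpha * hill_corrected rho A X (k n) n w - 1))) ->
    asymp_equiv (fun n => - lne (P (E n)))%E (fun n => (k n)%:R / 2 * theta (k n) ^+ 2).
  move=> s2 hE; under [X in asymp_equiv _ X]eq_fun do rewrite NE.
  apply: asymp_equiv_rate => // eta eta0 eta1.
  move: k_gt0 (rate sigma s2 eta eta0 eta1); apply: filterS2 => n k0.
  suff -> : E n = [set w | (k n)%:R * theta (k n) ^+ 2 <
    deviation alpha rho A X sigma (theta (k n)) (k n) n w] by [].
  have th0 : 0 < (k n)%:R * theta (k n) by rewrite mulr_gt0 ?ltr0n ?theta_gt0.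
  apply/funext => w; apply/propext; rewrite hE// /= -(ltr_pM2l th0) -mulrA -expr2.
  suff -> : deviation alpha rho A X sigma (theta (k n)) (k n) n w =
      (k n)%:R * theta (k n) * (sigma * (alpha * hill_corrected rho A X (k n) n w - 1)) by [].
  by rewrite /deviation; ring.
split.
- by apply: (evE 1) => [|n w k0 /=]; [rewrite expr1n|rewrite mul1r ltrBrDl].
- apply: (evE (-1)) => [|n w k0 /=]; first by rewrite sqrrN expr1n.
  by rewrite mulN1r opprB ltrBrDl -ltrBrDr.
Qed.
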